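(* Let $(E,\varepsilon)$ be a (general, not necessarily Lie) algebroid over a manifold $M$, with bundle projection $\tau:E\to M$ and left and right anchors $\rho,\sigma:E\to TM$. Let $L:E\to\mathbb{R}$ be a Lagrangian of mechanical type, $L(e)=\frac12\mathcal{G}(e,e)-V(\tau(e))$, where $\mathcal{G}$ is a bundle metric on $E$ and $V:M\to\mathbb{R}$ is a smooth function. Let $D\subset E$ be a vector subbundle over a submanifold $D_M\subset M$ with $\rho(D)\subset TD_M$ and $\sigma(D)\subset TD_M$. Let $P:E_{|D_M}\to D$ be the $\mathcal{G}$-orthogonal projection, $\varepsilon_P$ the nonholonomic restriction of $\varepsilon$ to $D$ along $P$, and $l=L_{|D}$. Let $X$ be a section of $D$ and $f$ a smooth function on $D_M$. Denote by $\iota_X:D^*\to\mathbb{R}$ the fibrewise linear function defined by $X$ and by $\pi_D:D^*\to D_M$ the bundle projection. The following are equivalent: (a) the pair $(X,f)$ is a symmetry of the nonholonomic problem associated with the Lagrangian, i.e. $\mathrm{d}_T^{\varepsilon_P}(X)(l)=\mathrm{d}_T^{\varepsilon_P}(f)$ as functions on $D$; (b) the function $\iota_X-f\circ\pi_D$ on $D^*$ is a constant of the motion of the nonholonomic phase dynamics on $D^*$, i.e. the function $\mathrm{d}_T(\iota_X-f\circ\pi_D):TD^*\to\mathbb{R}$ vanishes on $\Gamma_L^D=\Lambda_L^D(D)\subset TD^*$; (c) the function $(\iota_X-f\circ\pi_D)\circ\lambda_L^D$ on $D$ is a constant of the motion for the nonholonomic Euler-Lagrange equation, i.e. it is constant along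 every solution $\gamma$ in $D$ of the nonholonomic Euler-Lagrange equation of $L$ with constraint $D$.
   Context: Everything is smooth; a bundle metric is a smooth family of (positive definite) inner products on the fibres. **Algebroids.** An algebroid structure on a vector bundle $\tau:E\to M$ (dual bundle $\pi:E^*\to M$) is an $\mathbb{R}$-bilinear bracket $[\cdot,\cdot]_\varepsilon$ on sections of $E$ together with vector bundle morphisms $\rho,\sigma:E\to TM$ over $\mathrm{id}_M$ (left and right anchors) such that $$[fX,gY]_\varepsilon=f\rho(X)(g)\,Y-g\,\sigma(Y)(f)\,X+fg[X,Y]_\varepsilon$$ for functions $f,g$ on $M$ and sections $X,Y$ of $E$. No skew-symmetry or Jacobi identity is required. Equivalently, it is a morphism of double vector bundles $\varepsilon:T^*E\to TE^*$ covering the identity of $E^*$, given as follows. Let $(x^i)$ be local coordinates on $M$ and $\{e_a\}$ a local basis of sections of $E$, with induced coordinates $(x^i,y^a)$ on $E$, $(x^i,\xi_a)$ on $E^*$, $(x^i,y^a,p_j,\xi_b)$ on $T^*E$ (the covector $p_j\,\mathrm{d}x^j+\xi_b\,\mathrm{d}y^b$ at $(x,y)$) and $(x^i,\xi_a,\dot x^j,\dot\xi_b)$ on $TE^*$. Write $[e_a,e_b]_\varepsilon=\mathcal{C}^c_{ab}e_c$, $\rho(e_a)=\rho^i_a\partial_{x^i}$, $\sigma(e_a)=\sigma^i_a\partial_{x^i}$. Then (summation convention) $$\varepsilon(x^i,y^a,p_j,\xi_b)=\bigl(x^i,\ \xi_a,\ \rho^j_c(x)y^c,\ \mathcal{C}^c_{ab}(x)y^a\xi_c+\sigma^i_b(x)p_i\bigr).$$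 **Nonholonomic dynamics.** Let $i_D^*:E^*_{|D_M}\to D^*$ be the map dual to the inclusion $D\hookrightarrow E_{|D_M}$. Since $\rho(D)\subset TD_M$, $\varepsilon$ maps $(T^*E)_{|D}$ into $T(E^*_{|D_M})$. The constrained Tulczyjew differential is $$\Lambda_L^D=Ti_D^*\circ\varepsilon\circ \mathrm{d}L_{\,|D}:D\to TD^*$$ (here $\mathrm{d}L$ is the differential of $L$ on $E$, evaluated at points of $D$). The constrained Legendre map is $\lambda_L^D=\tau_{D^*}\circ\Lambda_L^D:D\to D^*$, where $\tau_{D^*}:TD^*\to D^*$ is the tangent projection; equivalently $\lambda_L^D=i_D^*\circ\lambda_{L|D}$ with $\lambda_L=\tau_{E^*}\circ\varepsilon\circ \mathrm{d}L:E\to E^*$. The nonholonomic phase dynamics is the implicit differential equation $\Gamma_L^D=\Lambda_L^D(D)\subset TD^*$. A curve $\gamma$ in $D$ is a solution of the nonholonomic Euler-Lagrange equation if $\mathbf{t}(\lambda_L^D\circ\gamma)=\Lambda_L^D\circ\gamma$, where $\mathbf{t}\beta(t)=(\beta(t),\dot\beta(t))$ is the tangent prolongation of a curve $\beta$. **Nonholonomic restriction of an algebroid.** Assume $\rho(D)\subset TD_M$ and $\sigma(D)\subset TD_M$, and let $P:E_{|D_M}\to D$ be a vector bundle projection onto $D$. For sections $X,Y$ of $D$, the restriction to $D_M$ of the bracket of any local extensions of $X,Y$ to sections of $E$ does not depend on the extensions; it is a section of $E_{|D_M}$ denoted $[X,Y]_\varepsilon$. The nonholonomic restriction $\varepsilon_P$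 is the algebroid structure on $D\to D_M$ with bracket $[X,Y]_{\varepsilon_P}=P([X,Y]_\varepsilon)$ and anchors $\rho_{|D},\sigma_{|D}:D\to TD_M$. **Lifts.** For a function $g$ on a manifold $N$, $\mathrm{d}_T(g):TN\to\mathbb{R}$ is the function $v\mapsto \mathrm{d}g(v)$. For an algebroid $(E,\varepsilon)$ over $M$, the complete lift $\mathrm{d}_T^\varepsilon(f)$ of a function $f$ on $M$ is the function $e\mapsto \mathrm{d}f(\rho(e))$ on $E$, i.e. $y^a\rho^i_a\,\partial f/\partial x^i$. The complete lift $\mathrm{d}_T^\varepsilon(X)$ of a section $X$ of $E$ is the vector field on $E$ determined by $\iota(\mathrm{d}_T^\varepsilon(X))=\mathrm{d}_T(\iota_X)\circ\varepsilon$, where $\iota_X$ is the linear function on $E^*$ defined by $X$ and $\iota(Z)$ is the linear function on $T^*E$ defined by a vector field $Z$ on $E$. In local coordinates, $$\mathrm{d}_T^\varepsilon(f^ae_a)=f^a\sigma^i_a\,\partial_{x^i}+\Bigl(y^a\rho^i_a\frac{\partial f^c}{\partial x^i}+\mathcal{C}^c_{ab}y^af^b\Bigr)\partial_{y^c}.$$ In the claim these lifts are taken for the algebroid $(D,\varepsilon_P)$ over $D_M$. *)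

(* Defs.v *)
From HB Require Import structures.
From mathcomp Require Import all_boot all_order all_algebra.
From mathcomp Require Import all_classical all_reals all_analysis.

Set Implicit Arguments.
Unset Strict Implicit.
Unset Printing Implicit Defensive.

Import Order.TTheory GRing.Theory Num.Theory.
Import numFieldNormedType.Exports.

Local Open Scope classical_set_scope.
Local Open Scope ring_scope.

(** * Smooth maps between (finite-dimensional) normed spaces *)

Fixpoint Ck (R : realType) (V W : normedModType R) (k : nat)
    (U : set V) (f : V -> W) : Prop :=
  if k is k'.+1 then
    (forall x, U x -> differentiable f x) /\ (forall v, Ck k' U ('D_v f))
  else forall x, U x -> {for x, continuous f}.

(* Only meant for open sets U. *)
Definition smooth_on (R : realType) (V W : normedModType R)
    (U : set V) (f : V -> W) : Prop :=
  forall k, Ck k U f.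

(** * Charts and manifolds *)

(* Bare chart data, without axioms, so that the total spaces of vector bundles
   carry it too without being given a topology.  [cmap c] and [cinv c] matter only
   on [cdom c] and on its image; [chart_at x] is a chosen chart around [x]. *)
Record charted (R : realType) (T : Type) := Charted {
  cdim : nat;
  cidx : Type;
  cdom : cidx -> set T;
  cmap : cidx -> T -> 'rV[R]_cdim;
  cinv : cidx -> 'rV[R]_cdim -> T;
  chart_at : T -> cidx
}.

Record is_manifold (R : realType) (T : topologicalType) (A : charted R T) :
    Prop :=
IsManifold {
  mfd_hausdorff : hausdorff_space T;
  mfd_second_countable : @second_countable T;
  mfd_at : forall x, cdom (chart_at A x) x;
  mfd_dom_open : forall c : cidx A, open (cdom c);
  mfd_im_open : forall c : cidx A, open (cmap c @` cdom c);
  mfd_mapK : forall (c : cidx A) x, cdom c x -> cinv c (cmap c x) = x;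
  mfd_map_cont : forall (c : cidx A) x, cdom c x -> {for x, continuous (cmap c)};
  mfd_inv_cont : forall (c : cidx A) x, cdom c x ->
    {for cmap c x, continuous (cinv c)};
  mfd_transition : forall c d : cidx A,
    smooth_on (cmap c @` (cdom c `&` cdom d)) (cmap d \o cinv c)
}.

Record manifold (R : realType) := Manifold {
  mfd_top :> topologicalType;
  atl : charted R mfd_top;
  mfdP : is_manifold atl
}.

(* g is smooth on the open set W. *)
Definition smooth_fun (R : realType) (T : Type) (A : charted R T)
    (V : normedModType R) (W : set T) (g : T -> V) : Prop :=
  forall c : cidx A, smooth_on (cmap c @` (cdom c `&` W)) (g \o cinv c).

Definition smooth_map (R : realType) (N M : manifold R) (h : N -> M) : Prop :=
  continuous h /\
  forall d : cidx (atl M), smooth_fun (atl N) (h @^-1` cdom d) (cmap d \o h).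

Definition smooth_curve (R : realType) (T : Type) (A : charted R T)
    (I : set R) (g : R -> T) : Prop :=
  forall c : cidx A, let J := I `&` g @^-1` cdom c in
    open J /\ smooth_on J (cmap c \o g).

(** * Tangent vectors and covectors *)

(* The tangent space at p is identified with R^n by means of the chosen chart
   [chart_at p] at p: the pair (p, v) is the tangent vector at p with
   components v in that chart. *)
Definition tangent_vec (R : realType) (T : Type) (A : charted R T) : Type :=
  (T * 'rV[R]_(cdim A))%type.

(* d_T(g) : v |-> dg(v) *)
Definition dT (R : realType) (T : Type) (A : charted R T) (V : normedModType R)
    (g : T -> V) (v : tangent_vec A) : V :=
  'D_(v.2) (g \o cinv (chart_at A v.1)) (cmap (chart_at A v.1) v.1).

Definition Tmap (R : realType) (T S : Type) (A : charted R T) (B : charted R S)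
    (h : T -> S) (v : tangent_vec A) : tangent_vec B :=
  (h v.1, dT (cmap (chart_at B (h v.1)) \o h) v).

(* Tangent prolongation t(beta) of a curve. *)
Definition tprol (R : realType) (T : Type) (A : charted R T)
    (beta : R -> T) (t : R) : tangent_vec A :=
  (beta t, derive1 (cmap (chart_at A (beta t)) \o beta) t).

(* Covectors at p are given by their components in the chart [chart_at p]. *)
Definition pair_cov (R : realType) (n : nat) (alpha v : 'rV[R]_n) : R :=
  \sum_i alpha 0 i * v 0 i.

Definition dcov (R : realType) (T : Type) (A : charted R T)
    (g : T -> R) (p : T) : 'rV[R]_(cdim A) :=
  \row_i dT g ((p, delta_mx 0 i) : tangent_vec A).

(** * Vector bundles *)

(* A family of vector spaces with local frames (again without axioms);
   [frame_at x] is a chosen local frame around x. *)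
Record framed (R : realType) (T : Type) := Framed {
  vb_rank : nat;
  fibre :> T -> vectType R;
  fidx : Type;
  fdom : fidx -> set T;
  frm : fidx -> 'I_vb_rank -> forall x, fibre x;
  frame_at : T -> fidx
}.

Definition vb_frame (R : realType) (T : Type) (E : framed R T) (k : fidx E)
    (x : T) : (vb_rank E).-tuple (E x) :=
  [tuple frm k a x | a < vb_rank E].

Definition fcoord (R : realType) (T : Type) (E : framed R T) (k : fidx E) (x : T)
    (v : E x) : 'rV[R]_(vb_rank E) :=
  \row_a coord (vb_frame k x) a v.

Record is_vbundle (R : realType) (M : manifold R) (E : framed R M) : Prop :=
IsVBundle {
  vb_at : forall x, fdom (frame_at E x) x;
  vb_dom_open : forall k : fidx E, open (fdom k);
  vb_basis : forall (k : fidx E) x, fdom k x -> basis_of fullv (vb_frame k x);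
  vb_transition : forall (k l : fidx E) (b : 'I_(vb_rank E)),
    smooth_fun (atl M) (fdom k `&` fdom l) (fun x => fcoord l (frm k b x))
}.

Record vbundle (R : realType) (M : manifold R) := VBundle {
  vb_framed :> framed R M;
  vbP : is_vbundle vb_framed
}.

(* The total space, with the induced coordinates (x^i, y^a). *)
Definition total_sp (R : realType) (T : Type) (A : charted R T) (E : framed R T) :
    charted R {x : T & E x} :=
  {| cdim := (cdim A + vb_rank E)%N;
     cidx := (cidx A * fidx E)%type;
     cdom := fun ck => [set e | cdom ck.1 (projT1 e) /\ fdom ck.2 (projT1 e)];
     cmap := fun ck e =>
       row_mx (cmap ck.1 (projT1 e)) (fcoord ck.2 (projT2 e));
     cinv := fun ck z => let x := cinv ck.1 (lsubmx z) in
       existT _ x (\sum_a rsubmx z 0 a *: frm ck.2 a x);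
     chart_at := fun e => (chart_at A (projT1 e), frame_at E (projT1 e)) |}.

(* E^*, with the dual frames. *)
Definition dualb (R : realType) (T : Type) (E : framed R T) : framed R T :=
  {| vb_rank := vb_rank E;
     fibre := fun x => 'Hom(E x, R^o);
     fidx := fidx E;
     fdom := @fdom R T E;
     frm := fun k a x => linfun (coord (vb_frame k x) a : E x -> R^o);
     frame_at := @frame_at R T E |}.

Definition pullb (R : realType) (S T : Type) (j : S -> T) (E : framed R T) :
    framed R S :=
  {| vb_rank := vb_rank E;
     fibre := fun s => E (j s);
     fidx := fidx E;
     fdom := fun k => j @^-1` fdom k;
     frm := fun k a s => frm k a (j s);
     frame_at := fun s => frame_at E (j s) |}.

(* TM, with the coordinate frames of the charts: the components of d/dx^i in the
   chosen chart at x. *)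
Definition tangent_bundle (R : realType) (T : Type) (A : charted R T) :
    framed R T :=
  {| vb_rank := cdim A;
     fibre := fun=> 'rV[R]_(cdim A);
     fidx := cidx A;
     fdom := @cdom R T A;
     frm := fun c i x =>
       'D_(delta_mx 0 i) (cmap (chart_at A x) \o cinv c) (cmap c x);
     frame_at := @chart_at R T A |}.

Definition sect (R : realType) (T : Type) (E : framed R T) : Type :=
  forall x, E x.

Definition smooth_sect (R : realType) (M : manifold R) (E : framed R M)
    (X : sect E) : Prop :=
  forall k : fidx E, smooth_fun (atl M) (fdom k) (fun x => fcoord k (X x)).

(* Vector bundle morphisms over the identity. *)
Definition smooth_hom (R : realType) (M : manifold R) (E F : framed R M)
    (h : forall x, 'Hom(E x, F x)) : Prop :=
  forall (k : fidx E) (l : fidx F) (a : 'I_(vb_rank E)),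
    smooth_fun (atl M) (fdom k `&` fdom l) (fun x => fcoord l (h x (frm k a x))).

(* iota_X *)
Definition iota_sect (R : realType) (T : Type) (E : framed R T) (X : sect E)
    (xi : {x : T & dualb E x}) : R :=
  projT2 xi (X (projT1 xi)).

Record bundle_metric (R : realType) (M : manifold R) (E : framed R M) :=
BundleMetric {
  metric_fun :> forall x, E x -> E x -> R;
  metric_linear : forall x (a : R) (u v w : E x),
    metric_fun (a *: u + v) w = a * metric_fun u w + metric_fun v w;
  metric_sym : forall x (u v : E x), metric_fun u v = metric_fun v u;
  metric_pos : forall x (u : E x), u != 0 -> 0 < metric_fun u u;
  metric_smooth : forall (k : fidx E) (a b : 'I_(vb_rank E)),
    smooth_fun (atl M) (fdom k) (fun x => metric_fun (frm k a x) (frm k b x))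
}.

(** * Algebroids *)

(* The bracket is only relevant on smooth sections. *)
Record algebroid (R : realType) (M : manifold R) (E : vbundle M) := Algebroid {
  abracket : sect E -> sect E -> sect E;
  anchor_left : forall x, 'Hom(E x, tangent_bundle (atl M) x);
  anchor_right : forall x, 'Hom(E x, tangent_bundle (atl M) x);
  rho_smooth : smooth_hom anchor_left;
  sigma_smooth : smooth_hom anchor_right;
  bracket_smooth : forall X Y : sect E,
    smooth_sect X -> smooth_sect Y -> smooth_sect (abracket X Y);
  bracket_linearl : forall (a : R) (X Y Z : sect E),
    smooth_sect X -> smooth_sect Y -> smooth_sect Z ->
    forall x, abracket (fun z => a *: X z + Y z) Z x
              = a *: abracket X Z x + abracket Y Z x;
  bracket_linearr : forall (a : R) (X Y Z : sect E),
    smooth_sect X -> smooth_sect Y -> smooth_sect Z ->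
    forall x, abracket Z (fun z => a *: X z + Y z) x
              = a *: abracket Z X x + abracket Z Y x;
  bracket_leibniz : forall (f g : M -> R) (X Y : sect E),
    smooth_fun (atl M) setT f -> smooth_fun (atl M) setT g ->
    smooth_sect X -> smooth_sect Y ->
    forall x, abracket (fun z => f z *: X z) (fun z => g z *: Y z) x
      = (f x * dT g ((x, anchor_left x (X x)) : tangent_vec (atl M))) *: Y x
        - (g x * dT f ((x, anchor_right x (Y x)) : tangent_vec (atl M))) *: X x
        + (f x * g x) *: abracket X Y x
}.

(* The bracket at x of sections defined around x: the value at x of the bracket of
   any global smooth sections with the same germs at x. *)
Definition local_bracket (R : realType) (M : manifold R) (E : vbundle M)
    (eps : algebroid E) (X Y : sect E) (x : M) : E x :=
  xget 0 [set w | exists X' Y' : sect E,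
    [/\ smooth_sect X', smooth_sect Y',
        \forall z \near x, X' z = X z, \forall z \near x, Y' z = Y z
      & w = abracket eps X' Y' x]].

(* C^c_ab(x), for the chosen frame around x. *)
Definition structure_fun (R : realType) (M : manifold R) (E : vbundle M)
    (eps : algebroid E) (x : M) (a b c : 'I_(vb_rank E)) : R :=
  coord (vb_frame (frame_at E x) x) c
    (local_bracket eps (frm (frame_at E x) a) (frm (frame_at E x) b) x).

(* The morphism T^*E -> TE^*, on the covector at e with components
   (p_j, xi_b) = alpha.  The coordinates (x^i, y^a) are those of the chosen chart
   and frame around x, which are also the ones in which the components of
   (co)tangent vectors at points of E and E^* over x are taken. *)
Definition eps_map (R : realType) (M : manifold R) (E : vbundle M)
    (eps : algebroid E) (e : {x : M & E x})
    (alpha : 'rV[R]_(cdim (atl M) + vb_rank E)) :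
    tangent_vec (total_sp (atl M) (dualb E)) :=
  let x := projT1 e in
  let k := frame_at E x in
  let y := fcoord k (projT2 e) in
  let p : 'rV[R]_(cdim (atl M)) := lsubmx alpha in
  let xi : 'rV[R]_(vb_rank E) := rsubmx alpha in
  (existT _ x (\sum_a xi 0 a *: frm (k : fidx (dualb E)) a x),
   row_mx (\sum_c y 0 c *: anchor_left eps x (frm k c x))
          (\row_b ((\sum_a \sum_c structure_fun eps x a b c * y 0 a * xi 0 c)
                   + pair_cov p (anchor_right eps x (frm k b x))))).

(* d_T^eps(f), for a function f on M *)
Definition clift_fun (R : realType) (M : manifold R) (E : vbundle M)
    (eps : algebroid E) (f : M -> R) (e : {x : M & E x}) : R :=
  dT f ((projT1 e, anchor_left eps (projT1 e) (projT2 e)) : tangent_vec (atl M)).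

(* d_T^eps(X), for a section X of E: the vector field Z on E determined by
   iota(Z) = d_T(iota_X) o eps *)
Definition clift_sect (R : realType) (M : manifold R) (E : vbundle M)
    (eps : algebroid E) (X : sect E) (e : {x : M & E x}) :
    tangent_vec (total_sp (atl M) E) :=
  (e, xget 0 [set Z | forall alpha,
        pair_cov alpha Z = dT (iota_sect X) (eps_map eps e alpha)]).

(** * Submanifolds and subbundles *)

(* A submanifold of M is given by its inclusion j. *)
Record is_submanifold (R : realType) (N M : manifold R) (j : N -> M) : Prop :=
IsSubmanifold {
  submfd_smooth : smooth_map j;
  submfd_inj : injective j;
  submfd_immersion : forall n : N, injective
    (fun v => Tmap (atl M) j ((n, v) : tangent_vec (atl N)));
  submfd_topology : forall U : set N, open U ->
    exists2 V : set M, open V & U = j @^-1` V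
}.

(* A subbundle of E over N is given by its fibrewise inclusion i over j. *)
Record is_subbundle (R : realType) (N M : manifold R) (j : N -> M)
    (E : vbundle M) (D : vbundle N) (i : forall n, 'Hom(D n, E (j n))) : Prop :=
IsSubbundle {
  subvb_smooth : @smooth_hom R N D (pullb j E) i;
  subvb_inj : forall n, injective (i n)
}.

(* h(D) is contained in TN. *)
Definition maps_into_tangent (R : realType) (N M : manifold R) (j : N -> M)
    (E : vbundle M) (D : vbundle N) (i : forall n, 'Hom(D n, E (j n)))
    (h : forall x, 'Hom(E x, tangent_bundle (atl M) x)) : Prop :=
  forall n (d : D n), exists v,
    Tmap (atl M) j ((n, v) : tangent_vec (atl N)) = (j n, h (j n) (i n d)).

Definition is_orthogonal_projection (R : realType) (N M : manifold R) (j : N -> M)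
    (E : vbundle M) (D : vbundle N) (i : forall n, 'Hom(D n, E (j n)))
    (G : bundle_metric E) (P : forall n, 'Hom(E (j n), D n)) : Prop :=
  forall n, (forall d, P n (i n d) = d) /\
            (forall v d, G (j n) (v - i n (P n v)) (i n d) = 0).

(* epsP is the nonholonomic restriction of eps along P; X' and Y' are local
   extensions, around n, of the sections X and Y of D. *)
Record is_nonholonomic_restriction (R : realType) (N M : manifold R) (j : N -> M)
    (E : vbundle M) (D : vbundle N) (i : forall n, 'Hom(D n, E (j n)))
    (eps : algebroid E) (P : forall n, 'Hom(E (j n), D n)) (epsP : algebroid D) :
    Prop :=
IsNonholonomicRestriction {
  nhr_bracket : forall (X Y : sect D) (X' Y' : sect E) (n : N),
    smooth_sect X -> smooth_sect Y -> smooth_sect X' -> smooth_sect Y' ->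
    (\forall m \near n, X' (j m) = i m (X m)) ->
    (\forall m \near n, Y' (j m) = i m (Y m)) ->
    abracket epsP X Y n = P n (abracket eps X' Y' (j n));
  nhr_rho : forall n (d : D n),
    Tmap (atl M) j ((n, anchor_left epsP n d) : tangent_vec (atl N))
      = (j n, anchor_left eps (j n) (i n d));
  nhr_sigma : forall n (d : D n),
    Tmap (atl M) j ((n, anchor_right epsP n d) : tangent_vec (atl N))
      = (j n, anchor_right eps (j n) (i n d))
}.

(** * Nonholonomic dynamics *)

Definition mechanical_lagrangian (R : realType) (M : manifold R) (E : vbundle M)
    (G : bundle_metric E) (V : M -> R) (e : {x : M & E x}) : R :=
  2^-1 * G (projT1 e) (projT2 e) (projT2 e) - V (projT1 e).

Section nonholonomic.
Variables (R : realType) (N M : manifold R) (j : N -> M).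
Variables (E : vbundle M) (D : vbundle N) (i : forall n, 'Hom(D n, E (j n))).

Definition bundle_incl (e : {n : N & D n}) : {x : M & E x} :=
  existT _ (j (projT1 e)) (i (projT1 e) (projT2 e)).

(* The inclusion of the restriction of E^* to N into E^*. *)
Definition dual_incl (q : {n : N & pullb j (dualb E) n}) : {x : M & dualb E x} :=
  existT _ (j (projT1 q)) (projT2 q).

(* i_D^* *)
Definition dual_restr (q : {n : N & pullb j (dualb E) n}) : {n : N & dualb D n} :=
  existT _ (projT1 q)
    ((projT2 q : 'Hom(E (j (projT1 q)), R^o)) \o i (projT1 q))%VF.

Variables (eps : algebroid E) (L : {x : M & E x} -> R).

(* Lambda_L^D.  [u] = eps(dL(e)) sits over a point [q] of the restriction of E^*
   to N, and [w] is [u] seen as a vector tangent to that restriction. *)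
Definition Lambda (e : {n : N & D n}) :
    tangent_vec (total_sp (atl N) (dualb D)) :=
  let u := eps_map eps (bundle_incl e)
    (dcov (total_sp (atl M) E) L (bundle_incl e)) in
  let q : {n : N & pullb j (dualb E) n} :=
    existT (fibre (pullb j (dualb E))) (projT1 e) (projT2 u.1) in
  let w := xget 0 [set w0 |
    Tmap (total_sp (atl M) (dualb E)) dual_incl
      ((q, w0) : tangent_vec (total_sp (atl N) (pullb j (dualb E)))) = u] in
  Tmap (total_sp (atl N) (dualb D)) dual_restr
    ((q, w) : tangent_vec (total_sp (atl N) (pullb j (dualb E)))).

Definition legendre_nh (e : {n : N & D n}) : {n : N & dualb D n} := (Lambda e).1.

Definition phase_dynamics : set (tangent_vec (total_sp (atl N) (dualb D))) :=
  range Lambda.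

Definition is_solution (I : set R) (gamma : R -> {n : N & D n}) : Prop :=
  smooth_curve (total_sp (atl N) D) I gamma /\
  forall t, I t ->
    tprol (total_sp (atl N) (dualb D)) (legendre_nh \o gamma) t
      = Lambda (gamma t).

Definition constant_on_phase_dynamics (g : {n : N & dualb D n} -> R) : Prop :=
  forall v, phase_dynamics v -> dT g v = 0.

Definition constant_on_solutions (F : {n : N & D n} -> R) : Prop :=
  forall (I : set R) (gamma : R -> {n : N & D n}),
    open I -> is_interval I -> is_solution I gamma ->
    forall s t, I s -> I t -> F (gamma s) = F (gamma t).

End nonholonomic.

(* (X, f) is a symmetry: d_T^epsP(X)(l) = d_T^epsP(f) *)
Definition is_symmetry (R : realType) (N : manifold R) (D : vbundle N)
    (epsP : algebroid D) (l : {n : N & D n} -> R) (X : sect D)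
    (f : N -> R) : Prop :=
  forall e, dT l (clift_sect epsP X e) = clift_fun epsP f e.

(* Main.v *)
(* Everything rests on an invariant formula for the constrained Tulczyjew
   differential.  For sections Z, Y of D, the derivative of iota_Y along
   Lambda(Z(n)) is G(Z, [Z, Y]_P)(n) + d(l o Z)(sigma(Y(n))): this is the
   coordinate formula for eps, combined with the fact that the fibre derivative
   of a mechanical Lagrangian is the metric, so that pairing it with D only sees
   the orthogonal projection P of the bracket.  The same formula holds for
   eps_P, so d_T(iota_X) o Lambda = d_T^(eps_P)(X)(l) on D, and (a) and (b) agree
   pointwise.

   Along a solution, g o lambda has derivative d_T(g)(Lambda(gamma(t))), so (b)
   implies (c).  Conversely, the Legendre map of l is the isomorphism D -> D^*
   given by the metric, so that Lambda is a smooth vector field on D^* read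
   through it; by the Picard-Lindeloef theorem a solution passes through every
   point of D, and differentiating there gives (b).

   Brackets along D are computed with extensions to M of sections over D_M, which
   exist because an immersion has a smooth local left inverse. *)

Require Import Defs.
From HB Require Import structures.
From mathcomp Require Import all_boot all_order all_algebra.
From mathcomp Require Import ring lra.
From mathcomp Require Import all_classical all_reals all_analysis.

Set Implicit Arguments.
Unset Strict Implicit.
Unset Printing Implicit Defensive.

Import Order.TTheory GRing.Theory Num.Theory.
Import numFieldNormedType.Exports.

Local Open Scope classical_set_scope.
Local Open Scope ring_scope.

(** * Smooth maps between normed spaces *)

(** Total spaces of bundles carry charts but no topology, so germs and smoothness on them are read
    in coordinates; [atlas_ok] isolates what the calculus needs. Brackets are given on global
    sections only: cut-off functions make them local, and frames and coefficients are extended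
    before the Leibniz rule is applied. The invariant formula rests on a cancellation. Expanding the
    bracket gives the covector of dL paired with the derivative of the coefficients of Z along
    sigma(Y), with a minus sign; the fibre part of the derivative of L along Z gives the same term
    with a plus sign. What remains sees Z only through its value at the point, and is the coordinate
    expression of eps. Tangency of the right anchor to D_M then allows L to be replaced by l, and
    tangency of the left anchor makes eps(dL) tangent to the restriction of the dual bundle to D_M.
    Structure functions, complete lifts and [Lambda] are defined through [xget], so each is tied to
    its meaning by a witness, and where needed by uniqueness. *)

Section calculus.
Variable R : realType.

(** Certifies a differential guessed in advance from an explicit estimate; this is how the flat
    point of [flat_exp] and the local inverse of a map are treated. *)
Lemma is_diff_epsP (V W : normedModType R) (f : V -> W) (df : {linear V -> W}) x :
  continuous df ->
  (forall e, 0 < e -> \forall h \near (0 : V), `|f (h + x) - f x - df h| <= e * `|h|) ->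
  is_diff x f df.
Proof.
move=> cdf Hf.
have Ho : f \o shift x = cst (f x) + df +o_ 0 id.
  apply/eqaddoP => e e0; have := Hf e e0; apply: filterS => h /=.
  by rewrite /GRing.add /GRing.opp /= opprD addrA.
have E := diff_unique cdf Ho.
by apply: DiffDef => //; apply/diff_locallyP; rewrite E.
Qed.

Lemma diff_eps (V W : normedModType R) (f : V -> W) x e :
  differentiable f x -> 0 < e ->
  \forall h \near (0 : V), `|f (h + x) - f x - 'd f x h| <= e * `|h|.
Proof.
move=> /diff_locallyP [_ /eqaddoP H] e0; have := H e e0; apply: filterS => h /=.
by rewrite /GRing.add /GRing.opp /= opprD addrA.
Qed.

Lemma near_eq_is_diff (V W : normedModType R) (f g : V -> W) x :
  (\near x, f x = g x) -> differentiable f x -> is_diff x g ('d f x).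
Proof.
move=> fg df; apply: is_diff_epsP; first exact: diff_continuous.
move=> e e0; have fgx : f x = g x by exact: nbhs_singleton fg.
have fg0 : \forall h \near (0 : V), f (h + x) = g (h + x).
  by move: fg; rewrite (near_shift 0 x) /=; apply: filterS => h; rewrite subr0.
have := diff_eps df e0; near_simpl; move=> H; near=> h.
by rewrite -fgx -(near fg0 h) //; near: h.
Unshelve. all: by end_near. Qed.

Lemma near_eq_differentiable (V W : normedModType R) (f g : V -> W) x :
  (\near x, f x = g x) -> differentiable f x -> differentiable g x.
Proof. by move=> fg /(near_eq_is_diff fg) []. Qed.

Lemma open_near_eq (V W : normedModType R) (U : set V) (f g : V -> W) x :
  open U -> U x -> {in U, f =1 g} -> \near x, f x = g x.
Proof.
move=> oU Ux fg; have := open_nbhs_nbhs (conj oU Ux).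
by apply: filterS => y Uy; apply: fg; rewrite inE.
Qed.

Lemma Ck_ext (V W : normedModType R) k (U : set V) (f g : V -> W) :
  open U -> {in U, f =1 g} -> Ck k U f -> Ck k U g.
Proof.
move=> oU; elim: k f g => [|k IH] f g fg /=.
  move=> cf x Ux; have fgx := open_near_eq oU Ux fg.
  have E : f x = g x by exact: nbhs_singleton fgx.
  have : f @ x --> g x by rewrite -E; exact: cf.
  by apply: cvg_trans; apply: near_eq_cvg; exact: fgx.
move=> [df ck]; split=> [x Ux|v].
  exact: near_eq_differentiable (open_near_eq oU Ux fg) (df x Ux).
apply: (IH ('D_v f)) (ck v) => x; rewrite inE => Ux.
by apply: near_eq_derive; exact: open_near_eq oU Ux fg.
Qed.

Lemma Ck_cont (V W : normedModType R) k (U : set V) (f : V -> W) x :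
  Ck k U f -> U x -> {for x, continuous f}.
Proof.
case: k => [cf|k [df _]] Ux; first exact: cf.
exact/differentiable_continuous/df.
Qed.

Lemma Ck_pred (V W : normedModType R) k (U : set V) (f : V -> W) :
  Ck k.+1 U f -> Ck k U f.
Proof.
elim: k f => [|k IH] f; first by move=> cf x Ux; exact: Ck_cont cf Ux.
by case=> df ck; split=> // v; apply: IH; exact: ck.
Qed.

Lemma Ck_sub (V W : normedModType R) k (U U' : set V) (f : V -> W) :
  U' `<=` U -> Ck k U f -> Ck k U' f.
Proof.
move=> UU; elim: k f => [|k IH] f /=; first by move=> cf x /UU; exact: cf.
by move=> [df ck]; split=> [x /UU|v]; [exact: df|exact: IH].
Qed.

(** Since ['D_v f] is a function on the whole space, [Ck] is a conjunction of conditions at single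
    points; the sets [U'] may therefore be arbitrary. *)
Lemma Ck_cover (V W : normedModType R) k (U : set V) (f : V -> W) :
  (forall x, U x -> exists2 U' : set V, U' x & Ck k U' f) -> Ck k U f.
Proof.
elim: k f => [|k IH] f H.
  by move=> x Ux; have [U' U'x cf] := H x Ux; exact: cf.
split=> [x Ux|v]; first by have [U' U'x [df _]] := H x Ux; exact: df.
apply: IH => x Ux; have [U' U'x [_ ck]] := H x Ux.
by exists U' => //; exact: ck.
Qed.

Lemma Ck_cst (V W : normedModType R) k (U : set V) (w : W) : Ck k U (fun _ : V => w).
Proof.
elim: k w => [|k IH] w /=; first by move=> x _; exact: cst_continuous.
split=> [x _|v]; first exact: differentiable_cst.
rewrite (_ : 'D_v _ = fun=> 0); first exact: IH.
by apply/funext => x; exact: (derive_cst w).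
Qed.

Lemma Ck_id (V : normedModType R) k (U : set V) : Ck k U (@id V).
Proof.
case: k => [|k] /=; first by move=> x _.
split=> [x _|v]; first exact: (@ex_diff _ _ _ _ _ _ _ (is_diff_id x)).
rewrite (_ : 'D_v _ = fun=> v); first exact: Ck_cst.
by apply/funext => x; exact: derive_id.
Qed.

Lemma Ck_add (V W : normedModType R) k (U : set V) (f g : V -> W) : open U ->
  Ck k U f -> Ck k U g -> Ck k U (fun x => f x + g x).
Proof.
move=> oU; elim: k f g => [|k IH] f g /=.
  by move=> cf cg x Ux; apply: continuousD; [exact: cf|exact: cg].
move=> [df ckf] [dg ckg]; split=> [x Ux|v].
  by apply: differentiableD; [exact: df|exact: dg].
apply: (Ck_ext oU) (IH _ _ (ckf v) (ckg v)) => x; rewrite inE => Ux /=.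
by rewrite -(deriveD (f := f) (g := g))//; apply: diff_derivable; [exact: df|exact: dg].
Qed.

Lemma Ck_mul (V : normedModType R) k (U : set V) (f g : V -> R) : open U ->
  Ck k U f -> Ck k U g -> Ck k U (fun x => f x * g x).
Proof.
move=> oU; elim: k f g => [|k IH] f g.
  by move=> cf cg x Ux; apply: continuousM; [exact: cf|exact: cg].
move=> Cf Cg; have [df ckf] := Cf; have [dg ckg] := Cg.
split=> [x Ux|v].
  by apply: differentiableM; [exact: df|exact: dg].
have := Ck_add oU (IH _ _ (Ck_pred Cf) (ckg v)) (IH _ _ (Ck_pred Cg) (ckf v)).
apply: (Ck_ext oU) => x; rewrite inE => Ux /=.
by rewrite -(deriveM (f := f) (g := g))//; apply: diff_derivable; [exact: df|exact: dg].
Qed.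

Lemma Ck_scalel (V W : normedModType R) k (U : set V) (f : V -> R) (w : W) : open U ->
  Ck k U f -> Ck k U (fun x => f x *: w).
Proof.
move=> oU; elim: k f => [|k IH] f.
  by move=> cf x Ux; apply: continuousZr_tmp; exact: cf.
move=> [df ck]; split=> [x Ux|v]; first exact/differentiableZl/df.
apply: (Ck_ext oU) (IH _ (ck v)) => x; rewrite inE => Ux /=.
by rewrite !deriveE ?diffZl//; [exact: df|exact: differentiableZl (df _ Ux)|exact: df].
Qed.

Lemma Ck_inv (V : normedModType R) k (U : set V) (f : V -> R) : open U ->
  (forall x, U x -> f x != 0) -> Ck k U f -> Ck k U (fun x => (f x)^-1).
Proof.
move=> oU f0; elim: k => [|k IH].
  by move=> cf x Ux; apply: continuousV; [exact: f0|exact: cf].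
move=> Cf; have [df ck] := Cf; split=> [x Ux|v].
  by apply: differentiableV; [exact: df|exact: f0].
have C1 := IH (Ck_pred Cf).
have := Ck_mul oU (@Ck_cst V R k U (-1)) (Ck_mul oU (Ck_mul oU C1 C1) (ck v)).
apply: (Ck_ext oU) => x; rewrite inE => Ux /=.
rewrite (deriveV (f := f)) ?f0//; last by apply: diff_derivable; exact: df.
by rewrite mulN1r /GRing.scale /= mulNr -invfM -expr2.
Qed.

Lemma Ck_sum (V W : normedModType R) k (U : set V) (I : Type) (r : seq I) (P : pred I)
    (f : I -> V -> W) : open U ->
  (forall i, P i -> Ck k U (f i)) -> Ck k U (fun x => \sum_(i <- r | P i) f i x).
Proof.
move=> oU H; elim: r => [|i r IH].
  rewrite (_ : (fun _ => _) = fun=> 0); first exact: Ck_cst.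
  by apply/funext => x; rewrite big_nil.
have [Pi|Pi] := boolP (P i); last first.
  by under eq_fun do rewrite big_cons (negPf Pi).
under eq_fun do rewrite big_cons Pi.
by apply: Ck_add => //; exact: H.
Qed.

Lemma Ck_row (V : normedModType R) k (U : set V) n (f : V -> 'rV[R]_n) : open U ->
  (forall j, Ck k U (fun x => f x 0 j)) -> Ck k U f.
Proof.
move=> oU H; have /(Ck_ext oU) : Ck k U (fun x => \sum_j f x 0 j *: (delta_mx 0 j : 'rV[R]_n)).
  by apply: Ck_sum => // j _; apply: Ck_scalel.
by apply=> x _; rewrite -row_sum_delta.
Qed.

Lemma derive_comp (V V' W : normedModType R) (f : V -> V') (g : V' -> W) x v :
  differentiable f x -> differentiable g (f x) ->
  'D_v (g \o f) x = 'D_('D_v f x) g (f x).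
Proof.
move=> df dg; have dgf := differentiable_comp df dg.
by rewrite (deriveE _ dgf) (deriveE _ df) (deriveE _ dg) diff_comp.
Qed.

Lemma derive_sum_delta (W : normedModType R) n (g : 'rV[R]_n -> W) x v :
  differentiable g x -> 'D_v g x = \sum_j v 0 j *: 'D_(delta_mx 0 j) g x.
Proof.
move=> dg; rewrite deriveE// {1}(row_sum_delta v) linear_sum.
by apply: eq_bigr => j _; rewrite linearZ deriveE.
Qed.

Lemma derive_coord (V : normedModType R) n (f : V -> 'rV[R]_n) x v j :
  differentiable f x -> ('D_v f x) 0 j = 'D_v (fun y => f y 0 j) x.
Proof. by move=> df; rewrite derive_mx ?mxE//; exact: diff_derivable. Qed.

Lemma Ck_coord (V : normedModType R) k (U : set V) n (f : V -> 'rV[R]_n) j : open U ->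
  Ck k U f -> Ck k U (fun x => f x 0 j).
Proof.
move=> oU; elim: k f => [|k IH] f.
  move=> cf x Ux; apply: (@continuous_comp _ _ _ f (fun y : 'rV[R]_n => y 0 j)).
    exact: cf.
  exact: coord_continuous.
move=> [df ck]; split=> [x Ux|v].
  apply: (@differentiable_comp _ _ _ _ f (fun y : 'rV[R]_n => y 0 j)).
    exact: df.
  exact: differentiable_coord.
apply: (Ck_ext oU) (IH _ (ck v)) => x; rewrite inE => Ux.
by rewrite derive_coord//; exact: df.
Qed.

(** In coordinates the chain rule writes a derivative of [g \o f] as a finite sum of products of
    ['D_v f] with partial derivatives of [g] composed with [f], to which the induction hypothesis
    applies. *)
Lemma Ck_comp (V : normedModType R) n k (U : set V) (U' : set 'rV[R]_n)
    (f : V -> 'rV[R]_n) (g : 'rV[R]_n -> R) : open U ->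
  (forall x, U x -> U' (f x)) -> Ck k U f -> Ck k U' g -> Ck k U (g \o f).
Proof.
move=> oU fU; elim: k g => [|k IH] g.
  move=> cf cg x Ux; apply: continuous_comp; first exact: cf.
  by apply: cg; exact: fU.
move=> Cf Cg; have [df ckf] := Cf; have [dg ckg] := Cg; split=> [x Ux|v].
  by apply: differentiable_comp; [exact: df|apply: dg; exact: fU].
have : Ck k U (fun x => \sum_j ('D_v f x) 0 j * ('D_(delta_mx 0 j) g \o f) x).
  apply: Ck_sum => // j _; apply: Ck_mul => //; first exact: Ck_coord (ckf v).
  by apply: IH; [exact: Ck_pred|exact: ckg].
apply: (Ck_ext oU) => x; rewrite inE => Ux /=.
rewrite (derive_comp _ (df _ Ux) (dg _ (fU _ Ux))).
by rewrite derive_sum_delta//; apply: dg; exact: fU.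
Qed.

Lemma near_comp (S T : topologicalType) (f : S -> T) x (P : set T) :
  {for x, continuous f} -> (\forall y \near f x, P y) -> \forall y \near x, P (f y).
Proof. by move=> cf; exact: cf. Qed.

Lemma near_neq0 (V : normedModType R) (f : V -> R) x :
  {for x, continuous f} -> f x != 0 -> \forall y \near x, f y != 0.
Proof.
move=> cf fx0; apply: (near_comp (P := fun y : R => y != 0) cf).
by apply: open_nbhs_nbhs; split => //; exact: open_neq.
Qed.

(** A notion on germs: it is stable under composition and under changes away from [x] without any
    bookkeeping of domains, and [smooth_onP] returns to open sets. *)
Definition smooth_at (V W : normedModType R) (x : V) (f : V -> W) : Prop :=
  exists2 U : set V, open U /\ U x & smooth_on U f.

Lemma smooth_at_ext (V W : normedModType R) (x : V) (f g : V -> W) :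
  (\near x, f x = g x) -> smooth_at x f -> smooth_at x g.
Proof.
move=> fg [U [oU Ux] sf].
pose U' := U `&` [set y | f y = g y]^°.
have oU' : open U' by apply: openI => //; exact: open_interior.
exists U'; first by split => //; split.
move=> k; apply: (Ck_ext oU' _ (Ck_sub _ (sf k))) => [y|y []//].
by rewrite inE => -[_ /interior_subset].
Qed.

Lemma smooth_onP (V W : normedModType R) (U : set V) (f : V -> W) : open U ->
  smooth_on U f <-> forall x, U x -> smooth_at x f.
Proof.
move=> oU; split=> [sf x Ux|H k]; first by exists U.
by apply: Ck_cover => x /H [U' [_ U'x] sf]; exists U'.
Qed.

Lemma smooth_at_near (V W : normedModType R) (x : V) (f : V -> W) :
  smooth_at x f -> \forall y \near x, smooth_at y f.
Proof.
move=> [U [oU Ux] sf]; have := open_nbhs_nbhs (conj oU Ux).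
by apply: filterS => y Uy; exists U.
Qed.

Lemma smooth_at_diff (V W : normedModType R) (x : V) (f : V -> W) :
  smooth_at x f -> differentiable f x.
Proof. by move=> [U [oU Ux] /(_ 1%N) [df _]]; exact: df. Qed.

Lemma smooth_at_cont (V W : normedModType R) (x : V) (f : V -> W) :
  smooth_at x f -> {for x, continuous f}.
Proof. by move/smooth_at_diff/differentiable_continuous. Qed.

Lemma smooth_at_derive (V W : normedModType R) (x v : V) (f : V -> W) :
  smooth_at x f -> smooth_at x ('D_v f).
Proof. by move=> [U oU sf]; exists U => // k; have [_] := sf k.+1; apply. Qed.

Lemma smooth_at_cst (V W : normedModType R) (x : V) (w : W) : smooth_at x (fun=> w).
Proof. by exists setT; [split => //; exact: openT|move=> k; exact: Ck_cst]. Qed.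

Lemma smooth_at_id (V : normedModType R) (x : V) : smooth_at x (@id V).
Proof. by exists setT; [split => //; exact: openT|move=> k; exact: Ck_id]. Qed.

Lemma smooth_at_add (V W : normedModType R) (x : V) (f g : V -> W) :
  smooth_at x f -> smooth_at x g -> smooth_at x (fun y => f y + g y).
Proof.
move=> [U [oU Ux] sf] [U' [oU' U'x] sg]; exists (U `&` U').
  by split => //; exact: openI.
move=> k; apply: Ck_add; first exact: openI.
- by apply: Ck_sub (sf k) => y [].
- by apply: Ck_sub (sg k) => y [].
Qed.

Lemma smooth_at_mul (V : normedModType R) (x : V) (f g : V -> R) :
  smooth_at x f -> smooth_at x g -> smooth_at x (fun y => f y * g y).
Proof.
move=> [U [oU Ux] sf] [U' [oU' U'x] sg]; exists (U `&` U').
  by split => //; exact: openI.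
move=> k; apply: Ck_mul; first exact: openI.
- by apply: Ck_sub (sf k) => y [].
- by apply: Ck_sub (sg k) => y [].
Qed.

Lemma smooth_at_scalel (V W : normedModType R) (x : V) (f : V -> R) (w : W) :
  smooth_at x f -> smooth_at x (fun y => f y *: w).
Proof. by move=> [U [oU Ux] sf]; exists U => // k; exact: Ck_scalel. Qed.

Lemma smooth_at_inv (V : normedModType R) (x : V) (f : V -> R) :
  f x != 0 -> smooth_at x f -> smooth_at x (fun y => (f y)^-1).
Proof.
move=> fx0 sf; have cf := smooth_at_cont sf.
have /= n0 : \forall y \near x, f y != 0.
  exact: near_neq0.
case: sf => U [oU Ux] sf; pose U' := U `&` [set y | f y != 0]^°.
have oU' : open U' by apply: openI => //; exact: open_interior.
exists U'; first by split => //; split.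
move=> k; apply: Ck_inv => // [y [_ /interior_subset]//|].
by apply: Ck_sub (sf k) => y [].
Qed.

Lemma smooth_at_sum (V W : normedModType R) (x : V) (I : Type) (r : seq I) (P : pred I)
    (f : I -> V -> W) :
  (forall i, P i -> smooth_at x (f i)) -> smooth_at x (fun y => \sum_(i <- r | P i) f i y).
Proof.
move=> H; elim: r => [|i r IH].
  rewrite (_ : (fun _ => _) = fun=> 0); first exact: smooth_at_cst.
  by apply/funext => y; rewrite big_nil.
have [Pi|Pi] := boolP (P i); last first.
  by under eq_fun do rewrite big_cons (negPf Pi).
under eq_fun do rewrite big_cons Pi.
by apply: smooth_at_add => //; exact: H.
Qed.

Lemma smooth_at_prod (V : normedModType R) (x : V) (I : Type) (r : seq I) (P : pred I)
    (f : I -> V -> R) :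
  (forall i, P i -> smooth_at x (f i)) -> smooth_at x (fun y => \prod_(i <- r | P i) f i y).
Proof.
move=> H; elim: r => [|i r IH].
  rewrite (_ : (fun _ => _) = fun=> 1); first exact: smooth_at_cst.
  by apply/funext => y; rewrite big_nil.
have [Pi|Pi] := boolP (P i); last first.
  by under eq_fun do rewrite big_cons (negPf Pi).
under eq_fun do rewrite big_cons Pi.
by apply: smooth_at_mul => //; exact: H.
Qed.

Lemma smooth_at_row (V : normedModType R) n (x : V) (f : V -> 'rV[R]_n) :
  (forall j, smooth_at x (fun y => f y 0 j)) -> smooth_at x f.
Proof.
move=> H; have /smooth_at_ext : smooth_at x (fun y => \sum_j f y 0 j *: (delta_mx 0 j : 'rV[R]_n)).
  by apply: smooth_at_sum => // j _; exact: smooth_at_scalel.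
by apply; apply: nearW => y; rewrite -row_sum_delta.
Qed.

Lemma smooth_at_coord (V : normedModType R) n (x : V) (f : V -> 'rV[R]_n) j :
  smooth_at x f -> smooth_at x (fun y => f y 0 j).
Proof. by move=> [U [oU Ux] sf]; exists U => // k; exact: Ck_coord. Qed.

Lemma smooth_at_compR (V : normedModType R) n (x : V) (f : V -> 'rV[R]_n) (g : 'rV[R]_n -> R) :
  smooth_at x f -> smooth_at (f x) g -> smooth_at x (g \o f).
Proof.
move=> sf [U' [oU' U'x] sg]; have cf := smooth_at_cont sf.
have /= nU' : \forall y \near x, U' (f y) by apply: near_comp cf _; exact: open_nbhs_nbhs.
case: sf => U [oU Ux] sf; pose U1 := U `&` [set y | U' (f y)]^°.
have oU1 : open U1 by apply: openI => //; exact: open_interior.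
exists U1; first by split => //; split.
move=> k; apply: (Ck_comp oU1 _ _ (sg k)) => [y [_ /interior_subset]//|].
by apply: Ck_sub (sf k) => y [].
Qed.

Lemma smooth_at_comp (V : normedModType R) n m (x : V) (f : V -> 'rV[R]_n)
    (g : 'rV[R]_n -> 'rV[R]_m) :
  smooth_at x f -> smooth_at (f x) g -> smooth_at x (g \o f).
Proof.
move=> sf sg; apply: smooth_at_row => j.
by apply: (smooth_at_compR (g := fun y => g y 0 j)) => //; exact: smooth_at_coord.
Qed.

Lemma smooth_at_opp (V : normedModType R) (x : V) (f : V -> R) :
  smooth_at x f -> smooth_at x (fun y => - f y).
Proof.
move=> sf; under eq_fun do rewrite -mulN1r.
by apply: smooth_at_mul => //; exact: smooth_at_cst.
Qed.

Lemma smooth_at_sub (V : normedModType R) (x : V) (f g : V -> R) :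
  smooth_at x f -> smooth_at x g -> smooth_at x (fun y => f y - g y).
Proof. by move=> sf sg; apply: smooth_at_add => //; exact: smooth_at_opp. Qed.

Lemma smooth_at_mulmx (V : normedModType R) n m (x : V) (f : V -> 'rV[R]_n)
    (A : V -> 'M[R]_(n, m)) :
  smooth_at x f -> (forall i j, smooth_at x (fun y => A y i j)) ->
  smooth_at x (fun y => f y *m A y).
Proof.
move=> sf sA; apply: smooth_at_row => j; under eq_fun do rewrite mxE.
by apply: smooth_at_sum => i _; apply: smooth_at_mul => //; exact: smooth_at_coord.
Qed.

Lemma smooth_at_det (V : normedModType R) n (x : V) (A : V -> 'M[R]_n) :
  (forall i j, smooth_at x (fun y => A y i j)) -> smooth_at x (fun y => \det (A y)).
Proof.
move=> sA; apply: smooth_at_sum => s _; apply: smooth_at_mul.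
  exact: smooth_at_cst.
by apply: smooth_at_prod => i _.
Qed.

(** Cramer's rule. It describes [invmx] only where the determinant is nonzero, which is a
    neighbourhood of [x]. *)
Lemma smooth_at_invmx (V : normedModType R) n (x : V) (A : V -> 'M[R]_n) i j :
  A x \in unitmx -> (forall i j, smooth_at x (fun y => A y i j)) ->
  smooth_at x (fun y => invmx (A y) i j).
Proof.
move=> Ax sA; have sd := smooth_at_det sA.
have d0 : \det (A x) != 0 by rewrite -unitfE -unitmxE.
have /= n0 : \forall y \near x, \det (A y) != 0.
  by apply: near_neq0 => //; exact: smooth_at_cont.
have /smooth_at_ext : smooth_at x (fun y => (\det (A y))^-1 * (cofactor (A y) j i)).
  apply: smooth_at_mul; first exact: smooth_at_inv.
  apply: smooth_at_mul; first exact: smooth_at_cst.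
  by apply: smooth_at_det => a b; under eq_fun do rewrite !mxE; exact: sA.
apply; apply: filterS n0 => y y0.
by rewrite /invmx unitmxE unitfE y0 !mxE.
Qed.

End calculus.

(** * Bump functions *)

Section bump.
Variable R : realType.

Lemma Ck_compR (V : normedModType R) k (U : set V) (f : V -> R) (g : R -> R) : open U ->
  Ck k U f -> Ck k setT g -> Ck k U (g \o f).
Proof.
move=> oU; elim: k g => [|k IH] g.
  move=> cf cg x Ux; apply: continuous_comp; first exact: cf.
  exact: cg.
move=> Cf Cg; have [df ckf] := Cf; have [dg ckg] := Cg; split=> [x Ux|v].
  by apply: differentiable_comp; [exact: df|exact: dg].
have : Ck k U (fun x => 'D_v f x * ('D_1 g \o f) x).
  apply: (Ck_mul oU (ckf v)); apply: IH; [exact: Ck_pred|exact: ckg].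
apply: (Ck_ext oU) => x; rewrite inE => Ux /=.
have dfx := df x Ux; have dgx := dg (f x) I.
rewrite (derive_comp _ dfx dgx) (deriveE _ dgx) (deriveE _ dgx).
by rewrite -[X in _ = 'd g _ X]mulr1 -[X in _ = 'd g _ X]/(_ *: 1) linearZ.
Qed.

(* The extra parameter [k] makes the family stable, up to linear combinations,
   under differentiation. *)
Definition flat_exp k (t : R) : R := if 0 < t then t^-1 ^+ k * expR (- t^-1) else 0.

Lemma exprn_le_expR k (s : R) : 0 <= s -> s ^+ k.+1 <= (k.+1)`!%:R * expR s.
Proof.
move=> s0; rewrite mulrC -ler_pdivrMr ?ltr0n ?fact_gt0//.
by apply: le_trans (expR_ge1Dxn k s0); rewrite lerDr.
Qed.

(** The exponential series at [t^-1], cut at the term of degree [k.+2], gives two powers of [t] to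
    spare; a quadratic bound forces the derivative at 0 to vanish. *)
Lemma flat_exp_bound k (t : R) : `|flat_exp k t| <= (k.+2)`!%:R * t ^+ 2.
Proof.
rewrite /flat_exp; case: ifPn => t0; last by rewrite normr0 mulr_ge0 ?ler0n ?sqr_ge0.
rewrite ger0_norm ?mulr_ge0 ?expR_ge0 ?exprn_ge0 ?invr_ge0 ?(ltW t0)//.
have := @exprn_le_expR k.+1 t^-1; rewrite invr_ge0 (ltW t0) => /(_ isT) H.
rewrite expRN. rewrite ler_pdivrMr ?expR_gt0//.
have -> : t^-1 ^+ k = t^-1 ^+ k.+2 * t ^+ 2.
  by rewrite -addn2 exprD -mulrA -exprMn mulVf ?gt_eqF// expr1n mulr1.
by rewrite [leRHS]mulrAC ler_wpM2r// sqr_ge0.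
Qed.

Lemma flat_exp_diff k (t : R) : differentiable (flat_exp k) t /\
  'D_1 (flat_exp k) t = flat_exp k.+2 t - k%:R * flat_exp k.+1 t.
Proof.
have [t0|t0|t0] := ltgtP t 0.
- have E : \near t, cst 0 t = flat_exp k t.
    by near=> s; rewrite /flat_exp ltNge ltW//; near: s; exact: lt_nbhsl.
  split; first exact: near_eq_differentiable E (differentiable_cst _ _).
  rewrite -(near_eq_derive _ E) (derive_cst (0:R)) /flat_exp.
  by rewrite ltNge ltW//= mulr0 subr0.
- pose g := (fun s : R => s^-1 ^+ k * expR (- s^-1)).
  have E : \near t, g t = flat_exp k t.
    by near=> s; rewrite /flat_exp ifT//; near: s; exact: lt_nbhsr.
  have dg : is_derive t 1 g (flat_exp k.+2 t - k%:R * flat_exp k.+1 t).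
    have t1 : t != 0 by rewrite gt_eqF.
    have dV : is_derive t 1 (fun s : R => s^-1) (- t ^- 2 *: 1) by exact: is_deriveV.
    have dX := is_deriveX k dV.
    have dN := is_deriveN dV.
    have dE := is_derive1_comp (g := - (GRing.inv : R -> R)) (is_derive_expR (- t^-1)) dN.
    have Eg : g = ((GRing.inv : R -> R) ^+ k) * (expR \o - (GRing.inv : R -> R)).
      by apply/funext => s; rewrite /g /= exprfctE.
    rewrite Eg; have [Hd Hv] := is_deriveM dX dE.
    apply: (DeriveDef Hd); rewrite [LHS]Hv /flat_exp t0 /GRing.scale /=.
    rewrite exprfctE /= -[(- GRing.inv) t]/(- t^-1) -exprVn.
    move: t^-1 (expR _) => s e; case: (k) => [|m] /=; first by ring.
    by rewrite !exprS; ring.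
  have dg1 : differentiable g t by apply/derivable1_diffP.
  split; first exact: near_eq_differentiable E dg1.
  by rewrite -(near_eq_derive _ E); exact: (@derive_val _ _ _ _ _ _ _ dg).
- rewrite t0; have F0 : flat_exp k.+2 0 - k%:R * flat_exp k.+1 0 = 0.
    by rewrite /flat_exp ltxx mulr0 subr0.
  suff [d1 d2] : is_diff (0:R) (flat_exp k) (\0 : R -> R).
    by split => //; rewrite deriveE// d2 F0.
  apply: (@is_diff_epsP _ _ _ _ (\0 : {linear R -> R})); first exact: cst_continuous.
  move=> e e0; pose C : R := (k.+2)`!%:R.
  have C0 : 0 < C by rewrite ltr0n fact_gt0.
  have n0 : \forall h \near (0 : R), `|h| <= e / C by exact: nbhs0_le (divr_gt0 e0 C0).
  near=> h; rewrite /= {2}/flat_exp ltxx addr0 !subr0.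
  apply: le_trans (flat_exp_bound _ _) _.
  rewrite -real_normK ?num_real// expr2 mulrA ler_wpM2r// mulrC -ler_pdivlMr//.
  by near: h; exact: n0.
Unshelve. all: by end_near. Qed.

Lemma Ck_flat_exp j k : Ck j setT (flat_exp k).
Proof.
elim: j k => [|j IH] k.
  move=> t _; apply: differentiable_continuous.
  by have [] := flat_exp_diff k t.
split=> [t _|v]; first by have [] := flat_exp_diff k t.
have oT : open [set: R] by exact: openT.
have : Ck j setT (fun t => v * (flat_exp k.+2 t + (- k%:R) * flat_exp k.+1 t)).
  apply: (Ck_mul oT (@Ck_cst R R R j setT v)); apply: (Ck_add oT (IH k.+2)).
  exact: (Ck_mul oT (@Ck_cst R R R j setT (- k%:R)) (IH k.+1)).
apply: (Ck_ext oT) => t _; have [d E] := flat_exp_diff k t.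
rewrite mulNr -E (deriveE _ d) (deriveE _ d).
by rewrite -[X in _ = 'd _ _ X]mulr1 -[X in _ = 'd _ _ X]/(_ *: 1) linearZ.
Qed.

Lemma smooth_at_flat_exp (V : normedModType R) (x : V) (f : V -> R) :
  smooth_at x f -> smooth_at x (fun y => flat_exp 0 (f y)).
Proof.
move=> [U [oU Ux] sf]; exists U => // k.
by apply: (Ck_compR oU (sf k)); exact: Ck_flat_exp.
Qed.

Lemma flat_exp_ge0 t : 0 <= flat_exp 0 t.
Proof. by rewrite /flat_exp; case: ifP => // _; rewrite mul1r expR_ge0. Qed.

Lemma flat_exp_gt0 t : 0 < t -> 0 < flat_exp 0 t.
Proof. by rewrite /flat_exp => ->; rewrite mul1r expR_gt0. Qed.

Lemma flat_exp_eq0 t : t <= 0 -> flat_exp 0 t = 0.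
Proof. by rewrite /flat_exp leNgt => /negPf ->. Qed.

Lemma rV_norm_le n (x : 'rV[R]_n) e : 0 <= e ->
  (`|x| <= e) = [forall j, `|x 0 j| <= e].
Proof.
move=> e0; rewrite /Num.Def.normr/= mx_normrE; apply/bigmax_leP/forallP => /=.
  by move=> [_ H] j; exact: (H (0, j)).
move=> H; split => [|[i j] _]; first exact: e0.
by rewrite /= ord1; exact: H.
Qed.

Lemma rV_norm_lt n (x : 'rV[R]_n) e : 0 < e ->
  (`|x| < e) = [forall j, `|x 0 j| < e].
Proof.
move=> e0; rewrite /Num.Def.normr/= mx_normrE; apply/bigmax_ltP/forallP => /=.
  by move=> [_ H] j; exact: (H (0, j)).
move=> H; split => [|[i j] _]; first exact: e0.
by rewrite /= ord1; exact: H.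
Qed.

(** The norm of a row is the maximum of its entries, so a product of one-variable cut-offs does.
    With [q] the square of the offset divided by [r], each factor is the usual quotient, equal to 1
    for [q <= 1] and to 0 for [2 <= q]; an offset of at least [r * 2] gives [q] at least 4. The
    square avoids the corner of the absolute value. *)
Lemma bump_exists n (x0 : 'rV[R]_n) (r : R) : 0 < r ->
  exists b : 'rV[R]_n -> R, [/\ forall x, smooth_at x b,
    forall x, `|x - x0| <= r -> b x = 1 & forall x, r * 2 <= `|x - x0| -> b x = 0].
Proof.
move=> r0; pose q j (x : 'rV[R]_n) := ((x 0 j - x0 0 j) * r^-1) * ((x 0 j - x0 0 j) * r^-1).
pose den j x := flat_exp 0 (2 - q j x) + flat_exp 0 (q j x - 1).
have den0 j x : 0 < den j x.
  have [q2|q2] := ltP (q j x) 2.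
    by rewrite /den ltr_pwDl ?flat_exp_ge0// flat_exp_gt0// subr_gt0.
  rewrite /den ltr_wpDl ?flat_exp_ge0// flat_exp_gt0// subr_gt0.
  by apply: lt_le_trans q2; rewrite ltr1n.
have qE j x : q j x = (`|x 0 j - x0 0 j| / r) ^+ 2.
  rewrite /q -expr2 -[LHS]ger0_norm ?sqr_ge0// normrX normrM.
  by rewrite [`|r^-1|]gtr0_norm ?invr_gt0.
pose b x := \prod_j (flat_exp 0 (2 - q j x) * (den j x)^-1).
have sq j x : smooth_at x (q j).
  have s1 : smooth_at x (fun y : 'rV[R]_n => (y 0 j - x0 0 j) * r^-1).
    apply: smooth_at_mul (smooth_at_cst _ _); apply: smooth_at_add (smooth_at_cst _ _).
    by apply: smooth_at_coord; exact: smooth_at_id.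
  exact: smooth_at_mul.
have s2 j x : smooth_at x (fun y => flat_exp 0 (2 - q j y)).
  by apply: smooth_at_flat_exp; apply: smooth_at_sub (sq _ _); exact: smooth_at_cst.
have s3 j x : smooth_at x (den j).
  apply: smooth_at_add => //; apply: smooth_at_flat_exp.
  by apply: smooth_at_sub; [exact: sq|exact: smooth_at_cst].
exists b; split=> [x|x xr|x xr].
- apply: smooth_at_prod => j _; apply: smooth_at_mul => //.
  by apply: smooth_at_inv => //; rewrite gt_eqF.
- move: xr; rewrite rV_norm_le ?ltW// => /forallP xr.
  rewrite /b big1// => j _; rewrite /den (@flat_exp_eq0 (q j x - 1)).
    rewrite addr0 mulfV// gt_eqF// flat_exp_gt0// subr_gt0 qE.
    have /le_lt_trans : (`|x 0 j - x0 0 j| / r) ^+ 2 <= 1; last by apply; rewrite ltr1n.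
    by rewrite expr_le1 ?divr_ge0 ?(ltW r0)// ler_pdivrMr// mul1r; have := xr j; rewrite !mxE.
  by rewrite subr_le0 qE expr_le1 ?divr_ge0 ?(ltW r0)// ler_pdivrMr// mul1r; have := xr j; rewrite !mxE.
- move: xr; rewrite leNgt rV_norm_lt ?mulr_gt0// negb_forall => /existsP [j].
  rewrite !mxE -leNgt => xr; rewrite /b (bigD1 j)//= (@flat_exp_eq0 (2 - q j x)) ?mul0r//.
  rewrite subr_le0 qE; have : 2 <= `|x 0 j - x0 0 j| / r by rewrite ler_pdivlMr// mulrC.
  move=> H; apply: (@le_trans _ _ (2 ^+ 2)); first by rewrite -natrX ler_nat.
  by rewrite lerXn2r ?nnegrE ?divr_ge0 ?(ltW r0).
Qed.

End bump.

(** * Mean value estimates *)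

Section mvt.
Variable R : realType.

Lemma mvt_real (f df : R -> R) (s t : R) :
  (forall c, Num.min s t <= c <= Num.max s t -> is_derive c 1 f (df c)) ->
  exists2 c, Num.min s t <= c <= Num.max s t & f t - f s = df c * (t - s).
Proof.
wlog st : s t / s <= t => [H D|].
  case/orP: (le_total s t) => [st|ts]; first exact: H.
  have [c c1 c2] : exists2 c, Num.min t s <= c <= Num.max t s & f s - f t = df c * (s - t).
    by apply: H => // c; rewrite minC maxC; exact: D.
  by exists c; [rewrite minC maxC|rewrite -opprB c2 -mulrN opprB].
rewrite (min_idPl st) (max_idPr st) => D.
have [|| c] := @MVT_segment R f df s t st.
- by move=> c; rewrite in_itv/= => /andP[c1 c2]; apply: D; rewrite !ltW.
- apply: continuous_in_subspaceT => c; rewrite inE /= in_itv/= => /D [/derivable1_diffP dc _].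
  exact: (differentiable_continuous dc).
- by rewrite in_itv/= => cst E; exists c.
Qed.

Lemma mvt_row n (f : 'rV[R]_n -> R) (x y : 'rV[R]_n) :
  (forall t, 0 <= t <= 1 -> differentiable f (t *: (x - y) + y)) ->
  exists2 t, 0 <= t <= 1 & f x - f y = 'D_(x - y) f (t *: (x - y) + y).
Proof.
move=> D; pose l (t : R) : 'rV[R]_n := t *: (x - y) + y.
have dl t : differentiable l t /\ 'D_1 l t = x - y.
  have dl1 := is_diff_scalel t (x - y).
  have dl2 := is_diffD dl1 (is_diff_cst y t).
  have d1 : differentiable l t by exact: (@ex_diff _ _ _ _ _ _ _ dl2).
  split => //; rewrite deriveE//.
  by rewrite [X in X 1 = _](@diff_val _ _ _ _ _ _ _ dl2) /= /GRing.add /= scale1r addr0.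
have [|t t01] := @mvt_real (f \o l) (fun t => 'D_(x - y) f (l t)) 0 1.
  move=> t; rewrite (min_idPl ler01) (max_idPr ler01) => t01.
  have [d1 d2] := dl t; have d3 := differentiable_comp d1 (D t t01).
  by apply: DeriveDef; [exact/derivable1_diffP|rewrite (derive_comp _ d1 (D t t01)) d2].
move: t01; rewrite (min_idPl ler01) (max_idPr ler01) => t01.
by rewrite /= {1 2}/l scale1r scale0r add0r subrK subr0 mulr1 => E; exists t.
Qed.

(** The ball is convex, so the mean value theorem applies to each entry along the segment; the
    factor [n] counts the partial derivatives in a directional one. *)
Lemma partial_bound_lip n m (f : 'rV[R]_n -> 'rV[R]_m) (x0 : 'rV[R]_n) (r c : R) :
  0 <= c ->
  (forall x, `|x - x0| <= r -> differentiable f x /\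
     forall i j, `|('D_(delta_mx 0 i) f x) 0 j| <= c) ->
  forall x y, `|x - x0| <= r -> `|y - x0| <= r ->
  `|f x - f y| <= n%:R * c * `|x - y|.
Proof.
move=> c0 H x y xr yr; rewrite rV_norm_le ?mulr_ge0//; apply/forallP => j.
have seg t : 0 <= t <= 1 -> `|t *: (x - y) + y - x0| <= r.
  move=> /andP[t0 t1].
  have -> : t *: (x - y) + y - x0 = t *: (x - x0) + (1 - t) *: (y - x0).
    by apply/rowP => k; rewrite !mxE; ring.
  have t1' : 0 <= 1 - t by rewrite subr_ge0.
  apply: le_trans (ler_normD _ _) _; rewrite !normrZ (ger0_norm t0) (ger0_norm t1').
  have -> : r = t * r + (1 - t) * r by ring.
  by apply: lerD; rewrite ler_wpM2l.
have d1 z : `|z - x0| <= r -> differentiable (fun y => f y 0 j) z.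
  move=> zr; apply: (@differentiable_comp _ _ _ _ f (fun y : 'rV[R]_m => y 0 j)).
    by have [] := H z zr.
  exact: differentiable_coord.
have [t t01 E] := @mvt_row n (fun y => f y 0 j) x y (fun t t01 => d1 _ (seg t t01)).
rewrite !mxE E derive_sum_delta; last exact/d1/seg.
apply: le_trans (ler_norm_sum _ _ _) _.
have -> : n%:R * c * `|x - y| = \sum_(i < n) c * `|x - y|.
  by rewrite sumr_const card_ord -[RHS]mulr_natl mulrA.
apply: ler_sum => i _; rewrite normrZ mulrC; have [df Hb] := H _ (seg t t01).
rewrite ler_pM//; first by rewrite -derive_coord.
by have := lexx `|x - y|; rewrite rV_norm_le// => /forallP /(_ i).
Qed.

Lemma geometric_cvg n (u : nat -> 'rV[R]_n) (C : R) :
  (forall k, `|u k.+1 - u k| <= C * 2^-1 ^+ k) ->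
  exists l, forall k, `|u k - l| <= C * 2 * 2^-1 ^+ k.
Proof.
move=> H.
(* Subtracting the tail that is still to come makes the induction on [p] close exactly. *)
have H2 k p : `|u k - u (p + k)%N| <= C * 2 * 2^-1 ^+ k - C * 2 * 2^-1 ^+ (p + k).
  elim: p => [|p IH]; first by rewrite !subrr normr0.
  rewrite -[u k](subrK (u (p + k)%N)) -addrA; apply: le_trans (ler_normD _ _) _.
  have := H (p + k)%N; rewrite distrC => H1.
  have -> : C * 2 * 2^-1 ^+ k - C * 2 * 2^-1 ^+ (p.+1 + k) =
    (C * 2 * 2^-1 ^+ k - C * 2 * 2^-1 ^+ (p + k)) + C * 2^-1 ^+ (p + k) by rewrite addSn exprS; field.
  exact: lerD.
have C0 : 0 <= C by have := H 0%N; rewrite expr0 mulr1; exact: le_trans.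
have H3 k p : (k <= p)%N -> `|u k - u p| <= C * 2 * 2^-1 ^+ k.
  move=> kp; have := H2 k (p - k)%N; rewrite subnK// => /le_trans; apply.
  by rewrite gerBl !mulr_ge0// exprn_ge0// invr_ge0.
have cz e : 0 < e -> exists k, C * 2 * 2^-1 ^+ k < e.
  move=> e0; have : (2^-1 : R) ^+ k @[k --> \oo] --> 0.
    by apply: cvg_expr; rewrite ger0_norm ?invr_ge0// invf_lt1// ltr1n.
  have C1 : 0 < e / (C * 2 + 1) by rewrite divr_gt0// ltr_wpDl// mulr_ge0.
  move=> /cvgrPdist_lt /(_ _ C1) [k _ /(_ k (leqnn k))].
  rewrite /= sub0r normrN ger0_norm ?exprn_ge0 ?invr_ge0// ltr_pdivlMr ?ltr_wpDl ?mulr_ge0// mulrC => Hk.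
  exists k; apply: le_lt_trans Hk; apply: ler_wpM2r; first by rewrite exprn_ge0 ?invr_ge0.
  by rewrite lerDl.
have : cvgn u.
  apply: cauchy_cvg; apply: cauchy_exP => e /= e0; have [k Hk] := cz e e0.
  exists (u k); exists k => // p /= kp; rewrite -ball_normE /ball_ /=.
  exact: le_lt_trans (H3 _ _ kp) Hk.
move=> cu; exists (limn u) => k.
apply: (@closed_cvg _ _ _ eventually_filter u [set x | `|u k - x| <= C * 2 * 2^-1 ^+ k]).
- have cd : continuous (fun x : 'rV[R]_n => `|u k - x|).
    move=> x; have cb : {for x, continuous (fun x : 'rV[R]_n => u k - x)}.
      by apply: continuousB; [exact: cst_continuous|exact: cvg_id].
    exact: (continuous_comp cb (@norm_continuous _ _ _)).
  apply: (@closed_comp _ _ _ [set x : R | x <= C * 2 * 2^-1 ^+ k]); last exact: closed_le.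
  by move=> x _; exact: cd.
- by exists k => // p /= kp; exact: H3.
- exact: cu.
Qed.

End mvt.

(** * The inverse function theorem *)

Section inverse_function.
Variable R : realType.

Lemma near_ballP n (x0 : 'rV[R]_n) (P : 'rV[R]_n -> Prop) :
  (\forall x \near x0, P x) <-> exists2 r, 0 < r & forall x, `|x - x0| <= r -> P x.
Proof.
split=> [/nbhs_ballP [e /= e0 He]|[r r0 Hr]].
  exists (e / 2); first by rewrite divr_gt0.
  move=> x xe; apply: He; rewrite -ball_normE /ball_ /= distrC.
  by apply: le_lt_trans xe _; rewrite ltr_pdivrMr// ltr_pMr// ltr1n.
apply/nbhs_ballP; exists r => // x; rewrite -ball_normE /ball_ /= distrC => /ltW.
exact: Hr.
Qed.

Lemma open_normball n (x0 : 'rV[R]_n) r : open [set x | `|x - x0| < r].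
Proof.
have -> : [set x | `|x - x0| < r] = ball x0 r.
  by apply/seteqP; split=> x; rewrite -ball_normE /ball_ /= distrC.
exact: ball_open.
Qed.

Lemma near_norm_lt (V : normedModType R) n (f : V -> 'rV[R]_n) x i c :
  {for x, continuous (fun y => f y 0 i)} -> `|f x 0 i| < c ->
  \forall y \near x, `|f y 0 i| <= c.
Proof.
move=> cf fxc.
have cn : {for x, continuous (fun y => `|f y 0 i|)}.
  exact: (continuous_comp cf (@norm_continuous _ _ _)).
have : \forall z \near `|f x 0 i|, z <= c.
  by apply: filterS (lt_nbhsl fxc) => z /ltW.
exact: cn.
Qed.

(** Strict bounds on the partial derivatives at [x0] persist nearby by continuity. The absolute
    value covers [n = 0] or [m = 0], where the bounds are vacuous and [c] may be negative. *)
Lemma smooth_at_lip n m (f : 'rV[R]_n -> 'rV[R]_m) (x0 : 'rV[R]_n) (c : R) :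
  smooth_at x0 f -> (forall i j, `|('D_(delta_mx 0 i) f x0) 0 j| < c) ->
  exists2 r, 0 < r & forall x y, `|x - x0| <= r -> `|y - x0| <= r ->
    `|f x - f y| <= n%:R * `|c| * `|x - y|.
Proof.
move=> sf Hc.
have H1 : \forall x \near x0, forall i j, `|('D_(delta_mx 0 i) f x) 0 j| <= c.
  have Hij i j : \forall x \near x0, `|('D_(delta_mx 0 i) f x) 0 j| <= c.
    apply: (@near_norm_lt _ _ ('D_(delta_mx 0 i) f) _ _ _ _ (Hc i j)).
    by apply: smooth_at_cont; apply: smooth_at_coord; exact: smooth_at_derive.
  have Hi i := @filter_forall _ 'I_m (fun j x => `|('D_(delta_mx 0 i) f x) 0 j| <= c)
    (nbhs x0) (nbhs_filter x0) (Hij i).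
  exact: (@filter_forall _ 'I_n _ (nbhs x0) (nbhs_filter x0) Hi).
have H2 : \forall x \near x0, differentiable f x /\
    forall i j, `|('D_(delta_mx 0 i) f x) 0 j| <= `|c|.
  apply: filterS2 H1 (smooth_at_near sf) => x Hx sx.
  split; first exact: smooth_at_diff.
  by move=> i j; apply: le_trans (Hx i j) (ler_norm _).
have [r r0 Hr] := (near_ballP _ _).1 H2.
exists r => // x y xr yr; exact: (partial_bound_lip (r := r) (x0 := x0)).
Qed.

Lemma contraction_fixpoint n (x0 : 'rV[R]_n) (r : R) (T : 'rV[R]_n -> 'rV[R]_n) :
  0 < r ->
  (forall x, `|x - x0| <= r -> `|T x - x0| <= r) ->
  (forall x y, `|x - x0| <= r -> `|y - x0| <= r -> `|T x - T y| <= 2^-1 * `|x - y|) ->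
  exists2 x, `|x - x0| <= r & T x = x.
Proof.
move=> r0 TB Tl; pose u k := iter k T x0.
have uB k : `|u k - x0| <= r.
  by elim: k => [|k IH]; [rewrite /u /= subrr normr0 ltW|exact: TB].
have us k : `|u k.+1 - u k| <= `|u 1%N - u 0%N| * 2^-1 ^+ k.
  elim: k => [|k IH]; first by rewrite expr0 mulr1.
  apply: le_trans (Tl _ _ (uB k.+1) (uB k)) _.
  by rewrite exprS mulrCA ler_wpM2l// invr_ge0.
have [l Hl] := geometric_cvg us; set C := `|_| * 2 in Hl.
have C0 : 0 <= C by rewrite mulr_ge0.
have small (a : R) : (forall k, a <= C * 2^-1 ^+ k) -> a <= 0.
  move=> Ha; apply/ler_addgt0Pl => e e0; rewrite addr0.
  have : (2^-1 : R) ^+ k @[k --> \oo] --> 0.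
    by apply: cvg_expr; rewrite ger0_norm ?invr_ge0// invf_lt1// ltr1n.
  have C1 : 0 < e / (C + 1) by rewrite divr_gt0// ltr_wpDl.
  move=> /cvgrPdist_lt /(_ _ C1) [k _ /(_ k (leqnn k))].
  rewrite /= sub0r normrN ger0_norm ?exprn_ge0 ?invr_ge0// ltr_pdivlMr ?ltr_wpDl// mulrC => Hk.
  apply: le_trans (Ha k) _; apply: le_trans (ltW Hk).
  by apply: ler_wpM2r; rewrite ?exprn_ge0 ?invr_ge0// lerDl.
have lB : `|l - x0| <= r.
  rewrite -subr_le0; apply: small => k; rewrite lerBlDr.
  by apply: le_trans (ler_distD (u k) _ _) _; rewrite [`|l - _|]distrC; exact: lerD.
exists l => //; apply/eqP; rewrite -subr_eq0 -normr_le0; apply: small => k.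
apply: le_trans (ler_distD (u k.+1) _ _) _.
have H1 : `|T l - u k.+1| <= 2^-1 * (C * 2^-1 ^+ k).
  by apply: le_trans (Tl _ _ lB (uB k)) _; rewrite ler_wpM2l ?invr_ge0// distrC.
have := Hl k.+1; rewrite exprS => H2; have := lerD H1 H2.
move/le_trans; apply; rewrite [C * (_ * _)]mulrCA -mulrDl -[in leRHS](mul1r (C * _)).
by rewrite ler_wpM2r ?mulr_ge0 ?exprn_ge0 ?invr_ge0//; lra.
Qed.

Lemma mulmx_norm_le n m (A : 'M[R]_(n, m)) :
  exists2 K, 0 <= K & forall v : 'rV[R]_n, `|v *m A| <= K * `|v|.
Proof.
exists (\sum_i \sum_j `|A i j|); first by apply: sumr_ge0 => i _; exact: sumr_ge0.
move=> w; rewrite rV_norm_le; last by rewrite mulr_ge0// sumr_ge0// => i _; exact: sumr_ge0.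
apply/forallP => j; rewrite mxE mulr_suml; apply: le_trans (ler_norm_sum _ _ _) _.
apply: ler_sum => i _; rewrite normrM mulrC; apply: ler_pM => //.
  by rewrite (bigD1 j)//= lerDl sumr_ge0.
by have := lexx `|w|; rewrite rV_norm_le// => /forallP /(_ i).
Qed.

(** The transposed Jacobian, since vectors are rows and act from the left. *)
Definition partials n m (f : 'rV[R]_n -> 'rV[R]_m) (x : 'rV[R]_n) : 'M[R]_(n, m) :=
  \matrix_(i, j) ('D_(delta_mx 0 i) f x) 0 j.

Lemma derive_partials n m (f : 'rV[R]_n -> 'rV[R]_m) x v :
  differentiable f x -> 'D_v f x = v *m partials f x.
Proof.
move=> df; rewrite derive_sum_delta//; apply/rowP => j; rewrite summxE mxE.
by apply: eq_bigr => i _; rewrite !mxE.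
Qed.

Lemma smooth_at_partials n m (f : 'rV[R]_n -> 'rV[R]_m) x i j :
  smooth_at x f -> smooth_at x (fun y => partials f y i j).
Proof.
move=> sf; under eq_fun do rewrite mxE.
by apply: smooth_at_coord; exact: smooth_at_derive.
Qed.

Lemma mulmxr_continuous n m (A : 'M[R]_(n, m)) : continuous (fun v : 'rV[R]_n => v *m A).
Proof.
move=> x; apply: differentiable_continuous; apply: smooth_at_diff.
by apply: smooth_at_mulmx => [|i j]; [exact: smooth_at_id|exact: smooth_at_cst].
Qed.

(** * Local inverse of a map close to the identity *)

Section local_inverse.
Variables (n : nat) (Phi : 'rV[R]_n -> 'rV[R]_n) (x0 : 'rV[R]_n) (r : R).
Hypothesis r0 : 0 < r.
Hypothesis Phi_smooth : forall x, `|x - x0| <= r -> smooth_at x Phi.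
Hypothesis Phi_unit : forall x, `|x - x0| <= r -> partials Phi x \in unitmx.
Hypothesis Phi_near_id : forall x y, `|x - x0| <= r -> `|y - x0| <= r ->
  `|(x - Phi x) - (y - Phi y)| <= 2^-1 * `|x - y|.

(* A value of the inverse is the fixed point of the contraction [x |-> y + (x - Phi x)]. *)
Let psi y : 'rV[R]_n := xget x0 [set x | `|x - x0| <= r /\ Phi x = y].

Let Phi_lower x y : `|x - x0| <= r -> `|y - x0| <= r -> `|x - y| <= 2 * `|Phi x - Phi y|.
Proof.
move=> xr yr; have H := Phi_near_id xr yr.
have : `|x - y| <= `|(x - Phi x) - (y - Phi y)| + `|Phi x - Phi y|.
  have E : x - y = (x - Phi x - (y - Phi y)) + (Phi x - Phi y).
    by apply/rowP => k; rewrite !mxE; ring.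
  by rewrite {1}E; exact: ler_normD.
by move=> H1; lra.
Qed.

(** The contraction uses up half of the radius [r], and the other half is the room left for [y]. *)
Let psiP y : `|y - Phi x0| <= r / 2 -> `|psi y - x0| <= r /\ Phi (psi y) = y.
Proof.
move=> yr; have B0 : `|x0 - x0| <= r by rewrite subrr normr0 ltW.
have [||x xr Tx] := @contraction_fixpoint n x0 r (fun x => y + (x - Phi x)) r0.
- move=> x xr; have := Phi_near_id xr B0.
  have -> : y + (x - Phi x) - x0 = (y - Phi x0) + ((x - Phi x) - (x0 - Phi x0)).
    by apply/rowP => k; rewrite !mxE; ring.
  by move=> H; apply: le_trans (ler_normD _ _) _; lra.
- by move=> x x' xr xr'; rewrite opprD addrACA subrr add0r; exact: Phi_near_id.
have : [set x | `|x - x0| <= r /\ Phi x = y] x.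
  split => //; apply/rowP => k; move/rowP/(_ k): Tx; rewrite !mxE => Tx.
  by move: Tx => /(congr1 (fun z => z - x 0 k + Phi x 0 k)); rewrite subrr add0r => <-; ring.
by move=> Sx; have := @xgetPex _ x0 _ (ex_intro _ x Sx).
Qed.

Let psiK x : `|x - x0| <= r -> `|Phi x - Phi x0| <= r / 2 -> psi (Phi x) = x.
Proof.
move=> xr Pr; have [p1 p2] := psiP Pr; apply/eqP; rewrite -subr_eq0 -normr_le0.
by apply: le_trans (Phi_lower p1 xr) _; rewrite p2 subrr normr0 mulr0.
Qed.

Let psi_lip y y' : `|y - Phi x0| <= r / 2 -> `|y' - Phi x0| <= r / 2 ->
  `|psi y - psi y'| <= 2 * `|y - y'|.
Proof.
move=> yr yr'; have [p1 p2] := psiP yr; have [q1 q2] := psiP yr'.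
by have := Phi_lower p1 q1; rewrite p2 q2.
Qed.

Let U : set 'rV[R]_n := [set y | `|y - Phi x0| < r / 2].

Let psi0 : psi (Phi x0) = x0.
Proof. by apply: psiK; rewrite subrr normr0; move: r0; lra. Qed.

Let psi_U y : U y -> `|psi y - x0| < r.
Proof.
move=> Uy; rewrite -[in X in `|X|]psi0.
have E : `|Phi x0 - Phi x0| <= r / 2 by rewrite subrr normr0; move: r0; lra.
apply: le_lt_trans (psi_lip (ltW Uy) E) _; rewrite mulrC -ltr_pdivlMr//.
Qed.

Let psi_diff y : U y -> is_diff y psi (fun v => v *m invmx (partials Phi (psi y))).
Proof.
move=> Uy; set A := invmx _; have [p1 p2] := psiP (ltW Uy).
have dP := smooth_at_diff (Phi_smooth p1).
have [K K0 HK] := mulmx_norm_le A.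
apply: (@is_diff_epsP _ _ _ _ (mulmxr A : {linear 'rV[R]_n -> 'rV[R]_n})).
  exact: mulmxr_continuous.
(* The 2 pays for the Lipschitz constant of [psi] and [K + 1] for the norm of the inverse Jacobian;
   adding 1 avoids a division by zero. *)
move=> e e0; have e1 : 0 < e / (2 * (K + 1)) by rewrite divr_gt0// mulr_gt0// ltr_wpDl.
have H1 : \forall k \near (0 : 'rV[R]_n), `|Phi (k + psi y) - y - k *m partials Phi (psi y)|
    <= e / (2 * (K + 1)) * `|k|.
  have := diff_eps dP e1; apply: filterS => k; rewrite p2.
  by rewrite -(deriveE _ dP) derive_partials.
have [d d0 Hd] := (near_ballP _ _).1 H1.
have nU : \forall h \near (0 : 'rV[R]_n), U (h + y).
  have : \forall z \near y, U z by apply: open_nbhs_nbhs; split => //; exact: open_normball.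
  by rewrite (near_shift 0 y) /=; apply: filterS => h; rewrite subr0.
apply/near_ballP; have [d1 d10 Hd1] := (near_ballP _ _).1 nU.
(* [d1] keeps [h + y] in [U]; [d / 2] keeps the increment [k] of [psi], of size at most twice that
   of [h], within [d]. *)
exists (Num.min d1 (d / 2)); first by rewrite lt_min d10 divr_gt0.
move=> h; rewrite subr0 le_min => /andP[h1 h2].
have Uh : U (h + y) by apply: Hd1; rewrite subr0.
have [q1 q2] := psiP (ltW Uh); set k := psi (h + y) - psi y.
have kh : `|k| <= 2 * `|h|.
  by have := psi_lip (ltW Uh) (ltW Uy); rewrite addrK.
have kd : `|k| <= d by lra.
have := Hd k; rewrite subr0 => /(_ kd); rewrite /k subrK q2 addrK -/k => Hk.
have -> : k - mulmxr A h = - ((h - k *m partials Phi (psi y)) *m A).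
  by rewrite mulmxBl mulmxK ?Phi_unit// opprB.
rewrite normrN; apply: le_trans (HK _) _.
have H2 : `|h - k *m partials Phi (psi y)| <= e / (2 * (K + 1)) * (2 * `|h|).
  by apply: le_trans Hk _; rewrite ler_wpM2l// ltW.
apply: le_trans (ler_wpM2l K0 H2) _.
have -> : K * (e / (2 * (K + 1)) * (2 * `|h|)) = (K / (K + 1)) * (e * `|h|).
  by field; rewrite gt_eqF// ltr_wpDl.
have : K / (K + 1) <= 1 by rewrite ler_pdivrMr ?ltr_wpDl// mul1r lerDl.
move=> H3; rewrite -[leRHS]mul1r ler_wpM2r// mulr_ge0// ltW//.
Qed.

Let B : set 'rV[R]_n := [set x | `|x - x0| < r].

Let invmx_smooth i j : smooth_on B (fun x => invmx (partials Phi x) i j).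
Proof.
apply/smooth_onP; first exact: open_normball.
move=> x /ltW xr; apply: smooth_at_invmx; first exact: Phi_unit.
by move=> a b; apply: smooth_at_partials; exact: Phi_smooth.
Qed.

(** Bootstrap: the derivative of [psi] is the inverse Jacobian of [Phi] evaluated at [psi], hence
    has at least the regularity already known for [psi]. *)
Let psi_Ck k : Ck k U psi.
Proof.
have oU : open U by exact: open_normball.
elim: k => [|k IH].
  move=> y Uy; have [d _] := psi_diff Uy; exact: differentiable_continuous.
split=> [y /psi_diff []//|v].
have : Ck k U (fun y => \row_j \sum_i v 0 i * ((fun x => invmx (partials Phi x) i j) \o psi) y).
  apply: Ck_row => // j; under eq_fun do rewrite mxE.
  apply: Ck_sum => // i _; apply: (Ck_mul oU (@Ck_cst R _ R _ _ _)).
  exact: (Ck_comp oU psi_U IH (@invmx_smooth i j k)).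
apply: (Ck_ext oU) => y; rewrite inE => Uy.
have [d E] := psi_diff Uy; rewrite deriveE// E.
by apply/rowP => j; rewrite !mxE.
Qed.

Lemma local_inverse_aux : exists psi : 'rV[R]_n -> 'rV[R]_n,
  [/\ smooth_at (Phi x0) psi, psi (Phi x0) = x0 & \forall x \near x0, psi (Phi x) = x].
Proof.
exists psi; split => //.
  exists U; last by move=> k; exact: psi_Ck.
  by split; [exact: open_normball|rewrite /U /= subrr normr0 divr_gt0].
have B0 : `|x0 - x0| <= r by rewrite subrr normr0 ltW.
have cP := smooth_at_cont (Phi_smooth B0).
have n1 : \forall x \near x0, U (Phi x).
  apply: (near_comp cP); apply: open_nbhs_nbhs; split; first exact: open_normball.
  by rewrite /U /= subrr normr0 divr_gt0.
have n2 : \forall x \near x0, B x.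
  by apply: open_nbhs_nbhs; split; [exact: open_normball|rewrite /B /= subrr normr0].
by apply: filterS2 n1 n2 => x /ltW Ux /ltW Bx; exact: psiK.
Qed.
End local_inverse.

Lemma local_inverse n (Phi : 'rV[R]_n -> 'rV[R]_n) (x0 : 'rV[R]_n) :
  smooth_at x0 Phi -> (forall v, 'D_v Phi x0 = v) ->
  exists psi : 'rV[R]_n -> 'rV[R]_n,
  [/\ smooth_at (Phi x0) psi, psi (Phi x0) = x0 & \forall x \near x0, psi (Phi x) = x].
Proof.
move=> sP dP; pose g x := x - Phi x.
have sg : smooth_at x0 g.
  apply: smooth_at_row => j; under eq_fun do rewrite !mxE.
  by apply: smooth_at_sub; apply: smooth_at_coord => //; exact: smooth_at_id.
have dg v : 'D_v g x0 = 0.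
  have dPx : derivable Phi x0 v by apply: diff_derivable; exact: smooth_at_diff.
  have -> : g = id - Phi by [].
  by rewrite (deriveB (@derivable_id _ _ x0 v) dPx) derive_id dP subrr.
(* The derivative of [g] vanishes at [x0], so any positive bound is available; this one makes the
   Lipschitz constant, which carries a factor [n], at most one half. The successor allows for
   [n = 0]. *)
have [|r1 r10 H1] := @smooth_at_lip _ _ g x0 (2 * n.+1%:R)^-1 sg.
  by move=> i j; rewrite dg mxE normr0 invr_gt0 mulr_gt0.
have p1 : partials Phi x0 = 1%:M.
  by apply/matrixP => i j; rewrite !mxE dP mxE eqxx /= eq_sym.
have n1 : \forall x \near x0, \det (partials Phi x) != 0.
  apply: near_neq0; last by rewrite p1 det1 oner_neq0.
  by apply: smooth_at_cont; apply: smooth_at_det => i j; exact: smooth_at_partials.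
have n2 : \forall x \near x0, smooth_at x Phi /\ \det (partials Phi x) != 0.
  by apply: filterS2 n1 (smooth_at_near sP).
have [r2 r20 H2] := (near_ballP _ _).1 n2.
have r0 : 0 < Num.min r1 r2 by rewrite lt_min r10 r20.
apply: (@local_inverse_aux n Phi x0 (Num.min r1 r2)) => //.
- by move=> x; rewrite le_min => /andP[_ /H2 []].
- by move=> x; rewrite le_min => /andP[_ /H2 [_ u]]; rewrite unitmxE unitfE.
- move=> x y; rewrite !le_min => /andP[x1 _] /andP[y1 _].
  apply: le_trans (H1 _ _ x1 y1) _; rewrite ler_wpM2r//.
  rewrite ger0_norm ?invr_ge0 ?mulr_ge0// invfM mulrCA -[leRHS]mulr1 ler_wpM2l ?invr_ge0//.
  by rewrite ler_pdivrMr// mul1r ler_nat.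
Qed.

End inverse_function.

(** * Ordinary differential equations *)

Section ode.
Variable R : realType.

(** Picard iteration will run on [[-d, d]] with [d <= 1], so primitives on a fixed larger open
    interval suffice. The integral starts at -2 to make 0 an interior point, and its value at 0 is
    then subtracted. *)
Lemma primitive_exists (h : R -> R) : continuous h ->
  exists H : R -> R, H 0 = 0 /\ forall t : R, -2 < t < 2 -> is_derive t 1 H (h t).
Proof.
move=> ch; pose F x := (\int[@lebesgue_measure R]_(t in `[-2, x]) h t)%R.
exists (fun x => F x - F 0); split=> [|t /andP[t1 t2]]; first by rewrite subrr.
have ih : (@lebesgue_measure R).-integrable `[-2, 2] (EFin \o h).
  apply: continuous_compact_integrable; first exact: segment_compact.
  exact: continuous_subspaceT.
have [dF EF] := continuous_FTC1_closed t2 ih t1 (ch t).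
have dF1 : is_derive t 1 F (h t).
  by apply: (DeriveDef dF); rewrite -derive1E; exact: EF.
have := is_deriveB dF1 (@is_derive_cst R R R (F 0) t 1).
by rewrite subr0.
Qed.

Lemma is_derive_row n (f : R -> 'rV[R]_n) (df : 'rV[R]_n) (t : R) :
  (forall j, is_derive t 1 (fun s => f s 0 j) (df 0 j)) -> is_derive t 1 f df.
Proof.
move=> H; have df1 : derivable f t 1.
  by apply/derivable_mxP => i j; rewrite ord1; have [] := H j.
split => //; rewrite derive_mx//; apply/rowP => j; rewrite mxE.
by have [_ ->] := H j.
Qed.

Lemma is_derive_coord n (f : R -> 'rV[R]_n) (df : 'rV[R]_n) (t : R) j :
  is_derive t 1 f df -> is_derive t 1 (fun s => f s 0 j) (df 0 j).
Proof.
move=> [d1 d2]; have d3 := (derivable_mxP _ _ _).1 d1 0 j.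
by split => //; rewrite -d2 derive_mx// mxE.
Qed.

Lemma primitive_row_exists n (h : R -> 'rV[R]_n) (a : 'rV[R]_n) : continuous h ->
  exists H : R -> 'rV[R]_n, H 0 = a /\ forall t : R, -2 < t < 2 -> is_derive t 1 H (h t).
Proof.
move=> ch; have H1 (j : 'I_n) : exists H : R -> R,
    H 0 = 0 /\ forall t : R, -2 < t < 2 -> is_derive t 1 H (h t 0 j).
  apply: primitive_exists => t.
  exact: (continuous_comp (ch t) (@coord_continuous _ _ _ 0 j _)).
have [H HP] := choice H1; exists (fun t => \row_j (H j t + a 0 j)); split.
  by apply/rowP => j; rewrite mxE (HP j).1 add0r.
move=> t t2; apply: is_derive_row => j; under eq_fun do rewrite mxE.
have := is_deriveD ((HP j).2 t t2) (@is_derive_cst R R R (a 0 j) t 1).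
by rewrite addr0.
Qed.

Lemma derive_bound_lip n (f df : R -> 'rV[R]_n) (d C : R) : 0 <= C ->
  (forall t : R, -d <= t <= d -> is_derive t 1 f (df t)) ->
  (forall t : R, -d <= t <= d -> `|df t| <= C) ->
  forall s t : R, -d <= s <= d -> -d <= t <= d -> `|f t - f s| <= C * `|t - s|.
Proof.
move=> C0 Hd Hb s t /andP[s1 s2] /andP[t1 t2].
rewrite rV_norm_le ?mulr_ge0//; apply/forallP => j.
have I c : Num.min s t <= c <= Num.max s t -> -d <= c <= d.
  by rewrite ge_min le_max => /andP[/orP[] c1 /orP[] c2]; lra.
have [c cI E] := @mvt_real R (fun t => f t 0 j) (fun t => df t 0 j) s t
  (fun c cI => is_derive_coord j (Hd c (I c cI))).
rewrite !mxE E normrM ler_wpM2r//.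
by have := Hb c (I c cI); rewrite rV_norm_le// => /forallP.
Qed.

(** The retraction onto the interval of centre [a] and radius [r], which is 1-Lipschitz. It serves
    twice: on time in the Picard iteration, and on the coordinates of space in [clamp_row]. *)
Definition clamp (a r x : R) : R := Num.max (a - r) (Num.min (a + r) x).

Lemma clamp_lip a r x y : `|clamp a r x - clamp a r y| <= `|x - y|.
Proof.
have h1 : x - y <= `|x - y| by exact: ler_norm.
have h2 : y - x <= `|x - y| by rewrite distrC; exact: ler_norm.
have h3 : 0 <= `|x - y| by [].
move: `|x - y| h1 h2 h3 => e h1 h2 h3; rewrite ler_norml /clamp.
case: (leP (a + r) x) => ?; case: (leP (a + r) y) => ?;
  case: (leP (a - r) _) => ?; try (case: (leP (a - r) _) => ?); apply/andP; split; lra.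
Qed.

Lemma clamp_bound a r x : 0 <= r -> `|clamp a r x - a| <= r.
Proof.
move=> r0; rewrite ler_norml lerBrDr lerBlDr /clamp le_max ge_max ge_min.
by apply/andP; split; [rewrite addrC lexx|rewrite [r + a]addrC lexx andbT; lra].
Qed.

Lemma clamp_id a r x : `|x - a| <= r -> clamp a r x = x.
Proof.
rewrite ler_norml => /andP[h1 h2]; rewrite /clamp min_r; last lra.
by rewrite max_r//; lra.
Qed.

Lemma lip_continuous (V W : normedModType R) (f : V -> W) C :
  (forall s t, `|f s - f t| <= C * `|s - t|) -> continuous f.
Proof.
move=> H t; apply/cvgrPdist_lt => e e0.
have C0 : 0 < `|C| + 1 by rewrite ltr_wpDl.
have d0 : 0 < e / (`|C| + 1) by rewrite divr_gt0.
have idt : s @[s --> t] --> t by exact: cvg_id.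
move/cvgrPdist_lt: idt => /(_ _ d0); apply: filterS => s st.
apply: le_lt_trans (H t s) _; move: st; rewrite ltr_pdivlMr// mulrC; apply: le_lt_trans.
by rewrite ler_wpM2r//; apply: le_trans (ler_norm _) _; rewrite lerDl.
Qed.

(** Bootstrap: if [z] is of class k, so is [F \o z], which is the derivative of [z]. *)
Lemma ode_smooth n (F : 'rV[R]_n -> 'rV[R]_n) (U : set 'rV[R]_n) (I : set R)
    (z : R -> 'rV[R]_n) :
  open I -> open U -> smooth_on U F -> (forall t : R, I t -> U (z t)) ->
  (forall t : R, I t -> is_derive t 1 z (F (z t))) -> smooth_on I z.
Proof.
move=> oI oU sF zU dz k.
have dz1 t : I t -> differentiable z t.
  by move=> /dz [d _]; exact/derivable1_diffP.
elim: k => [|k IH]; first by move=> t It; exact/differentiable_continuous/dz1.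
split => // v; have : Ck k I (fun t : R => \row_j (v * ((fun x => F x 0 j) \o z) t)).
  apply: Ck_row => // j; under eq_fun do rewrite mxE.
  apply: (Ck_mul oI (@Ck_cst R _ R _ _ _)).
  exact: (Ck_comp oI zU IH (Ck_coord j oU (sF k))).
apply: (Ck_ext oI) => t; rewrite inE => It.
rewrite (deriveE _ (dz1 t It)); have [d E] := dz t It.
have -> : v = v *: (1 : R) by rewrite /GRing.scale /= mulr1.
rewrite linearZ -(deriveE _ (dz1 t It)) E.
by apply/rowP => j; rewrite !mxE /= /GRing.scale /= mulr1.
Qed.

Lemma geometric_small (a C : R) : 0 <= C -> (forall k, a <= C * 2^-1 ^+ k) -> a <= 0.
Proof.
move=> C0 Ha; apply/ler_addgt0Pl => e e0; rewrite addr0.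
have : (2^-1 : R) ^+ k @[k --> \oo] --> 0.
  by apply: cvg_expr; rewrite ger0_norm ?invr_ge0// invf_lt1// ltr1n.
have C1 : 0 < e / (C + 1) by rewrite divr_gt0// ltr_wpDl.
move=> /cvgrPdist_lt /(_ _ C1) [k _ /(_ k (leqnn k))].
rewrite /= sub0r normrN ger0_norm ?exprn_ge0 ?invr_ge0// ltr_pdivlMr ?ltr_wpDl// mulrC => Hk.
apply: le_trans (Ha k) _; apply: le_trans (ltW Hk).
by apply: ler_wpM2r; rewrite ?exprn_ge0 ?invr_ge0// lerDl.
Qed.

(** Integration over a time at most [d] multiplies the distance of two curves by at most [d * K],
    hence by at most one half, so the iterates converge geometrically and uniformly. *)
Lemma picard_lindelof n (F : 'rV[R]_n -> 'rV[R]_n) (z0 : 'rV[R]_n) (K C d : R) :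
  0 <= K -> (forall x y, `|F x - F y| <= K * `|x - y|) -> (forall x, `|F x| <= C) ->
  0 < d -> d <= 1 -> d * K <= 2^-1 ->
  exists y : R -> 'rV[R]_n, [/\ y 0 = z0,
    forall s t : R, `|y s - y t| <= C * `|s - t| &
    forall t : R, -d < t < d -> is_derive t 1 y (F (y t))].
Proof.
move=> K0 FK FC d0 d1 dK.
have C0 : 0 <= C by apply: le_trans (FC z0).
have cF : continuous F by exact: lip_continuous FK.
(* [choice] wants an operator on all curves; discontinuous ones receive the zero curve, and no
   iterate is of that kind. *)
have [P HP] : exists P : (R -> 'rV[R]_n) -> R -> 'rV[R]_n, forall y, continuous y ->
    P y 0 = z0 /\ forall t : R, -2 < t < 2 -> is_derive t 1 (P y) (F (y t)).
  have H (y : R -> 'rV[R]_n) : exists H : R -> 'rV[R]_n, continuous y ->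
      H 0 = z0 /\ forall t : R, -2 < t < 2 -> is_derive t 1 H (F (y t)).
    have [cy|ncy] := pselect (continuous y); last by exists (fun=> 0).
    have [|H HH] := @primitive_row_exists _ (F \o y) z0; last by exists H.
    by move=> t; apply: continuous_comp; [exact: cy|exact: cF].
  by have [P HP] := choice H; exists P.
pose c := clamp 0 d.
have cB t : -d <= c t <= d.
  by have := clamp_bound 0 t (ltW d0); rewrite subr0 ler_norml.
have cI t : -d <= t <= d -> c t = t.
  by move=> td; apply: clamp_id; rewrite subr0 ler_norml.
have z2 t : -d <= t <= d -> -2 < t < 2 by move=> /andP[? ?]; apply/andP; split; lra.
have dz : -d <= 0 <= d by apply/andP; split; lra.
have Plip y : continuous y -> forall s t : R, `|P y (c s) - P y (c t)| <= C * `|s - t|.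
  move=> cy s t; apply: le_trans (@derive_bound_lip _ (P y) (F \o y) d C C0 _ _ _ _ (cB t) (cB s)) _.
  - by move=> u ud; apply: (HP y cy).2; exact: z2.
  - by move=> u _; exact: FC.
  - by rewrite ler_wpM2l//; exact: clamp_lip.
have Pdist y y' e : 0 <= e -> continuous y -> continuous y' ->
    (forall t, -d <= t <= d -> `|y t - y' t| <= e) ->
    forall t, -d <= t <= d -> `|P y t - P y' t| <= 2^-1 * e.
  move=> e0 cy cy' yy' t td; have [p1 p2] := HP y cy; have [q1 q2] := HP y' cy'.
  have := @derive_bound_lip _ (fun t => P y t - P y' t) (fun t => F (y t) - F (y' t)) d (K * e)
    (mulr_ge0 K0 e0) _ _ 0 t dz td.
  rewrite p1 q1 subrr !subr0 => H.
  have H1 : `|P y t - P y' t| <= K * e * `|t|.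
    apply: H => u ud; first by exact: (is_deriveB (p2 u (z2 u ud)) (q2 u (z2 u ud))).
    by apply: le_trans (FK _ _) _; rewrite ler_wpM2l//; exact: yy'.
  apply: le_trans H1 _; rewrite mulrAC; rewrite ler_wpM2r//.
  by rewrite mulrC; apply: le_trans dK; rewrite ler_wpM2r// ler_norml.
(* Clamping time freezes each iterate outside [[-d, d]], which makes it Lipschitz on the whole line
   and so a legitimate argument of [P]. *)
pose u k := iter k (fun y t => P y (c t)) (fun=> z0).
have uc k : continuous (u k).
  elim: k => [|k IH]; first exact: cst_continuous.
  by apply: lip_continuous; exact: Plip.
have us k t : -d <= t <= d -> `|u k.+1 t - u k t| <= C * 2^-1 ^+ k.
  elim: k t => [|k IH] t td.
    have := Plip _ (uc 0%N) t 0; rewrite (cI 0 dz) (HP _ (uc 0%N)).1 subr0.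
    rewrite expr0 mulr1 => /le_trans; apply; rewrite -[leRHS]mulr1 ler_wpM2l//.
    by rewrite ler_norml; move: td => /andP[? ?]; apply/andP; split; lra.
  rewrite exprS mulrCA [u k.+2 t]/= [in X in _ - X]/= cI//.
  apply: Pdist => //; first by rewrite mulr_ge0 ?exprn_ge0 ?invr_ge0.
  exact: uc k.+1.
have [y Hy] : exists y : R -> 'rV[R]_n, forall t k, `|u k (c t) - y t| <= C * 2 * 2^-1 ^+ k.
  have Hl t : exists l, forall k, `|u k (c t) - l| <= C * 2 * 2^-1 ^+ k.
    by apply: geometric_cvg => k; exact: us.
  by have [y Hy] := choice Hl; exists y.
have C20 : 0 <= C * 2 by rewrite mulr_ge0.
have yl s t : `|y s - y t| <= C * `|s - t|.
  rewrite -subr_le0; apply: (@geometric_small _ (C * 2 + C * 2)); first exact: addr_ge0.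
  move=> k; rewrite lerBlDr mulrDl.
  apply: le_trans (ler_distD (u k (c s)) _ _) _; rewrite -addrA; apply: lerD.
    by rewrite distrC; exact: Hy.
  apply: le_trans (ler_distD (u k (c t)) _ _) _; rewrite [leRHS]addrC; apply: lerD; last exact: Hy.
  case: k => [|k]; first by rewrite /= subrr normr0 mulr_ge0.
  by rewrite /= !(cI (c _) (cB _)); exact: Plip.
have cy := lip_continuous yl.
have yP t : -d <= t <= d -> y t = P y t.
  move=> td; apply/eqP; rewrite -subr_eq0 -normr_le0; apply: (geometric_small C20) => k.
  apply: le_trans (ler_distD (u k.+1 t) _ _) _.
  have H1 : `|y t - u k.+1 t| <= C * 2 * 2^-1 ^+ k.+1.
    by rewrite distrC -{1}(cI t td); exact: Hy.
  have H2 : `|u k.+1 t - P y t| <= 2^-1 * (C * 2 * 2^-1 ^+ k).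
    rewrite /= cI//; apply: Pdist => //; first by rewrite mulr_ge0 ?exprn_ge0 ?invr_ge0.
    by move=> v vd; rewrite -{1}(cI v vd); exact: Hy.
  apply: le_trans (lerD H1 H2) _; rewrite exprS [C * 2 * (_ * _)]mulrCA -mulrDl.
  by rewrite -[leRHS]mul1r ler_wpM2r ?mulr_ge0 ?exprn_ge0 ?invr_ge0//; lra.
exists y; split=> [|//|t td]; first by rewrite yP// (HP y cy).1.
have td' : -d <= t <= d by move: td => /andP[? ?]; apply/andP; split; lra.
apply: (@near_eq_is_derive _ _ _ (P y)); last by apply: (HP y cy).2; exact: z2.
move: td => /andP[t1 t2]; apply: filterS2 (lt_nbhsr t1) (lt_nbhsl t2) => s s1 s2.
by rewrite yP// !ltW.
Qed.

Definition clamp_row n (a : 'rV[R]_n) r (x : 'rV[R]_n) : 'rV[R]_n :=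
  \row_j clamp (a 0 j) r (x 0 j).

Lemma open_centered_itv (d : R) : open [set t : R | -d < t < d].
Proof.
have -> : [set t : R | -d < t < d] = ball (0 : R) d.
  by apply/seteqP; split=> x; rewrite /ball /= sub0r normrN ltr_norml.
exact: ball_open.
Qed.

(* Clamping the coordinates of the argument turns the locally Lipschitz field
   into a globally Lipschitz and bounded one. *)
Lemma ode_exists n (F : 'rV[R]_n -> 'rV[R]_n) (U : set 'rV[R]_n) (z0 : 'rV[R]_n) :
  open U -> U z0 -> smooth_on U F ->
  exists d, exists z : R -> 'rV[R]_n, [/\ 0 < d, z 0 = z0, smooth_on [set t : R | -d < t < d] z &
    forall t : R, -d < t < d -> U (z t) /\ is_derive t 1 z (F (z t))].
Proof.
move=> oU Uz sF; have sFz : smooth_at z0 F by exists U.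
(* Strictly above every partial derivative at [z0], as [smooth_at_lip] requires. *)
pose c := 1 + \sum_i \sum_j `|('D_(delta_mx 0 i) F z0) 0 j|.
have [|r1 r10 H1] := @smooth_at_lip _ _ _ F z0 c sFz.
  move=> i j; rewrite /c (bigD1 i)//= (bigD1 j)//= addrCA -addrA ltrDl.
  rewrite addrCA ltr_pwDl// addr_ge0 ?sumr_ge0// => k _; exact: sumr_ge0.
set K := n%:R * `|c| in H1; have K0 : 0 <= K by rewrite mulr_ge0.
have [r2 r20 H2] := (near_ballP _ _).1 (open_nbhs_nbhs (conj oU Uz) : \forall x \near z0, U x).
pose r := Num.min r1 r2; have r0 : 0 < r by rewrite lt_min r10.
pose p := clamp_row z0 r.
have pB x : `|p x - z0| <= r.
  rewrite rV_norm_le ?ltW//; apply/forallP => j; rewrite !mxE.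
  exact: clamp_bound (ltW r0).
have pid x : `|x - z0| <= r -> p x = x.
  rewrite rV_norm_le ?(ltW r0)// => /forallP xr; apply/rowP => j; rewrite mxE clamp_id//.
  by have := xr j; rewrite !mxE.
have pl x y : `|p x - p y| <= `|x - y|.
  rewrite rV_norm_le//; apply/forallP => j; rewrite !mxE; apply: le_trans (clamp_lip _ _ _ _) _.
  by have := lexx `|x - y|; rewrite rV_norm_le// => /forallP /(_ j); rewrite !mxE.
have r1P x : `|x - z0| <= r -> `|x - z0| <= r1 by rewrite le_min => /andP[].
have r2P x : `|x - z0| <= r -> U x by rewrite le_min => /andP[_]; exact: H2.
have FK x y : `|F (p x) - F (p y)| <= K * `|x - y|.
  by apply: le_trans (H1 _ _ (r1P _ (pB x)) (r1P _ (pB y))) _; rewrite ler_wpM2l.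
pose C := `|F z0| + K * r.
have FC x : `|F (p x)| <= C.
  rewrite -[F (p x)](subrK (F z0)); apply: le_trans (ler_normD _ _) _.
  rewrite addrC lerD2l; apply: le_trans (H1 _ z0 (r1P _ (pB x)) _) _.
    by rewrite subrr normr0 ltW.
  by rewrite ler_wpM2l.
have C0 : 0 <= C by rewrite addr_ge0 ?mulr_ge0// ltW.
(* The first two bounds are the hypotheses of [picard_lindelof]; the third keeps the solution within
   distance [r] of [z0], where clamping is the identity, so that it solves the original equation. *)
pose d := Num.min 1 (Num.min ((2 * (K + 1))^-1) (r / (C + 1))).
have d0 : 0 < d by rewrite !lt_min ltr01 invr_gt0 mulr_gt0 ?divr_gt0// ltr_wpDl.
have d1 : d <= 1 by rewrite ge_min lexx.
have dK : d * K <= 2^-1.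
  have : d <= (2 * (K + 1))^-1 by rewrite !ge_min lexx orbT.
  move=> H; apply: le_trans (ler_wpM2r K0 H) _.
  rewrite ler_pdivrMl ?mulr_gt0 ?ltr_wpDl// mulrAC divff// mul1r; lra.
have dC : C * d <= r.
  have : d <= r / (C + 1) by rewrite !ge_min lexx !orbT.
  move=> H; apply: le_trans (ler_wpM2l C0 H) _.
  by rewrite mulrA ler_pdivrMr ?ltr_wpDl// mulrC ler_wpM2l ?(ltW r0)// lerDl.
have [z [zz zl zd]] := picard_lindelof z0 K0 FK FC d0 d1 dK.
have zr t : -d < t < d -> `|z t - z0| <= r.
  move=> td; rewrite -[in X in _ - X]zz; apply: le_trans (zl _ _) _; apply: le_trans dC.
  by rewrite ler_wpM2l// subr0 ler_norml; move: td => /andP[? ?]; apply/andP; split; lra.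
have P2 t : -d < t < d -> U (z t) /\ is_derive t 1 z (F (z t)).
  move=> td; split; first exact/r2P/zr.
  by rewrite -[in X in is_derive _ _ _ X](pid _ (zr t td)); exact: zd.
exists d, z; split => //; apply: (@ode_smooth _ F U) => //.
- exact: open_centered_itv.
- by move=> t /P2 [].
- by move=> t /P2 [].
Qed.

End ode.

(** * Smooth functions and tangent maps in charts *)

Section charted_calculus.
Variable R : realType.

(** Common ground of manifolds and total spaces of bundles. Openness of chart domains is expressed
    by [ao_near] in coordinates alone, because [T] has no topology here. *)
Record atlas_ok (T : Type) (A : charted R T) : Prop := AtlasOk {
  ao_at : forall p, cdom (chart_at A p) p;
  ao_mapK : forall (c : cidx A) p, cdom c p -> cinv c (cmap c p) = p;
  ao_near : forall (c d : cidx A) p, cdom c p -> cdom d p ->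
    \forall z \near cmap c p, [/\ cdom c (cinv c z), cmap c (cinv c z) = z & cdom d (cinv c z)];
  ao_trans : forall (c d : cidx A) p, cdom c p -> cdom d p ->
    smooth_at (cmap c p) (cmap d \o cinv c)
}.

(* The suffix [c] refers to charts: smoothness and germs are read in the chart of [p]. *)
Definition smoothc (T : Type) (A : charted R T) (W : normedModType R) (p : T) (g : T -> W) : Prop :=
  smooth_at (cmap (chart_at A p) p) (g \o cinv (chart_at A p)).

Definition nearc (T : Type) (A : charted R T) (p : T) (Q : T -> Prop) : Prop :=
  \forall z \near cmap (chart_at A p) p, Q (cinv (chart_at A p) z).

Lemma nearcW (T : Type) (A : charted R T) (p : T) (Q : T -> Prop) :
  (forall q, Q q) -> nearc A p Q.
Proof.
move=> H; exact: (@nearW _ (nbhs (cmap (chart_at A p) p))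
  (fun z => Q (cinv (chart_at A p) z)) (nbhs_filter _) (fun z => H _)).
Qed.

Lemma nearcS (T : Type) (A : charted R T) (p : T) (Q Q' : T -> Prop) :
  (forall q, Q q -> Q' q) -> nearc A p Q -> nearc A p Q'.
Proof. by rewrite /nearc => H; apply: filterS => z; exact: H. Qed.

Lemma nearcI (T : Type) (A : charted R T) (p : T) (Q Q' : T -> Prop) :
  nearc A p Q -> nearc A p Q' -> nearc A p (fun q => Q q /\ Q' q).
Proof. by rewrite /nearc => H1 H2; apply: filterS2 H1 H2 => z; split. Qed.

Lemma smoothc_ext (T : Type) (A : charted R T) (W : normedModType R) (p : T) (g h : T -> W) :
  nearc A p (fun q => g q = h q) -> smoothc A p g -> smoothc A p h.
Proof. exact: smooth_at_ext. Qed.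

Lemma smoothc_row (T : Type) (A : charted R T) n (p : T) (g : T -> 'rV[R]_n) :
  (forall j, smoothc A p (fun q => g q 0 j)) -> smoothc A p g.
Proof. by move=> H; apply: smooth_at_row => j; exact: H. Qed.

Lemma smoothc_cst (T : Type) (A : charted R T) (W : normedModType R) (p : T) (w : W) :
  smoothc A p (fun=> w).
Proof. exact: smooth_at_cst. Qed.

Lemma smoothc_add (T : Type) (A : charted R T) (W : normedModType R) (p : T) (g h : T -> W) :
  smoothc A p g -> smoothc A p h -> smoothc A p (fun q => g q + h q).
Proof. exact: smooth_at_add. Qed.

Lemma smoothc_sub (T : Type) (A : charted R T) (p : T) (g h : T -> R) :
  smoothc A p g -> smoothc A p h -> smoothc A p (fun q => g q - h q).
Proof. exact: smooth_at_sub. Qed.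

Lemma smoothc_mul (T : Type) (A : charted R T) (p : T) (g h : T -> R) :
  smoothc A p g -> smoothc A p h -> smoothc A p (fun q => g q * h q).
Proof. exact: smooth_at_mul. Qed.

Lemma smoothc_sum (T : Type) (A : charted R T) (W : normedModType R) (p : T)
    (I : Type) (r : seq I) (g : I -> T -> W) :
  (forall i, smoothc A p (g i)) -> smoothc A p (fun q => \sum_(i <- r) g i q).
Proof.
move=> H; exact: (@smooth_at_sum R _ _ _ I r xpredT
  (fun i => g i \o cinv (chart_at A p)) (fun i _ => H i)).
Qed.

Lemma dT_ext (T : Type) (A : charted R T) (W : normedModType R) (p : T) v (g h : T -> W) :
  nearc A p (fun q => g q = h q) -> dT g ((p, v) : tangent_vec A) = dT h ((p, v) : tangent_vec A).
Proof. by move=> H; apply: near_eq_derive. Qed.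

Lemma dT_linear (T : Type) (A : charted R T) (W : normedModType R) (p : T) (g : T -> W) a u v :
  smoothc A p g -> dT g ((p, a *: u + v) : tangent_vec A) =
    a *: dT g ((p, u) : tangent_vec A) + dT g ((p, v) : tangent_vec A).
Proof. by move=> /smooth_at_diff d; rewrite /dT /= !(deriveE _ d) linearP. Qed.

Lemma dT_sum_delta (T : Type) (A : charted R T) (W : normedModType R) (p : T) (g : T -> W) v :
  smoothc A p g -> dT g ((p, v) : tangent_vec A) =
    \sum_i v 0 i *: dT g ((p, delta_mx 0 i) : tangent_vec A).
Proof. by move=> /smooth_at_diff d; rewrite /dT /= derive_sum_delta. Qed.

Lemma dT_add (T : Type) (A : charted R T) (W : normedModType R) (v : tangent_vec A) (g h : T -> W) :
  smoothc A v.1 g -> smoothc A v.1 h -> dT (fun q => g q + h q) v = dT g v + dT h v.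
Proof.
move=> /smooth_at_diff d1 /smooth_at_diff d2.
by rewrite /dT -[RHS](deriveD (diff_derivable d1) (diff_derivable d2)).
Qed.

Lemma dT_cst (T : Type) (A : charted R T) (W : normedModType R) (v : tangent_vec A) (w : W) :
  dT (fun=> w) v = 0.
Proof. exact: (derive_cst w). Qed.

Lemma dT_sum (T : Type) (A : charted R T) (W : normedModType R) (v : tangent_vec A)
    (I : Type) (r : seq I) (g : I -> T -> W) :
  (forall i, smoothc A v.1 (g i)) -> dT (fun q => \sum_(i <- r) g i q) v = \sum_(i <- r) dT (g i) v.
Proof.
move=> H; elim: r => [|i r IH].
  rewrite big_nil -[RHS](dT_cst v (0 : W)); apply: dT_ext.
  by apply: nearcW => q; rewrite big_nil.
rewrite big_cons -IH -dT_add//; last exact: smoothc_sum.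
by apply: dT_ext; apply: nearcW => q; rewrite big_cons.
Qed.

Lemma dT_coord (T : Type) (A : charted R T) n (v : tangent_vec A) (g : T -> 'rV[R]_n) j :
  smoothc A v.1 g -> dT g v 0 j = dT (fun q => g q 0 j) v.
Proof. by move=> /smooth_at_diff d; rewrite /dT /= derive_coord. Qed.

Section atlas.
Variables (T : Type) (A : charted R T).
Hypothesis okA : atlas_ok A.

Lemma nearc_chart (c : cidx A) p (Q : T -> Prop) : cdom c p -> nearc A p Q ->
  \forall z \near cmap c p, Q (cinv c z).
Proof.
move=> cp H; have dp := ao_at okA p; set d := chart_at A p in dp H.
have ct := smooth_at_cont (ao_trans okA cp dp).
have E : (cmap d \o cinv c) (cmap c p) = cmap d p by rewrite /= (ao_mapK okA cp).
have H1 : \forall z \near cmap c p, Q (cinv d (cmap d (cinv c z))).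
  by apply: (near_comp (f := cmap d \o cinv c) (P := fun z => Q (cinv d z))); rewrite ?E.
apply: filterS2 H1 (ao_near okA cp dp) => z + [_ _ dz].
by rewrite (ao_mapK okA dz).
Qed.

Lemma chart_nearc (c : cidx A) p (Q : T -> Prop) : cdom c p ->
  (\forall z \near cmap c p, Q (cinv c z)) -> nearc A p Q.
Proof.
move=> cp H; have dp := ao_at okA p; rewrite /nearc; set d := chart_at A p in dp *.
have ct := smooth_at_cont (ao_trans okA dp cp).
have E : (cmap c \o cinv d) (cmap d p) = cmap c p by rewrite /= (ao_mapK okA dp).
have H1 : \forall z \near cmap d p, Q (cinv c (cmap c (cinv d z))).
  by apply: (near_comp (f := cmap c \o cinv d) (P := fun z => Q (cinv c z))); rewrite ?E.
apply: filterS2 H1 (ao_near okA dp cp) => z + [_ _ dz].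
by rewrite (ao_mapK okA dz).
Qed.

Lemma nearc_cdom (c : cidx A) p : cdom c p -> nearc A p (cdom c).
Proof. by move=> cp; rewrite /nearc; apply: filterS (ao_near okA (ao_at okA p) cp) => z []. Qed.

Lemma dT_mul (p : T) v (g h : T -> R) : smoothc A p g -> smoothc A p h ->
  dT (fun q => g q * h q) ((p, v) : tangent_vec A) =
    g p * dT h ((p, v) : tangent_vec A) + h p * dT g ((p, v) : tangent_vec A).
Proof.
move=> /smooth_at_diff d1 /smooth_at_diff d2.
rewrite /dT /= [LHS](deriveM (diff_derivable d1) (diff_derivable d2)) /=.
by rewrite (ao_mapK okA)//; exact: ao_at.
Qed.

Lemma smoothc_chart_map (c : cidx A) p : cdom c p -> smoothc A p (cmap c).
Proof. by move=> cp; apply: (ao_trans okA) => //; exact: ao_at. Qed.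

Lemma smoothc_chart (c : cidx A) p (g : T -> R) : cdom c p ->
  smooth_at (cmap c p) (g \o cinv c) <-> smoothc A p g.
Proof.
move=> cp; have dp := ao_at okA p; rewrite /smoothc; set d := chart_at A p in dp *.
split=> H.
  apply: (@smooth_at_ext _ _ _ _ ((g \o cinv c) \o (cmap c \o cinv d))).
    apply: filterS (ao_near okA dp cp) => z [_ _ dz] /=.
    by rewrite (ao_mapK okA dz).
  apply: smooth_at_compR; first exact: (ao_trans okA dp cp).
  by rewrite /= (ao_mapK okA dp).
apply: (@smooth_at_ext _ _ _ _ ((g \o cinv d) \o (cmap d \o cinv c))).
  apply: filterS (ao_near okA cp dp) => z [_ _ dz] /=.
  by rewrite (ao_mapK okA dz).
apply: smooth_at_compR; first exact: (ao_trans okA cp dp).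
by rewrite /= (ao_mapK okA cp).
Qed.

(** Components of tangent vectors refer to the chart chosen at [p]; [dT (cmap c)] converts them to
    the chart [c], in which the derivative is then taken. *)
Lemma dT_chart (W : normedModType R) (c : cidx A) p v (g : T -> W) : cdom c p ->
  differentiable (g \o cinv c) (cmap c p) ->
  dT g ((p, v) : tangent_vec A) =
    'D_(dT (cmap c) ((p, v) : tangent_vec A)) (g \o cinv c) (cmap c p).
Proof.
move=> cp dg; have dp := ao_at okA p; rewrite /dT /=; set d := chart_at A p in dp *.
have E : (cmap c \o cinv d) (cmap d p) = cmap c p by rewrite /= (ao_mapK okA dp).
have d1 := smooth_at_diff (ao_trans okA dp cp).
have d2 : differentiable (g \o cinv c) ((cmap c \o cinv d) (cmap d p)) by rewrite E.
rewrite -[in RHS]E -(derive_comp _ d1 d2).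
apply: near_eq_derive; apply: filterS (ao_near okA dp cp) => z [_ _ dz] /=.
by rewrite (ao_mapK okA dz).
Qed.

Lemma dT_self p (w : 'rV[R]_(cdim A)) : dT (cmap (chart_at A p)) ((p, w) : tangent_vec A) = w.
Proof.
have dp := ao_at okA p; rewrite /dT /= -[RHS](derive_id (cmap (chart_at A p) p)).
by apply: near_eq_derive; apply: filterS (ao_near okA dp dp) => z [].
Qed.

End atlas.

(** The second clause plays the part of continuity: nearby points must land in the chart used at
    [h p]. *)
Definition smoothc_map (T S : Type) (A : charted R T) (B : charted R S) (p : T) (h : T -> S) : Prop :=
  smoothc A p (cmap (chart_at B (h p)) \o h) /\ nearc A p (fun q => cdom (chart_at B (h p)) (h q)).

(** The hypotheses on charts are weaker than [atlas_ok] so that the source can be the pullback of a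
    dual bundle, for which only these properties are established. *)
Lemma dT_comp (T S : Type) (A : charted R T) (B : charted R S) (W : normedModType R)
    p v (h : T -> S) (g : S -> W) :
  (forall (c : cidx A) p, cdom c p -> cinv c (cmap c p) = p) ->
  cdom (chart_at A p) p ->
  (forall (c : cidx B) p, cdom c p -> cinv c (cmap c p) = p) ->
  smoothc_map A B p h -> smoothc B (h p) g ->
  dT (g \o h) ((p, v) : tangent_vec A) = dT g (Tmap B h ((p, v) : tangent_vec A)).
Proof.
rewrite /smoothc_map /nearc => AK Ap BK [s1 n1] /smooth_at_diff dg; rewrite {2}/dT /=.
set c := chart_at B (h p) in s1 n1 dg *.
pose f := (cmap c \o h) \o cinv (chart_at A p).
have E : f (cmap (chart_at A p) p) = cmap c (h p) by rewrite /f /= AK.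
have d1 := smooth_at_diff s1.
have d2 : differentiable (g \o cinv c) (f (cmap (chart_at A p) p)) by rewrite E.
rewrite -[in RHS]E -(derive_comp _ d1 d2).
by apply: near_eq_derive; apply: filterS n1 => z cz; rewrite /f /= BK.
Qed.

Lemma smoothc_comp (T S : Type) (A : charted R T) (B : charted R S) p (h : T -> S) (g : S -> R) :
  (forall (c : cidx A) p, cdom c p -> cinv c (cmap c p) = p) ->
  cdom (chart_at A p) p ->
  (forall (c : cidx B) p, cdom c p -> cinv c (cmap c p) = p) ->
  smoothc_map A B p h -> smoothc B (h p) g -> smoothc A p (g \o h).
Proof.
rewrite /smoothc_map /nearc => AK Ap BK [s1 n1] sg; set c := chart_at B (h p) in s1 n1 sg *.
apply: (@smooth_at_ext _ _ _ _ ((g \o cinv c) \o ((cmap c \o h) \o cinv (chart_at A p)))).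
  by apply: filterS n1 => z cz /=; rewrite BK.
by apply: smooth_at_compR => //=; rewrite AK.
Qed.

End charted_calculus.

(** * Manifolds and total spaces of vector bundles *)

Section manifolds.
Variable R : realType.

Lemma manifold_atlas (M : manifold R) : atlas_ok (atl M).
Proof.
have mM := mfdP M; split.
- exact: mfd_at.
- exact: mfd_mapK.
- move=> c d p cp dp.
  have oI : open (cmap c @` cdom c) by exact: (mfd_im_open mM).
  have n1 : \forall z \near cmap c p, (cmap c @` cdom c) z.
    by apply: open_nbhs_nbhs; split => //; exists p.
  have n2 : \forall z \near cmap c p, cdom d (cinv c z).
    apply: (near_comp (mfd_inv_cont mM cp)); rewrite (mfd_mapK mM cp).
    by apply: open_nbhs_nbhs; split => //; exact: (mfd_dom_open mM).
  by apply: filterS2 n1 n2 => _ [q cq <-]; rewrite (mfd_mapK mM cq).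
- move=> c d p cp dp.
  have oU : open (cmap c @` (cdom c `&` cdom d)).
    rewrite openE => _ [q [cq dq] <-]; rewrite /interior.
    have n1 : \forall z \near cmap c q, (cmap c @` cdom c) z.
      by apply: open_nbhs_nbhs; split; [exact: (mfd_im_open mM)|exists q].
    have n2 : \forall z \near cmap c q, cdom d (cinv c z).
      apply: (near_comp (mfd_inv_cont mM cq)); rewrite (mfd_mapK mM cq).
      by apply: open_nbhs_nbhs; split => //; exact: (mfd_dom_open mM).
    apply: filterS2 n1 n2 => _ [q' cq' <-]; rewrite (mfd_mapK mM cq') => dq'.
    by exists q'.
  exists (cmap c @` (cdom c `&` cdom d)); first by split => //; exists p.
  exact: mfd_transition.
Qed.

(** On a manifold the two notions of nearness agree because charts are continuous both ways. *)
Lemma nearcM (M : manifold R) (p : M) (Q : M -> Prop) :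
  (\forall q \near p, Q q) <-> nearc (atl M) p Q.
Proof.
have mM := mfdP M; have cp := mfd_at mM p; rewrite /nearc; split => H.
  by apply: (near_comp (mfd_inv_cont mM cp)); rewrite (mfd_mapK mM cp).
have n1 := near_comp (mfd_map_cont mM cp) H.
have n2 : \forall q \near p, cdom (chart_at (atl M) p) q.
  by apply: open_nbhs_nbhs; split => //; exact: (mfd_dom_open mM).
by apply: filterS2 n1 n2 => q + cq; rewrite (mfd_mapK mM cq).
Qed.

Lemma open_chart_image (M : manifold R) (c : cidx (atl M)) (W : set M) : open W ->
  open (cmap c @` (cdom c `&` W)).
Proof.
move=> oW; have mM := mfdP M.
rewrite openE => _ [q [cq Wq] <-]; rewrite /interior.
have n1 : \forall z \near cmap c q, (cmap c @` cdom c) z.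
  by apply: open_nbhs_nbhs; split; [exact: (mfd_im_open mM)|exists q].
have n2 : \forall z \near cmap c q, W (cinv c z).
  apply: (near_comp (mfd_inv_cont mM cq)); rewrite (mfd_mapK mM cq).
  by apply: open_nbhs_nbhs; split.
apply: filterS2 n1 n2 => _ [q' cq' <-]; rewrite (mfd_mapK mM cq') => Wq'.
by exists q'.
Qed.

Lemma smooth_funP (M : manifold R) (W : set M) (g : M -> R) : open W ->
  smooth_fun (atl M) W g <-> forall p, W p -> smoothc (atl M) p g.
Proof.
move=> oW; split=> [sg p Wp|H c].
  have cp := mfd_at (mfdP M) p; set c := chart_at (atl M) p in cp.
  have H := (smooth_onP (g \o cinv c) (@open_chart_image M c W oW)).1 (sg c) (cmap c p).
  by apply: H; exists p.
apply/smooth_onP; first exact: open_chart_image.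
move=> _ [p [cp Wp] <-]; apply/(smoothc_chart (manifold_atlas M)) => //.
exact: H.
Qed.

Lemma smooth_fun_coordP (M : manifold R) (W : set M) n (g : M -> 'rV[R]_n) : open W ->
  smooth_fun (atl M) W g <-> forall p j, W p -> smoothc (atl M) p (fun x => g x 0 j).
Proof.
move=> oW; split=> [sg p j Wp|H c].
  apply: (smooth_funP (fun x => g x 0 j) oW).1 Wp => c.
  apply/smooth_onP; first exact: open_chart_image.
  move=> z Uz; apply: smooth_at_coord.
  exact: ((smooth_onP (g \o cinv c) (@open_chart_image M c W oW)).1 (sg c) z Uz).
apply/smooth_onP; first exact: open_chart_image.
move=> z Uz; apply: smooth_at_row => j.
have sj : smooth_fun (atl M) W (fun x => g x 0 j).
  by apply/smooth_funP => // p Wp; exact: H.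
exact: ((smooth_onP _ (@open_chart_image M c W oW)).1 (sj c) z Uz).
Qed.

Lemma smooth_sectP (M : manifold R) (E : vbundle M) (X : sect E) :
  smooth_sect X <->
  forall (k : fidx E) p a, fdom k p -> smoothc (atl M) p (fun x => fcoord k (X x) 0 a).
Proof.
have ok (k : fidx E) : open (fdom k) := @vb_dom_open _ _ _ (vbP E) k.
split=> [sX k p a|H k]; first exact: ((smooth_fun_coordP _ (ok k)).1 (sX k)).
by apply/smooth_fun_coordP => // p j; exact: H.
Qed.

(** * Coordinates in a frame *)

Section framed_coord.
Variables (T : Type) (E : framed R T) (k : fidx E) (x : T).
Hypothesis bE : basis_of fullv (vb_frame k x).

Lemma sum_fcoord (v : E x) : \sum_a fcoord k v 0 a *: frm k a x = v.
Proof.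
rewrite [RHS](coord_basis bE (memvf v)); apply: eq_bigr => a _.
by rewrite mxE (nth_map a) ?size_enum_ord// nth_ord_enum.
Qed.

Lemma fcoord_frm a : fcoord k (frm k a x) = delta_mx 0 a.
Proof.
apply/rowP => b; rewrite !mxE eqxx /=.
have E1 : frm k a x = (vb_frame k x)`_a.
  by rewrite (nth_map a) ?size_enum_ord// nth_ord_enum.
by rewrite E1 coord_free ?(basis_free bE)// eq_sym.
Qed.

Lemma fcoord_linear (a : R) (u v : E x) : fcoord k (a *: u + v) = a *: fcoord k u + fcoord k v.
Proof. by apply/rowP => b; rewrite !mxE linearP. Qed.

Lemma fcoord_sum (I : Type) (r : seq I) (P : pred I) (F : I -> E x) :
  fcoord k (\sum_(i <- r | P i) F i) = \sum_(i <- r | P i) fcoord k (F i).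
Proof.
apply/rowP => b; rewrite summxE mxE linear_sum; apply: eq_bigr => i _.
by rewrite mxE.
Qed.

Lemma fcoordZ (a : R) (u : E x) : fcoord k (a *: u) = a *: fcoord k u.
Proof. by apply/rowP => b; rewrite !mxE linearZ. Qed.

Lemma fcoordK (y : 'rV[R]_(vb_rank E)) : fcoord k (\sum_a y 0 a *: frm k a x) = y.
Proof.
rewrite fcoord_sum [RHS]row_sum_delta; apply: eq_bigr => a _.
by rewrite fcoordZ fcoord_frm.
Qed.

End framed_coord.

Lemma lsubmx_smooth n m (z : 'rV[R]_(n + m)) : smooth_at z (fun y : 'rV[R]_(n + m) => lsubmx y).
Proof.
apply: smooth_at_row => j; under eq_fun do rewrite mxE.
exact/smooth_at_coord/smooth_at_id.
Qed.

Lemma rsubmx_smooth n m (z : 'rV[R]_(n + m)) : smooth_at z (fun y : 'rV[R]_(n + m) => rsubmx y).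
Proof.
apply: smooth_at_row => j; under eq_fun do rewrite mxE.
exact/smooth_at_coord/smooth_at_id.
Qed.

Lemma smooth_at_row_mx (V : normedModType R) n m (x : V) (f : V -> 'rV[R]_n) (g : V -> 'rV[R]_m) :
  smooth_at x f -> smooth_at x g -> smooth_at x (fun y => row_mx (f y) (g y)).
Proof.
move=> sf sg; apply: smooth_at_row => j; case: (split_ordP j) => i ->.
  by under eq_fun do rewrite row_mxEl; exact: smooth_at_coord.
by under eq_fun do rewrite row_mxEr; exact: smooth_at_coord.
Qed.

(** Fibre coordinates change linearly, with coefficients that are smooth on the base by
    [vb_transition]; nearness conditions only concern the base point. *)
Lemma total_atlas (M : manifold R) (E : framed R M) : is_vbundle E ->
  atlas_ok (total_sp (atl M) E).
Proof.
move=> vE; have okM := manifold_atlas M; split.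
- by move=> [x v]; split; [exact: (ao_at okM)|exact: (vb_at vE)].
- move=> [c k] [x v] [/= cx kx]; rewrite row_mxKl row_mxKr (ao_mapK okM cx).
  by congr (existT _ _ _); exact: sum_fcoord (vb_basis vE kx) v.
- move=> [c k] [d l] [x v] [/= cx kx] [/= dx lx]; set z0 := row_mx _ _.
  have E0 : lsubmx z0 = cmap c x by rewrite row_mxKl.
  have cl : {for z0, continuous (fun z : 'rV[R]_(cdim (atl M) + vb_rank E) => lsubmx z)}.
    exact/smooth_at_cont/lsubmx_smooth.
  have n1 : \forall z \near z0, [/\ cdom c (cinv c (lsubmx z)),
      cmap c (cinv c (lsubmx z)) = lsubmx z & cdom d (cinv c (lsubmx z))].
    by apply: (near_comp (P := fun y => [/\ cdom c (cinv c y), cmap c (cinv c y) = y & cdom d (cinv c y)]) cl); rewrite E0; exact: (ao_near okM).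
  have nkl : \forall y \near cmap c x, fdom k (cinv c y) /\ fdom l (cinv c y).
    apply: (nearc_chart okM (Q := fun q => fdom k q /\ fdom l q) cx).
    apply/nearcM; apply: open_nbhs_nbhs; split => //.
    by apply: openI; exact: (vb_dom_open vE).
  have n2 : \forall z \near z0, fdom k (cinv c (lsubmx z)) /\ fdom l (cinv c (lsubmx z)).
    by apply: (near_comp (P := fun y => fdom k (cinv c y) /\ fdom l (cinv c y)) cl); rewrite E0.
  apply: filterS2 n1 n2 => z [cz zz dz] [kz lz]; split => //=.
  by rewrite zz fcoordK ?hsubmxK//; exact: (vb_basis vE).
- move=> [c k] [d l] [x v] [/= cx kx] [/= dx lx]; set z0 := row_mx _ _.
  have E0 : lsubmx z0 = cmap c x by rewrite row_mxKl.
  apply: smooth_at_row_mx.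
    apply: (@smooth_at_comp _ _ _ _ _ (fun z => lsubmx z) (cmap d \o cinv c)).
      exact: lsubmx_smooth.
    by rewrite E0; exact: (ao_trans okM).
  apply: smooth_at_row => b.
  apply: (@smooth_at_ext _ _ _ _ (fun z => \sum_a rsubmx z 0 a *
      ((fun x => fcoord l (frm k a x) 0 b) \o cinv c \o (fun z => lsubmx z)) z)).
    apply: (@nearW _ (nbhs z0) _ (nbhs_filter z0)) => z /=.
    by rewrite fcoord_sum summxE; apply: eq_bigr => a _; rewrite fcoordZ [RHS]mxE.
  apply: smooth_at_sum => a _; apply: smooth_at_mul.
    exact/smooth_at_coord/rsubmx_smooth.
  apply: smooth_at_compR; first exact: lsubmx_smooth.
  rewrite E0; apply/(smoothc_chart okM) => //.
  have okl : open (fdom k `&` fdom l) by apply: openI; exact: (vb_dom_open vE).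
  exact: ((smooth_fun_coordP _ okl).1 (vb_transition vE k l a)).
Qed.

(** Transfers neighbourhoods of the base to germs on the total space. *)
Lemma nearc_base (M : manifold R) (F : framed R M) (q : {x : M & F x}) (Q : M -> Prop) :
  (\forall m \near projT1 q, Q m) -> nearc (total_sp (atl M) F) q (fun q' => Q (projT1 q')).
Proof.
move=> /nearcM; rewrite /nearc /= => H.
have E0 : lsubmx (cmap (chart_at (total_sp (atl M) F) q) q) =
    cmap (chart_at (atl M) (projT1 q)) (projT1 q) by rewrite row_mxKl.
apply: (near_comp (f := fun z : 'rV[R]_(cdim (atl M) + vb_rank F) => lsubmx z)
  (P := fun y => Q (cinv (chart_at (atl M) (projT1 q)) y))).
  exact/smooth_at_cont/lsubmx_smooth.
by rewrite E0.
Qed.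

Lemma total_cinvK (M : manifold R) (E : framed R M) (c : cidx (atl M)) (k : fidx E)
    (z : 'rV[R]_(cdim (atl M) + vb_rank E)) : is_vbundle E ->
  cmap c (cinv c (lsubmx z)) = lsubmx z -> fdom k (cinv c (lsubmx z)) ->
  cmap ((c, k) : cidx (total_sp (atl M) E)) (cinv ((c, k) : cidx (total_sp (atl M) E)) z) = z.
Proof.
move=> vE zz kz /=; rewrite zz fcoordK ?hsubmxK//; exact: (vb_basis vE).
Qed.

End manifolds.

(** * Dual bundles *)

Section bundles.
Variable R : realType.

Section dual_frames.
Variables (T : Type) (E : framed R T) (k : fidx E) (x : T).
Hypothesis bE : basis_of fullv (vb_frame k x).

Lemma dual_frmE a (v : E x) : frm (k : fidx (dualb E)) a x v = fcoord k v 0 a.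
Proof. by rewrite /= lfunE mxE. Qed.

Lemma vb_frame_nth (F : framed R T) (l : fidx F) (a : 'I_(vb_rank F)) :
  (vb_frame l x)`_a = frm l a x.
Proof. by rewrite (nth_map a) ?size_enum_ord// nth_ord_enum. Qed.

Lemma dual_sum (xi : dualb E x) :
  \sum_a xi (frm k a x) *: frm (k : fidx (dualb E)) a x = xi.
Proof.
apply/lfunP => v; rewrite sum_lfunE -[in RHS](sum_fcoord bE v) linear_sum.
by apply: eq_bigr => a _; rewrite linearZ /= scale_lfunE lfunE mxE /GRing.scale /= mulrC.
Qed.

Lemma dual_basis : basis_of fullv (vb_frame (k : fidx (dualb E)) x).
Proof.
apply/andP; split.
  apply/eqP/vspaceP => xi; rewrite memvf -(dual_sum xi).
  apply: memv_suml => a _; apply: memvZ; rewrite -vb_frame_nth.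
  by apply: memv_span; apply: mem_nth; rewrite size_tuple.
apply/freeP => c H a.
have {}H : \sum_b c b *: frm (k : fidx (dualb E)) b x = 0.
  by rewrite -[RHS]H; apply: eq_bigr => b _; rewrite vb_frame_nth.
have := congr1 (fun xi : dualb E x => xi (frm k a x)) H.
rewrite zero_lfunE sum_lfunE (bigD1 a) // big1.
  rewrite scale_lfunE dual_frmE fcoord_frm // mxE !eqxx /= addr0.
  by rewrite /GRing.scale /= mulr1.
move=> b ba; rewrite scale_lfunE dual_frmE fcoord_frm // mxE.
by rewrite (negPf ba) andbF scaler0.
Qed.

Lemma fcoord_dual (xi : dualb E x) a : fcoord (k : fidx (dualb E)) xi 0 a = xi (frm k a x).
Proof.
have := @fcoordK _ _ (dualb E) k x dual_basis (\row_a xi (frm k a x)).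
under eq_bigr do rewrite mxE.
by rewrite dual_sum => ->; rewrite mxE.
Qed.

End dual_frames.

(** The dual transition from [k] to [l] is the transpose of the transition from [l] to [k], so its
    smoothness is that of another transition of [E], with no matrix inversion. *)
Lemma dual_vbundle (M : manifold R) (E : framed R M) : is_vbundle E -> is_vbundle (dualb E).
Proof.
move=> vE; split.
- exact: (vb_at vE).
- exact: (vb_dom_open vE).
- by move=> k x kx; apply: dual_basis; exact: (vb_basis vE).
- move=> k l b; have okl : open (fdom (k : fidx E) `&` fdom (l : fidx E)).
    by apply: openI; exact: (vb_dom_open vE).
  apply/smooth_fun_coordP => // p a [kp lp].
  apply: (smoothc_ext (g := fun x => fcoord (k : fidx E) (frm (l : fidx E) a x) 0 b)).
    have : \forall q \near p, fdom (k : fidx E) q /\ fdom (l : fidx E) q.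
      exact: open_nbhs_nbhs.
    move=> /nearcM; apply: nearcS => q [kq lq].
    by rewrite fcoord_dual ?dual_frmE//; exact: (vb_basis vE).
  have olk : open (fdom (l : fidx E) `&` fdom (k : fidx E)).
    by apply: openI; exact: (vb_dom_open vE).
  exact: ((smooth_fun_coordP _ olk).1 (vb_transition vE l k a)).
Qed.

(** A bump in coordinates, extended by zero outside the chart. The extension is smooth because its
    support lies in the image of a closed ball, which is compact and hence closed, [M] being
    Hausdorff; this image is contained in [U]. *)
Lemma mfd_bump (M : manifold R) (p : M) (U : set M) : open U -> U p ->
  exists b : M -> R, [/\ forall q, smoothc (atl M) q b, \forall q \near p, b q = 1 &
    forall q, ~ U q -> \forall q' \near q, b q' = 0].
Proof.
move=> oU Up; have mM := mfdP M; have okM := manifold_atlas M.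
set c := chart_at (atl M) p; have cp : cdom c p by exact: mfd_at.
pose x0 := cmap c p.
have n1 : \forall z \near x0, [/\ cdom c (cinv c z), cmap c (cinv c z) = z & cdom c (cinv c z)].
  exact: (ao_near okM).
have n2 : \forall z \near x0, U (cinv c z).
  by apply/(nearcM p U); apply: open_nbhs_nbhs.
have n3 : \forall z \near x0, [/\ cdom c (cinv c z), cmap c (cinv c z) = z & U (cinv c z)].
  by apply: filterS2 n1 n2 => z [].
have [r r0 Hr] := (near_ballP _ _).1 n3.
have r20 : 0 < r / 2 by rewrite divr_gt0.
have [beta [sb b1 b0]] := bump_exists x0 r20.
rewrite divfK ?pnatr_eq0// in b0.
pose b q := if pselect (cdom c q) then beta (cmap c q) else 0.
pose B := [set z : 'rV[R]_(cdim (atl M)) | `|z - x0| <= r].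
have cB : compact B.
  apply: bounded_closed_compact.
    exists (r + `|x0|); split; first exact: num_real.
    move=> s sr z /= zr; apply: le_trans (ltW sr).
    have : `|z| <= `|z - x0| + `|x0| by rewrite -{1}[z](subrK x0) ler_normD.
    by move/le_trans; apply; rewrite lerD2r.
  have cd : continuous (fun x : 'rV[R]_(cdim (atl M)) => `|x - x0|).
    move=> x; have cb : {for x, continuous (fun x : 'rV[R]_(cdim (atl M)) => x - x0)}.
      by apply: continuousB; [exact: cvg_id|exact: cst_continuous].
    exact: (continuous_comp cb (@norm_continuous _ _ _)).
  apply: (@closed_comp _ _ _ [set x : R | x <= r]); last exact: closed_le.
  by move=> x _; exact: cd.
have cc : {within B, continuous (cinv c)}.
  apply: continuous_in_subspaceT => z.
  rewrite inE => Bz; have [cz E _] := Hr z Bz.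
  by have := mfd_inv_cont mM cz; rewrite E.
have cK : closed (cinv c @` B) := compact_closed (mfd_hausdorff mM) (continuous_compact cc cB).
have out q : ~ (cinv c @` B) q -> \forall q' \near q, b q' = 0.
  move=> nq; have : \forall q' \near q, (~` (cinv c @` B)) q'.
    by apply: open_nbhs_nbhs; split => //; exact: closed_openC.
  apply: filterS => q' nq'; rewrite /b; case: pselect => //= cq'.
  apply: b0; apply: ltW; rewrite ltNge; apply/negP => h; apply: nq'.
  by exists (cmap c q') => //; rewrite (mfd_mapK mM cq').
exists b; split.
- move=> q; have [[z Bz <-]|nq] := pselect ((cinv c @` B) q); last first.
    apply: (smoothc_ext (g := fun=> 0)); last exact: smoothc_cst.
    by apply/nearcM; apply: filterS (out q nq) => q' ->.
  have [cz E _] := Hr z Bz; apply: (smoothc_ext (g := beta \o cmap c)).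
    apply: nearcS (nearc_cdom okM cz) => q' cq'.
    by rewrite /b; case: pselect.
  apply: (smoothc_chart okM (beta \o cmap c) cz).1; apply: smooth_at_ext (sb (cmap c (cinv c z))).
  by apply: filterS (ao_near okM cz cz) => y [_ yy _] /=; rewrite yy.
- apply/nearcM; apply/(chart_nearc okM cp).
  have : \forall z \near x0, `|z - x0| <= r / 2.
    by apply/near_ballP; exists (r / 2).
  move=> H; apply: filterS2 n1 H => z [cz E _] zr.
  by rewrite /b; case: pselect => //= _; rewrite E b1.
- move=> q nU; apply: out => -[z Bz E]; apply: nU; rewrite -E.
  by have [] := Hr z Bz.
Qed.

End bundles.

(** * Extension of functions and sections *)

Section extension.
Variable R : realType.

(** At [q] smoothness is read in the chart chosen at [q], so a change of chart is involved. *)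
Lemma smoothc_near (M : manifold R) (p : M) (h : M -> R) : smoothc (atl M) p h ->
  \forall q \near p, smoothc (atl M) q h.
Proof.
have okM := manifold_atlas M; move=> sh; have cp := ao_at okM p.
apply/nearcM; rewrite /nearc.
apply: filterS2 (smooth_at_near sh) (ao_near okM cp cp) => z sz [cz zz _].
by apply: (smoothc_chart okM h cz).1; rewrite zz.
Qed.

Lemma open_of_near (T : topologicalType) (p : T) (Q : T -> Prop) :
  (\forall q \near p, Q q) -> exists U : set T, [/\ open U, U p & forall q, U q -> Q q].
Proof.
move=> H; exists (Q : set T)^°; split; first exact: open_interior.
  exact: H.
by move=> q /interior_subset.
Qed.

Lemma extend_fun (M : manifold R) (p : M) (h : M -> R) : smoothc (atl M) p h ->
  exists g : M -> R, (forall q, smoothc (atl M) q g) /\ \forall q \near p, g q = h q.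
Proof.
move=> /smoothc_near /open_of_near [U [oU Up HU]].
have [b [sb b1 b0]] := mfd_bump oU Up.
exists (fun q => b q * h q); split; last by apply: filterS b1 => q ->; rewrite mul1r.
move=> q; have [Uq|nU] := pselect (U q); first by apply: smoothc_mul => //; exact: HU.
apply: (smoothc_ext (g := fun=> 0)); last exact: smoothc_cst.
by apply/nearcM; apply: filterS (b0 q nU) => q' ->; rewrite mul0r.
Qed.

Definition smooth_sect_at (M : manifold R) (E : vbundle M) (p : M) (X : sect E) : Prop :=
  forall (k : fidx E) a, fdom k p -> smoothc (atl M) p (fun x => fcoord k (X x) 0 a).

Lemma smooth_sect_atP (M : manifold R) (E : vbundle M) (X : sect E) :
  smooth_sect X <-> forall p, smooth_sect_at p X.
Proof.
split=> [/smooth_sectP H p k a kp|H]; first exact: H.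
by apply/smooth_sectP => k p a kp; exact: H.
Qed.

Lemma fdom_near (M : manifold R) (E : vbundle M) (k : fidx E) p : fdom k p ->
  \forall q \near p, fdom k q.
Proof. by move=> kp; apply: open_nbhs_nbhs; split => //; exact: (vb_dom_open (vbP E)). Qed.

Lemma frm_smooth_coord (M : manifold R) (E : vbundle M) (k l : fidx E) p a b :
  fdom k p -> fdom l p -> smoothc (atl M) p (fun x => fcoord l (frm k a x) 0 b).
Proof.
move=> kp lp; have okl : open (fdom k `&` fdom l).
  by apply: openI; exact: (vb_dom_open (vbP E)).
exact: ((smooth_fun_coordP _ okl).1 (vb_transition (vbP E) k l a)).
Qed.

Lemma smooth_sect_at_frame (M : manifold R) (E : vbundle M) (p : M) (X : sect E) (k : fidx E) :
  fdom k p -> (forall a, smoothc (atl M) p (fun x => fcoord k (X x) 0 a)) -> smooth_sect_at p X.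
Proof.
move=> kp H l b lp.
apply: (smoothc_ext (g := fun x => \sum_a fcoord k (X x) 0 a * fcoord l (frm k a x) 0 b)).
  apply/nearcM; apply: filterS (fdom_near kp) => q kq.
  rewrite -[in RHS](sum_fcoord (vb_basis (vbP E) kq) (X q)) fcoord_sum summxE.
  by apply: eq_bigr => a _; rewrite fcoordZ [RHS]mxE.
by apply: smoothc_sum => a; apply: smoothc_mul; [exact: H|exact: frm_smooth_coord].
Qed.

Lemma frm_smooth_sect_at (M : manifold R) (E : vbundle M) (k : fidx E) p a :
  fdom k p -> @smooth_sect_at M E p (frm k a).
Proof. by move=> kp l b lp; exact: frm_smooth_coord. Qed.

Lemma smooth_sect_at_ext (M : manifold R) (E : vbundle M) (p : M) (X Y : sect E) :
  (\forall q \near p, X q = Y q) -> smooth_sect_at p X -> smooth_sect_at p Y.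
Proof.
move=> XY H k a kp; apply: smoothc_ext (H k a kp).
by apply/nearcM; apply: filterS XY => q ->.
Qed.

Lemma smooth_sect_at_scale (M : manifold R) (E : vbundle M) (p : M) (f : M -> R) (X : sect E) :
  smoothc (atl M) p f -> smooth_sect_at p X -> smooth_sect_at p (fun q => f q *: X q).
Proof.
move=> sf H k a kp; apply: (smoothc_ext (g := fun x => f x * fcoord k (X x) 0 a)).
  by apply: nearcW => q; rewrite fcoordZ [RHS]mxE.
by apply: smoothc_mul => //; exact: H.
Qed.

Lemma smooth_sect_at_sum (M : manifold R) (E : vbundle M) (p : M) (I : Type) (r : seq I)
    (X : I -> sect E) :
  (forall i, smooth_sect_at p (X i)) -> smooth_sect_at p (fun q => \sum_(i <- r) X i q).
Proof.
move=> H k a kp; apply: (smoothc_ext (g := fun x => \sum_(i <- r) fcoord k (X i x) 0 a)).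
  by apply: nearcW => q; rewrite fcoord_sum summxE.
by apply: smoothc_sum => i; exact: H.
Qed.

Lemma smooth_sect_at_zero (M : manifold R) (E : vbundle M) (p : M) :
  @smooth_sect_at M E p (fun=> 0).
Proof.
move=> k a kp; apply: (smoothc_ext (g := fun=> 0)); last exact: smoothc_cst.
by apply: nearcW => q; rewrite mxE linear0.
Qed.

Lemma smooth_sect_at_near (M : manifold R) (E : vbundle M) (p : M) (X : sect E) :
  smooth_sect_at p X -> \forall q \near p, smooth_sect_at q X.
Proof.
move=> H; have kp := vb_at (vbP E) p; set k := frame_at E p in kp.
have n1 a : \forall q \near p, smoothc (atl M) q (fun x => fcoord k (X x) 0 a).
  by apply: smoothc_near; exact: H.
have n2 := @filter_forall _ _ _ (nbhs p) (nbhs_filter p) n1.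
by apply: filterS2 (fdom_near kp) n2 => q kq Hq; exact: smooth_sect_at_frame kq Hq.
Qed.

Lemma extend_sect (M : manifold R) (E : vbundle M) (p : M) (X : sect E) :
  smooth_sect_at p X -> exists2 X' : sect E, smooth_sect X' & \forall q \near p, X' q = X q.
Proof.
move=> /smooth_sect_at_near /open_of_near [U [oU Up HU]].
have [b [sb b1 b0]] := mfd_bump oU Up.
exists (fun q => b q *: X q); last by apply: filterS b1 => q ->; rewrite scale1r.
apply/smooth_sect_atP => q; have [Uq|nU] := pselect (U q).
  by apply: smooth_sect_at_scale => //; exact: HU.
apply: (smooth_sect_at_ext (X := fun=> 0)); last exact: smooth_sect_at_zero.
by apply: filterS (b0 q nU) => q' ->; rewrite scale0r.
Qed.

(** * Extension along an immersion *)

Section immersion.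
Variables (N M : manifold R) (j : N -> M) (n : N).
Hypothesis sj : smooth_map j.

Lemma smooth_map_chart : smoothc (atl N) n (cmap (chart_at (atl M) (j n)) \o j).
Proof.
have [cj sj2] := sj; set d := chart_at (atl M) (j n).
have dj : cdom d (j n) := ao_at (manifold_atlas M) (j n).
have oW : open (j @^-1` cdom d).
  by move/continuousP: cj; apply; exact: (mfd_dom_open (mfdP M)).
apply: smoothc_row => b.
exact: ((smooth_fun_coordP _ oW).1 (sj2 d) n b dj).
Qed.

Lemma smooth_map_smoothc_map : smoothc_map (atl N) (atl M) n j.
Proof.
split; first exact: smooth_map_chart.
apply/nearcM; have [cj _] := sj; apply: (near_comp (f := j)); first exact: cj.
by apply: open_nbhs_nbhs; split; [exact: (mfd_dom_open (mfdP M))|exact: (ao_at (manifold_atlas M))].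
Qed.

Lemma near_pullback (Q : M -> Prop) : (\forall x \near j n, Q x) -> \forall m \near n, Q (j m).
Proof. by have [cj _] := sj; apply: near_comp; exact: cj. Qed.

Lemma smoothc_pullback (g : M -> R) : smoothc (atl M) (j n) g -> smoothc (atl N) n (g \o j).
Proof.
have okM := manifold_atlas M; have okN := manifold_atlas N.
apply: smoothc_comp smooth_map_smoothc_map; [exact: (ao_mapK okN)|exact: (ao_at okN)|exact: (ao_mapK okM)].
Qed.

Lemma dT_pullback (g : M -> R) v : smoothc (atl M) (j n) g ->
  dT (g \o j) ((n, v) : tangent_vec (atl N)) = dT g (Tmap (atl M) j ((n, v) : tangent_vec (atl N))).
Proof.
have okM := manifold_atlas M; have okN := manifold_atlas N.
apply: dT_comp smooth_map_smoothc_map; [exact: (ao_mapK okN)|exact: (ao_at okN)|exact: (ao_mapK okM)].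
Qed.

Hypothesis ij : injective (fun v => Tmap (atl M) j ((n, v) : tangent_vec (atl N))).

(* With [Pi] a right inverse of the Jacobian of [j] at [n], the inverse function
   theorem applied to [Pi \o j] gives a smooth local left inverse of [j]. *)
Lemma extend_fun_along (h : N -> R) : smoothc (atl N) n h ->
  exists g : M -> R, (forall q, smoothc (atl M) q g) /\ \forall m \near n, g (j m) = h m.
Proof.
move=> sh; have okM := manifold_atlas M; have okN := manifold_atlas N.
set d := chart_at (atl M) (j n); set c := chart_at (atl N) n.
have dj : cdom d (j n) := ao_at okM (j n).
have cn : cdom c n := ao_at okN n.
pose x0 := cmap c n; pose phi := (cmap d \o j) \o cinv c.
have sphi : smooth_at x0 phi := smooth_map_chart.
have phi0 : phi x0 = cmap d (j n) by rewrite /phi /= (ao_mapK okN).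
pose J := partials phi x0.
have Jv v : 'D_v phi x0 = v *m J by rewrite derive_partials//; exact: smooth_at_diff.
have /row_freeP [Pi JPi] : row_free J.
  apply: inj_row_free => v vJ.
  by apply: ij; rewrite /Tmap /dT /= -/c -/d -/phi !Jv vJ mul0mx.
pose mu (y : 'rV[R]_(cdim (atl M))) := y *m Pi.
have smu y : smooth_at y mu.
  by apply: smooth_at_mulmx => [|a b]; [exact: smooth_at_id|exact: smooth_at_cst].
have dmu y w : 'D_w mu y = w *m Pi.
  have cmu : continuous (mulmxr Pi : {linear 'rV[R]_(cdim (atl M)) -> 'rV[R]_(cdim (atl N))}).
    exact: mulmxr_continuous.
  have dm : differentiable (mulmxr Pi : 'rV[R]_(cdim (atl M)) -> 'rV[R]_(cdim (atl N))) y.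
    exact: linear_differentiable.
  by rewrite (deriveE (f := mulmxr Pi) _ dm) (diff_lin _ cmu).
have sPhi : smooth_at x0 (mu \o phi) by apply: smooth_at_comp.
have dPhi v : 'D_v (mu \o phi) x0 = v.
  rewrite (derive_comp _ (smooth_at_diff sphi) (smooth_at_diff (smu _))) Jv dmu.
  by rewrite -mulmxA JPi mulmx1.
have [psi [spsi psi0 psiK]] := local_inverse sPhi dPhi.
pose g0 q := (h \o cinv c) (psi (mu (cmap d q))).
have sg0 : smoothc (atl M) (j n) g0.
  apply: (@smooth_at_ext _ _ _ _ ((h \o cinv c) \o (psi \o mu))).
    by apply: filterS (ao_near okM dj dj) => z [_ zz _]; rewrite /g0 /= zz.
  have E0 : (psi \o mu) (cmap d (j n)) = x0 by rewrite -phi0 -[RHS]psi0.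
  apply: smooth_at_compR; last by rewrite E0.
  apply: smooth_at_comp => //; rewrite -phi0; exact: spsi.
have [g [sg gg0]] := extend_fun sg0.
exists g; split => //.
have n1 : \forall m \near n, g0 (j m) = h m.
  apply/nearcM; rewrite /nearc.
  apply: filterS psiK => z Hz; rewrite /g0 /=; congr (h (cinv c _)).
  exact: Hz.
by apply: filterS2 n1 (near_pullback gg0) => m <-.
Qed.

Lemma extend_sect_along (E : vbundle M) (Y : forall m, E (j m)) (k : fidx E) : fdom k (j n) ->
  (forall a, smoothc (atl N) n (fun m => fcoord k (Y m) 0 a)) ->
  exists2 X' : sect E, smooth_sect X' & \forall m \near n, X' (j m) = Y m.
Proof.
move=> kj H; have [g Hg] := choice (fun a => extend_fun_along (H a)).
have [|X' sX' X'E] := @extend_sect M E (j n) (fun x => \sum_a g a x *: frm k a x).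
  apply: smooth_sect_at_sum => a; apply: smooth_sect_at_scale; first by have [] := Hg a.
  exact: frm_smooth_sect_at.
exists X' => //.
have n1 := @filter_forall _ _ _ (nbhs n) (nbhs_filter n) (fun a => (Hg a).2).
have n2 := near_pullback X'E; have n3 := near_pullback (fdom_near kj).
apply: filterS (filterI n1 (filterI n2 n3)) => m [h1 [h2 h3]].
rewrite h2 -[RHS](sum_fcoord (vb_basis (vbP E) h3)); apply: eq_bigr => a _.
by rewrite h1.
Qed.

End immersion.
End extension.

(** * Locality of the bracket *)

Section bracket.
Variables (R : realType) (M : manifold R) (E : vbundle M) (eps : algebroid E).

Lemma sect_ext (X Y : sect E) : (forall x, X x = Y x) -> X = Y.
Proof. exact: functional_extensionality_dep. Qed.

Lemma smooth_funT (f : M -> R) : (forall q, smoothc (atl M) q f) -> smooth_fun (atl M) setT f.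
Proof. by move=> H; apply/smooth_funP; [exact: openT|move=> p _; exact: H]. Qed.

Lemma smooth_sect0 : smooth_sect ((fun=> 0) : sect E).
Proof. by apply/smooth_sect_atP => p; exact: smooth_sect_at_zero. Qed.

Lemma smooth_sect_lin a (X Y : sect E) : smooth_sect X -> smooth_sect Y ->
  smooth_sect (fun z => a *: X z + Y z).
Proof.
move=> /smooth_sectP sX /smooth_sectP sY; apply/smooth_sectP => k p b kp.
apply: (smoothc_ext (g := fun x => a * fcoord k (X x) 0 b + fcoord k (Y x) 0 b)).
  by apply: nearcW => q; rewrite fcoord_linear !mxE.
by apply: smoothc_add; [apply: smoothc_mul; [exact: smoothc_cst|exact: sX]|exact: sY].
Qed.

Lemma smooth_sect_scale (f : M -> R) (X : sect E) : (forall q, smoothc (atl M) q f) ->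
  smooth_sect X -> smooth_sect (fun z => f z *: X z).
Proof.
move=> sf /smooth_sect_atP sX; apply/smooth_sect_atP => p.
exact: smooth_sect_at_scale.
Qed.

Lemma smooth_sect_sum (I : Type) (r : seq I) (X : I -> sect E) :
  (forall i, smooth_sect (X i)) -> smooth_sect (fun q => \sum_(i <- r) X i q).
Proof.
move=> H; apply/smooth_sect_atP => p; apply: smooth_sect_at_sum => i.
exact: (smooth_sect_atP (X i)).1.
Qed.

Lemma bracket0l (Y : sect E) (x : M) : smooth_sect Y -> abracket eps (fun=> 0) Y x = 0.
Proof.
move=> sY; have := bracket_linearl eps 1 smooth_sect0 smooth_sect0 sY x.
rewrite (@sect_ext (fun z => 1 *: 0 + 0) (fun=> 0)); last by move=> z; rewrite scaler0 addr0.
by rewrite scale1r => /(congr1 (fun v => v - abracket eps (fun=> 0) Y x)); rewrite addrK subrr.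
Qed.

Lemma bracket0r (Y : sect E) (x : M) : smooth_sect Y -> abracket eps Y (fun=> 0) x = 0.
Proof.
move=> sY; have := bracket_linearr eps 1 smooth_sect0 smooth_sect0 sY x.
rewrite (@sect_ext (fun z => 1 *: 0 + 0) (fun=> 0)); last by move=> z; rewrite scaler0 addr0.
by rewrite scale1r => /(congr1 (fun v => v - abracket eps Y (fun=> 0) x)); rewrite addrK subrr.
Qed.

(* Multiplying by [b] does not change the value at [x] of the bracket with [W],
   by the Leibniz rule, but it kills [W]. *)
Lemma cutoff_near0 (W : sect E) (x : M) : (\forall q \near x, W q = 0) ->
  exists b : M -> R, [/\ forall q, smoothc (atl M) q b, b x = 1 & forall q, b q *: W q = 0].
Proof.
move=> /open_of_near [U [oU Ux HU]]; have [b [sb b1 b0]] := mfd_bump oU Ux.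
exists b; split => //; first exact: nbhs_singleton b1.
move=> q; have [Uq|nU] := pselect (U q); first by rewrite HU// scaler0.
by rewrite (nbhs_singleton (b0 q nU)) scale0r.
Qed.

Lemma bracket_vanish_l (W Y : sect E) (x : M) : smooth_sect W -> smooth_sect Y ->
  (\forall q \near x, W q = 0) -> abracket eps W Y x = 0.
Proof.
move=> sW sY W0; have [b [sb b1 bW]] := cutoff_near0 W0.
have Wx : W x = 0 by exact: nbhs_singleton W0.
have s1 : forall q, smoothc (atl M) q (fun=> 1 : R) by move=> q; exact: smoothc_cst.
have := bracket_leibniz eps (smooth_funT sb) (smooth_funT s1) sW sY x.
rewrite (@sect_ext (fun z => b z *: W z) (fun=> 0))//.
rewrite (@sect_ext (fun z => 1 *: Y z) Y); last by move=> z; rewrite scale1r.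
by rewrite bracket0l// dT_cst Wx b1 mulr0 scale0r scaler0 subr0 mulr1 scale1r add0r => <-.
Qed.

Lemma bracket_vanish_r (W Y : sect E) (x : M) : smooth_sect W -> smooth_sect Y ->
  (\forall q \near x, W q = 0) -> abracket eps Y W x = 0.
Proof.
move=> sW sY W0; have [b [sb b1 bW]] := cutoff_near0 W0.
have Wx : W x = 0 by exact: nbhs_singleton W0.
have s1 : forall q, smoothc (atl M) q (fun=> 1 : R) by move=> q; exact: smoothc_cst.
have := bracket_leibniz eps (smooth_funT s1) (smooth_funT sb) sY sW x.
rewrite (@sect_ext (fun z => b z *: W z) (fun=> 0))//.
rewrite (@sect_ext (fun z => 1 *: Y z) Y); last by move=> z; rewrite scale1r.
by rewrite bracket0r// dT_cst Wx b1 mulr0 scale0r scaler0 subr0 mulr1 scale1r add0r => <-.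
Qed.

Lemma near_sub0 (X X2 : sect E) (x : M) : (\forall q \near x, X q = X2 q) ->
  \forall q \near x, -1 *: X2 q + X q = 0.
Proof. by apply: filterS => q ->; rewrite scaleN1r addNr. Qed.

Lemma bracket_local_l (X X2 Y : sect E) (x : M) : smooth_sect X -> smooth_sect X2 -> smooth_sect Y ->
  (\forall q \near x, X q = X2 q) -> abracket eps X Y x = abracket eps X2 Y x.
Proof.
move=> sX sX2 sY XX; have := bracket_linearl eps (-1) sX2 sX sY x.
rewrite (bracket_vanish_l (smooth_sect_lin (-1) sX2 sX) sY (near_sub0 XX)).
by rewrite scaleN1r => /esym/eqP; rewrite addrC subr_eq0 => /eqP.
Qed.

Lemma bracket_local_r (X X2 Y : sect E) (x : M) : smooth_sect X -> smooth_sect X2 -> smooth_sect Y ->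
  (\forall q \near x, X q = X2 q) -> abracket eps Y X x = abracket eps Y X2 x.
Proof.
move=> sX sX2 sY XX; have := bracket_linearr eps (-1) sX2 sX sY x.
rewrite (bracket_vanish_r (smooth_sect_lin (-1) sX2 sX) sY (near_sub0 XX)).
by rewrite scaleN1r => /esym/eqP; rewrite addrC subr_eq0 => /eqP.
Qed.

Lemma bracket_suml (I : Type) (r : seq I) (X : I -> sect E) (Y : sect E) (x : M) :
  (forall i, smooth_sect (X i)) -> smooth_sect Y ->
  abracket eps (fun q => \sum_(i <- r) X i q) Y x = \sum_(i <- r) abracket eps (X i) Y x.
Proof.
move=> sX sY; elim: r => [|i r IH].
  rewrite big_nil -(bracket0l x sY); congr (abracket eps _ Y x).
  by apply: sect_ext => q; rewrite big_nil.
rewrite big_cons -IH -[X in X + _]scale1r -bracket_linearl//; last exact: smooth_sect_sum.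
by congr (abracket eps _ Y x); apply: sect_ext => q; rewrite big_cons scale1r.
Qed.

Lemma bracket_sumr (I : Type) (r : seq I) (X : I -> sect E) (Y : sect E) (x : M) :
  (forall i, smooth_sect (X i)) -> smooth_sect Y ->
  abracket eps Y (fun q => \sum_(i <- r) X i q) x = \sum_(i <- r) abracket eps Y (X i) x.
Proof.
move=> sX sY; elim: r => [|i r IH].
  rewrite big_nil -(bracket0r x sY); congr (abracket eps Y _ x).
  by apply: sect_ext => q; rewrite big_nil.
rewrite big_cons -IH -[X in X + _]scale1r -bracket_linearr//; last exact: smooth_sect_sum.
by congr (abracket eps Y _ x); apply: sect_ext => q; rewrite big_cons scale1r.
Qed.

Lemma local_bracketE (X Y X' Y' : sect E) (x : M) : smooth_sect X' -> smooth_sect Y' ->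
  (\forall z \near x, X' z = X z) -> (\forall z \near x, Y' z = Y z) ->
  local_bracket eps X Y x = abracket eps X' Y' x.
Proof.
move=> sX sY XX YY; rewrite /local_bracket; apply: xget_unique.
  by exists X', Y'.
move=> _ [X2 [Y2 [sX2 sY2 XX2 YY2 ->]]].
have e1 : \forall z \near x, X2 z = X' z by apply: filterS2 XX XX2 => z -> ->.
have e2 : \forall z \near x, Y2 z = Y' z by apply: filterS2 YY YY2 => z -> ->.
by rewrite (bracket_local_l sX2 sX sY2 e1) (bracket_local_r sY2 sY sX e2).
Qed.

Lemma dT_sumv (p : M) (I : Type) (r : seq I) (g : M -> R) (c : I -> R)
    (w : I -> 'rV[R]_(cdim (atl M))) : smoothc (atl M) p g ->
  dT g ((p, \sum_(i <- r) c i *: w i) : tangent_vec (atl M)) =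
  \sum_(i <- r) c i * dT g ((p, w i) : tangent_vec (atl M)).
Proof.
move=> sg; elim: r => [|i r IH]; last by rewrite !big_cons dT_linear// IH.
by rewrite !big_nil; exact: derive0.
Qed.

Lemma global_frame (k : fidx E) (x : M) : fdom k x -> exists F : 'I_(vb_rank E) -> sect E,
  (forall a, smooth_sect (F a)) /\ (forall a, \forall q \near x, F a q = frm k a q).
Proof.
move=> kx; have H a : exists F : sect E, smooth_sect F /\ \forall q \near x, F q = frm k a q.
  by have [F sF HF] := extend_sect (frm_smooth_sect_at a kx); exists F.
have [F HF] := choice H; exists F.
by split=> a; have [] := HF a.
Qed.

Lemma fcoord_comb3 (k : fidx E) (x : M) (a b c : R) (u v w : E x) d :
  fcoord k (a *: u - b *: v + c *: w) 0 d =
  a * fcoord k u 0 d - b * fcoord k v 0 d + c * fcoord k w 0 d.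
Proof. by rewrite !mxE linearD linearB !linearZ. Qed.

(** The Leibniz rule speaks of global functions and sections, so the coefficients of [Z] and [X] are
    first extended to [z] and [y]; locality allows the expansions in the frame [F], and the
    derivatives only see germs at [x]. *)
Lemma bracket_coord (k : fidx E) (x : M) (F : 'I_(vb_rank E) -> sect E) (Z X : sect E) c :
  fdom k x -> (forall a, smooth_sect (F a)) ->
  (forall a, \forall q \near x, F a q = frm k a q) ->
  smooth_sect Z -> smooth_sect X ->
  fcoord k (abracket eps Z X x) 0 c =
  \sum_a \sum_b fcoord k (Z x) 0 a * fcoord k (X x) 0 b * fcoord k (abracket eps (F a) (F b) x) 0 c
  + dT (fun q => fcoord k (X q) 0 c) ((x, anchor_left eps x (Z x)) : tangent_vec (atl M))
  - dT (fun q => fcoord k (Z q) 0 c) ((x, anchor_right eps x (X x)) : tangent_vec (atl M)).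
Proof.
move=> kx sF FE sZ sX.
have bx := vb_basis (vbP E) kx.
have ext (Y : sect E) : smooth_sect Y -> exists y : 'I_(vb_rank E) -> M -> R,
    (forall a q, smoothc (atl M) q (y a)) /\
    (forall a, \forall q \near x, y a q = fcoord k (Y q) 0 a).
  move=> /smooth_sectP sY.
  have [y Hy] := choice (fun a => extend_fun (sY k x a kx)).
  by exists y; split=> a; have [] := Hy a.
have glob (Y : sect E) (y : 'I_(vb_rank E) -> M -> R) :
    (forall a, \forall q \near x, y a q = fcoord k (Y q) 0 a) ->
    \forall q \near x, Y q = \sum_a y a q *: F a q.
  move=> Hy; have n1 := @filter_forall _ _ _ (nbhs x) (nbhs_filter x) Hy.
  have n2 := @filter_forall _ _ _ (nbhs x) (nbhs_filter x) FE.
  apply: filterS (filterI n1 (filterI n2 (fdom_near kx))) => q [h1 [h2 h3]].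
  rewrite -[LHS](sum_fcoord (vb_basis (vbP E) h3)); apply: eq_bigr => a _.
  by rewrite h1 h2.
have [z [sz zE]] := ext Z sZ; have [y [sy yE]] := ext X sX.
have sS (w : 'I_(vb_rank E) -> M -> R) : (forall a q, smoothc (atl M) q (w a)) ->
    forall a, smooth_sect (fun q => w a q *: F a q).
  by move=> sw a; apply: smooth_sect_scale.
have Fx a : F a x = frm k a x by exact: nbhs_singleton (FE a).
have zx a : z a x = fcoord k (Z x) 0 a by exact: nbhs_singleton (zE a).
have yx a : y a x = fcoord k (X x) 0 a by exact: nbhs_singleton (yE a).
rewrite (bracket_local_l sZ (smooth_sect_sum _ (sS z sz)) sX (glob _ _ zE)).
rewrite (bracket_local_r sX (smooth_sect_sum _ (sS y sy)) (smooth_sect_sum _ (sS z sz)) (glob _ _ yE)).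
rewrite bracket_suml//; last 2 first.
- exact: sS.
- by apply: smooth_sect_sum; exact: sS.
rewrite fcoord_sum summxE.
(* The Leibniz terms are multiples of the frame vectors [F b] and [F a], so they contribute to
   component [c] only when [b], respectively [a], equals [c]. *)
have term a : fcoord k (abracket eps (fun q => z a q *: F a q) (fun q => \sum_b y b q *: F b q) x) 0 c
  = \sum_b fcoord k (Z x) 0 a * fcoord k (X x) 0 b * fcoord k (abracket eps (F a) (F b) x) 0 c
   + z a x * dT (y c) ((x, anchor_left eps x (frm k a x)) : tangent_vec (atl M))
   - (c == a)%:R * \sum_b y b x * dT (z a) ((x, anchor_right eps x (frm k b x)) : tangent_vec (atl M)).
  rewrite bracket_sumr//; last 2 first.
  - exact: sS.
  - by apply: smooth_sect_scale.
  rewrite fcoord_sum summxE.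
  have leib b : fcoord k (abracket eps (fun q => z a q *: F a q) (fun q => y b q *: F b q) x) 0 c =
      fcoord k (Z x) 0 a * fcoord k (X x) 0 b * fcoord k (abracket eps (F a) (F b) x) 0 c
      + (c == b)%:R * (z a x * dT (y b) ((x, anchor_left eps x (frm k a x)) : tangent_vec (atl M)))
      - (c == a)%:R * (y b x * dT (z a) ((x, anchor_right eps x (frm k b x)) : tangent_vec (atl M))).
    rewrite (bracket_leibniz eps (smooth_funT (sz a)) (smooth_funT (sy b)) (sF a) (sF b) x).
    rewrite !Fx -zx -yx fcoord_comb3 !fcoord_frm// !mxE !eqxx /=; ring.
  under eq_bigr do rewrite leib.
  rewrite sumrB big_split /= -mulr_sumr; congr (_ + _ - _).
  rewrite (bigD1 c)//= eqxx mul1r big1 ?addr0// => b /negPf bc.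
  by rewrite eq_sym bc mul0r.
under eq_bigr do rewrite term.
rewrite sumrB big_split /=; congr (_ + _ - _).
  under eq_bigr do rewrite zx.
  rewrite -(@dT_sumv x _ _ _ (fun a => fcoord k (Z x) 0 a)); last exact: sy.
  have -> : \sum_a fcoord k (Z x) 0 a *: anchor_left eps x (frm k a x) = anchor_left eps x (Z x).
    rewrite -[in RHS](sum_fcoord bx (Z x)) linear_sum.
    by apply: eq_bigr => a _; rewrite linearZ.
  by apply: dT_ext; apply/nearcM; exact: yE.
rewrite (bigD1 c)//= eqxx mul1r [X in _ + X]big1; last first.
  by move=> a /negPf ac; rewrite eq_sym ac mul0r.
rewrite addr0.
under eq_bigr do rewrite yx.
rewrite -(@dT_sumv x _ _ _ (fun a => fcoord k (X x) 0 a)); last exact: sz.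
have -> : \sum_a fcoord k (X x) 0 a *: anchor_right eps x (frm k a x) = anchor_right eps x (X x).
  rewrite -[in RHS](sum_fcoord bx (X x)) linear_sum.
  by apply: eq_bigr => a _; rewrite linearZ.
by apply: dT_ext; apply/nearcM; exact: zE.
Qed.

End bracket.

(** * Linear functions on the dual bundle *)

Section complete_lift.
Variable R : realType.

Lemma derive_lsubmx (n m : nat) (h : 'rV[R]_n -> R) (z0 : 'rV[R]_(n + m)) u w :
  smooth_at (lsubmx z0) h -> smooth_at z0 (fun z : 'rV[R]_(n + m) => h (lsubmx z)) /\
  'D_(row_mx u w) (fun z : 'rV[R]_(n + m) => h (lsubmx z)) z0 = 'D_u h (lsubmx z0).
Proof.
move=> sh; have sl := @lsubmx_smooth R n m z0; split; first exact: (smooth_at_compR sl sh).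
rewrite [LHS](derive_comp _ (smooth_at_diff sl) (smooth_at_diff sh)); congr ('D_ _ h _).
apply/rowP => j; rewrite derive_coord; last exact: smooth_at_diff.
under eq_fun do rewrite mxE.
rewrite -derive_coord; last exact: (smooth_at_diff (smooth_at_id _)).
by rewrite derive_id row_mxEl.
Qed.

Lemma derive_rsubmx (n m : nat) (z0 : 'rV[R]_(n + m)) u w a :
  smooth_at z0 (fun z : 'rV[R]_(n + m) => rsubmx z 0 a) /\
  'D_(row_mx u w) (fun z : 'rV[R]_(n + m) => rsubmx z 0 a) z0 = w 0 a.
Proof.
split; first by apply: smooth_at_coord; exact: rsubmx_smooth.
under eq_fun do rewrite mxE.
rewrite -derive_coord; last exact: (smooth_at_diff (smooth_at_id _)).
by rewrite derive_id row_mxEr.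
Qed.

(** The coordinate shape of every fibrewise linear function: [iota_sect X], the entries of the map
    dual to an inclusion, and each factor of the kinetic energy. *)
Lemma derive_bilinear_sum (n m : nat) (h : 'I_m -> 'rV[R]_n -> R) (z0 : 'rV[R]_(n + m)) u w :
  (forall a, smooth_at (lsubmx z0) (h a)) ->
  smooth_at z0 (fun z : 'rV[R]_(n + m) => \sum_a rsubmx z 0 a * h a (lsubmx z)) /\
  'D_(row_mx u w) (fun z : 'rV[R]_(n + m) => \sum_a rsubmx z 0 a * h a (lsubmx z)) z0 =
  \sum_a (w 0 a * h a (lsubmx z0) + rsubmx z0 0 a * 'D_u (h a) (lsubmx z0)).
Proof.
move=> sh.
have st a : smooth_at z0 (fun z : 'rV[R]_(n + m) => rsubmx z 0 a * h a (lsubmx z)).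
  by apply: smooth_at_mul; [have [] := derive_rsubmx z0 u w a|have [] := derive_lsubmx u w (sh a)].
split; first by apply: smooth_at_sum => a _.
have dt a : derivable (fun z : 'rV[R]_(n + m) => rsubmx z 0 a * h a (lsubmx z)) z0 (row_mx u w).
  exact/diff_derivable/smooth_at_diff.
have -> : (fun z : 'rV[R]_(n + m) => \sum_a rsubmx z 0 a * h a (lsubmx z)) =
  \sum_a (fun z : 'rV[R]_(n + m) => rsubmx z 0 a * h a (lsubmx z)).
  by apply/funext => z; rewrite fct_sumE.
rewrite derive_sum//; apply: eq_bigr => a _.
have [s1 d1] := derive_rsubmx z0 u w a; have [s2 d2] := derive_lsubmx u w (sh a).
rewrite [LHS](deriveM (diff_derivable (smooth_at_diff s1)) (diff_derivable (smooth_at_diff s2))).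
by rewrite d1 d2 addrC /GRing.scale /= [h _ _ * _]mulrC.
Qed.

Lemma pair_cov_row_mx (n m : nat) (alpha : 'rV[R]_(n + m)) u w :
  pair_cov alpha (row_mx u w) = pair_cov (lsubmx alpha) u + pair_cov (rsubmx alpha) w.
Proof.
rewrite /pair_cov big_split_ord /=; congr (_ + _); apply: eq_bigr => i _.
  by rewrite row_mxEl mxE.
by rewrite row_mxEr mxE.
Qed.

Lemma pair_cov_linear n (alpha : 'rV[R]_n) a u v :
  pair_cov alpha (a *: u + v) = a * pair_cov alpha u + pair_cov alpha v.
Proof.
rewrite /pair_cov mulr_sumr -big_split; apply: eq_bigr => i _ /=.
by rewrite !mxE mulrDr mulrCA.
Qed.

Lemma pair_cov_sum n (alpha : 'rV[R]_n) (I : Type) (r : seq I) (c : I -> R) (v : I -> 'rV[R]_n) :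
  pair_cov alpha (\sum_(i <- r) c i *: v i) = \sum_(i <- r) c i * pair_cov alpha (v i).
Proof.
elim: r => [|i r IH]; last by rewrite !big_cons pair_cov_linear IH.
by rewrite !big_nil /pair_cov big1// => i _; rewrite mxE mulr0.
Qed.

Lemma pair_dcov (T : Type) (A : charted R T) (g : T -> R) p v : smoothc A p g ->
  dT g ((p, v) : tangent_vec A) = pair_cov (dcov A g p) v.
Proof.
move=> sg; rewrite dT_sum_delta//; apply: eq_bigr => i _.
by rewrite mxE mulrC.
Qed.

Section one_bundle.
Variables (M : manifold R) (E : vbundle M).

Lemma iota_cinv (X : sect E) (c : cidx (atl M)) (k : fidx E) z :
  iota_sect X (@cinv _ _ (total_sp (atl M) (dualb E)) (c, k) z) =
  \sum_a rsubmx z 0 a * fcoord k (X (cinv c (lsubmx z))) 0 a.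
Proof.
rewrite /iota_sect /= sum_lfunE; apply: eq_bigr => a _.
by rewrite scale_lfunE -[X in _ *: X]/(frm (k : fidx (dualb E)) a _ _) dual_frmE.
Qed.

Lemma iota_sm_dT (X : sect E) (q : {x : M & dualb E x}) u w : smooth_sect_at (projT1 q) X ->
  let k := frame_at E (projT1 q) in
  smoothc (total_sp (atl M) (dualb E)) q (iota_sect X) /\
  dT (iota_sect X) ((q, row_mx u w) : tangent_vec (total_sp (atl M) (dualb E))) =
  \sum_a (w 0 a * fcoord k (X (projT1 q)) 0 a +
     (projT2 q : dualb E _) (frm k a (projT1 q)) *
     dT (fun m => fcoord k (X m) 0 a) ((projT1 q, u) : tangent_vec (atl M))).
Proof.
case: q => x xi /= sX; have kx := vb_at (vbP E) x; set k := frame_at E x in kx *.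
have okM := manifold_atlas M; have cx := ao_at okM x; set c := chart_at (atl M) x in cx *.
pose h a y := fcoord k (X (cinv c y)) 0 a.
pose z0 : 'rV[R]_(cdim (atl M) + vb_rank E) := row_mx (cmap c x) (fcoord (k : fidx (dualb E)) xi).
have E0 : lsubmx z0 = cmap c x by rewrite row_mxKl.
have sh a : smooth_at (lsubmx z0) (h a) by rewrite E0; exact: sX.
have [s d] := derive_bilinear_sum u w sh.
have EF : (iota_sect X \o @cinv _ _ (total_sp (atl M) (dualb E)) (c, k)) =
   (fun z : 'rV[R]_(cdim (atl M) + vb_rank E) => \sum_a rsubmx z 0 a * h a (lsubmx z)).
  by apply/funext => z; exact: iota_cinv.
split; first by rewrite /smoothc /= -/c -/k EF.
rewrite /dT /= -/c -/k EF -/z0 d; apply: eq_bigr => a _.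
rewrite E0 row_mxKr fcoord_dual; last exact: (vb_basis (vbP E)).
by rewrite /h (ao_mapK okM cx).
Qed.

Lemma iota_sm (X : sect E) (q : {x : M & dualb E x}) : smooth_sect_at (projT1 q) X ->
  smoothc (total_sp (atl M) (dualb E)) q (iota_sect X).
Proof. by move=> sX; have [] := iota_sm_dT 0 0 sX. Qed.

Lemma dT_iota (X : sect E) (q : {x : M & dualb E x}) u w : smooth_sect_at (projT1 q) X ->
  let k := frame_at E (projT1 q) in
  dT (iota_sect X) ((q, row_mx u w) : tangent_vec (total_sp (atl M) (dualb E))) =
  \sum_a (w 0 a * fcoord k (X (projT1 q)) 0 a +
     (projT2 q : dualb E _) (frm k a (projT1 q)) *
     dT (fun m => fcoord k (X m) 0 a) ((projT1 q, u) : tangent_vec (atl M))).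
Proof. by move=> sX; have [] := iota_sm_dT u w sX. Qed.

(** The chain rule through [Z], with the velocity of [Z] split into its base part and the
    derivatives of its fibre coordinates. *)
Lemma dT_along_sect (L : {x : M & E x} -> R) (Z : sect E) (x : M) u : smooth_sect_at x Z ->
  smoothc (total_sp (atl M) E) (existT _ x (Z x)) L ->
  smoothc (atl M) x (fun m => L (existT _ m (Z m))) /\
  dT (fun m => L (existT _ m (Z m))) ((x, u) : tangent_vec (atl M)) =
  pair_cov (dcov (total_sp (atl M) E) L (existT _ x (Z x)))
    (row_mx u (\row_a dT (fun m => fcoord (frame_at E x) (Z m) 0 a) ((x, u) : tangent_vec (atl M)))).
Proof.
move=> sZ sL; have okM := manifold_atlas M; have okE := total_atlas (vbP E).
have kx := vb_at (vbP E) x; set k := frame_at E x in kx *.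
have cx := ao_at okM x; set c := chart_at (atl M) x in cx *.
pose h m : {x : M & E x} := existT _ m (Z m).
have sh : smoothc (atl M) x (cmap ((c, k) : cidx (total_sp (atl M) E)) \o h).
  apply: smooth_at_row_mx; first exact: (ao_trans okM cx cx).
  by apply: smooth_at_row => a; exact: (sZ k a kx).
have mh : smoothc_map (atl M) (total_sp (atl M) E) x h.
  split; first exact: sh.
  apply: nearcI; first exact: (nearc_cdom okM cx).
  by apply/nearcM; exact: fdom_near.
have Kc := ao_mapK okM; have Ke := ao_mapK okE.
split; first exact: (smoothc_comp Kc cx Ke mh sL).
rewrite [LHS](dT_comp (g := L) u Kc cx Ke mh sL) pair_dcov//; congr (pair_cov _ _).
apply/rowP => i; rewrite dT_coord//.
case: (split_ordP i) => b ->.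
  rewrite row_mxEl -[in RHS](dT_self okM x u) -/c dT_coord; last exact: (ao_trans okM cx cx).
  by apply: dT_ext; apply: nearcW => m /=; rewrite row_mxEl.
rewrite row_mxEr mxE; apply: dT_ext.
by apply: nearcW => m /=; rewrite row_mxEr.
Qed.

Section lift.
Variable eps : algebroid E.

Lemma structure_funE (x : M) (F : 'I_(vb_rank E) -> sect E) a b c :
  (forall a, smooth_sect (F a)) ->
  (forall a, \forall q \near x, F a q = frm (frame_at E x) a q) ->
  structure_fun eps x a b c = fcoord (frame_at E x) (abracket eps (F a) (F b) x) 0 c.
Proof.
move=> sF FE; rewrite /structure_fun mxE; congr (coord _ _ _).
exact: local_bracketE.
Qed.

Lemma eps_map_fibre (e : {x : M & E x}) alpha a :
  (projT2 (eps_map eps e alpha).1 : dualb E _) (frm (frame_at E (projT1 e)) a (projT1 e)) =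
  rsubmx alpha 0 a.
Proof.
case: e => x v /=; rewrite -fcoord_dual; last exact: (vb_basis (vbP E) (vb_at (vbP E) x)).
rewrite fcoordK//; apply: dual_basis; exact: (vb_basis (vbP E) (vb_at (vbP E) x)).
Qed.

(* The invariant content of the coordinate formula for [eps]. *)
Lemma iota_eps_map (L : {x : M & E x} -> R) (Z X : sect E) (x : M) :
  smooth_sect Z -> smooth_sect X -> smoothc (total_sp (atl M) E) (existT _ x (Z x)) L ->
  let u := eps_map eps (existT _ x (Z x)) (dcov (total_sp (atl M) E) L (existT _ x (Z x))) in
  dT (iota_sect X) u = (projT2 u.1 : dualb E x) (abracket eps Z X x) +
    dT (fun m => L (existT _ m (Z m))) ((x, anchor_right eps x (X x)) : tangent_vec (atl M)).
Proof.
move=> sZ sX sL; cbv zeta; set alpha := dcov _ _ _; pose u := eps_map eps (existT _ x (Z x)) alpha.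
rewrite -/u; have kx := vb_at (vbP E) x; set k := frame_at E x in kx.
have bx := vb_basis (vbP E) kx.
have sZx := (smooth_sect_atP Z).1 sZ x; have sXx := (smooth_sect_atP X).1 sX x.
have [F [sF FE]] := global_frame kx.
pose p : 'rV[R]_(cdim (atl M)) := lsubmx alpha; pose xi : 'rV[R]_(vb_rank E) := rsubmx alpha.
have [_ ->] := dT_along_sect (anchor_right eps x (X x)) sZx sL.
rewrite -/k -/alpha pair_cov_row_mx -/p -/xi.
have rhoZ : \sum_c fcoord k (Z x) 0 c *: anchor_left eps x (frm k c x) = anchor_left eps x (Z x).
  rewrite -[in RHS](sum_fcoord bx (Z x)) linear_sum.
  by apply: eq_bigr => a _; rewrite linearZ.
have sigX : \sum_c fcoord k (X x) 0 c *: anchor_right eps x (frm k c x) = anchor_right eps x (X x).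
  rewrite -[in RHS](sum_fcoord bx (X x)) linear_sum.
  by apply: eq_bigr => a _; rewrite linearZ.
have fib a : (projT2 u.1 : dualb E x) (frm k a x) = xi 0 a by exact: (eps_map_fibre (existT _ x (Z x))).
have -> : dT (iota_sect X) u = \sum_b (((\sum_a \sum_c structure_fun eps x a b c * fcoord k (Z x) 0 a * xi 0 c)
     + pair_cov p (anchor_right eps x (frm k b x))) * fcoord k (X x) 0 b
   + xi 0 b * dT (fun m => fcoord k (X m) 0 b) ((x, anchor_left eps x (Z x)) : tangent_vec (atl M))).
  rewrite [LHS](@dT_iota X u.1 _ _ sXx) /= -/k rhoZ; apply: eq_bigr => b _.
  by rewrite mxE fib.
have -> : (projT2 u.1 : dualb E x) (abracket eps Z X x) =
    \sum_c xi 0 c * fcoord k (abracket eps Z X x) 0 c.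
  rewrite -{1}(sum_fcoord bx (abracket eps Z X x)) linear_sum; apply: eq_bigr => c _.
  by rewrite linearZ -fib; exact: mulrC.
rewrite -[in X in pair_cov p X]sigX pair_cov_sum.
under [in RHS]eq_bigr do rewrite (bracket_coord eps _ kx sF FE sZ sX).
pose S c := \sum_a \sum_b fcoord k (Z x) 0 a * fcoord k (X x) 0 b *
  fcoord k (abracket eps (F a) (F b) x) 0 c.
pose B c := dT (fun m => fcoord k (X m) 0 c) ((x, anchor_left eps x (Z x)) : tangent_vec (atl M)).
(* The derivatives of the coordinates of [Z] along the right anchor, one from the bracket and one
   from [L] along [Z], cancel in this sum; [S] and [B] involve [Z] only through its value at [x]. *)
rewrite /pair_cov addrCA -big_split /=.
rewrite [X in _ = _ + X](eq_bigr (fun c => xi 0 c * S c + xi 0 c * B c)); last first.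
  by move=> c _; rewrite [in X in _ + X]mxE /S /B; ring.
under [LHS]eq_bigr do rewrite mulrDl -addrA.
rewrite !big_split /= addrCA; congr (_ + (_ + _)).
  by apply: eq_bigr => b _; exact: mulrC.
under [RHS]eq_bigr do rewrite mulr_sumr.
rewrite [RHS]exchange_big /=.
under [RHS]eq_bigr => a _.
  under eq_bigr do rewrite mulr_sumr.
  rewrite exchange_big /=; over.
rewrite [RHS]exchange_big /=; apply: eq_bigr => b _.
rewrite mulr_suml; apply: eq_bigr => a _.
rewrite mulr_suml; apply: eq_bigr => c _.
by rewrite (structure_funE _ _ _ sF FE) -/k; ring.
Qed.

End lift.
End one_bundle.

End complete_lift.

(** * Mechanical Lagrangians and complete lifts *)

Section mechanical.
Variable R : realType.

Lemma metric_suml (M : manifold R) (E : framed R M) (G : bundle_metric E) x (I : Type) (r : seq I)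
    (c : I -> R) (u : I -> E x) w :
  G x (\sum_(i <- r) c i *: u i) w = \sum_(i <- r) c i * G x (u i) w.
Proof.
elim: r => [|i r IH]; last by rewrite !big_cons metric_linear IH.
rewrite !big_nil; have := metric_linear G 1 (0 : E x) 0 w.
by rewrite scaler0 addr0 mul1r => /(congr1 (fun z => z - G x 0 w)); rewrite addrK subrr.
Qed.

Lemma metric_sumr (M : manifold R) (E : framed R M) (G : bundle_metric E) x (I : Type) (r : seq I)
    (c : I -> R) (u : I -> E x) w :
  G x w (\sum_(i <- r) c i *: u i) = \sum_(i <- r) c i * G x w (u i).
Proof. by rewrite Defs.metric_sym metric_suml; apply: eq_bigr => i _; rewrite Defs.metric_sym. Qed.

Lemma metric_sm (M : manifold R) (E : vbundle M) (G : bundle_metric E) (k : fidx E) p a b :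
  fdom k p -> smoothc (atl M) p (fun x => G x (frm k a x) (frm k b x)).
Proof.
move=> kp; have ok : open (fdom k) by exact: (vb_dom_open (vbP E)).
exact: ((smooth_funP _ ok).1 (metric_smooth G k a b)).
Qed.

Section lagrangian.
Variables (M : manifold R) (E : vbundle M) (G : bundle_metric E) (V : M -> R).
Hypothesis sV : forall p, smoothc (atl M) p V.
Let L := mechanical_lagrangian G V.

(** In bundle coordinates the Lagrangian is a quadratic form in the fibre minus a function of the
    base. A vertical direction fixes the base, so only the quadratic form varies, and by symmetry
    its two equal derivatives absorb the factor one half. *)
Lemma mechanical_sm_fibre (e : {x : M & E x}) (w : 'rV[R]_(vb_rank E)) :
  smoothc (total_sp (atl M) E) e L /\
  dT L ((e, row_mx 0 w) : tangent_vec (total_sp (atl M) E)) =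
  G (projT1 e) (projT2 e) (\sum_a w 0 a *: frm (frame_at E (projT1 e)) a (projT1 e)).
Proof.
case: e => x v /=; have kx := vb_at (vbP E) x; set k := frame_at E x in kx *.
have okM := manifold_atlas M; have cx := ao_at okM x; set c := chart_at (atl M) x in cx *.
pose g a b y := G (cinv c y) (frm k a (cinv c y)) (frm k b (cinv c y)).
pose z0 : 'rV[R]_(cdim (atl M) + vb_rank E) := row_mx (cmap c x) (fcoord k v).
have E0 : lsubmx z0 = cmap c x by rewrite row_mxKl.
have sg a b : smooth_at (lsubmx z0) (g a b) by rewrite E0; exact: metric_sm.
have sVc : smooth_at (lsubmx z0) (V \o cinv c) by rewrite E0; exact: sV.
pose K a (z : 'rV[R]_(cdim (atl M) + vb_rank E)) := \sum_b rsubmx z 0 b * g a b (lsubmx z).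
pose T a (z : 'rV[R]_(cdim (atl M) + vb_rank E)) := rsubmx z 0 a * K a z.
have EL : L \o @cinv _ _ (total_sp (atl M) E) (c, k) =
   (fun z : 'rV[R]_(cdim (atl M) + vb_rank E) => 2^-1 * (\sum_a T a z) - (V \o cinv c) (lsubmx z)).
  apply/funext => z; rewrite /L /mechanical_lagrangian /=; congr (_ * _ - _).
  rewrite metric_suml; apply: eq_bigr => a _; congr (_ * _).
  by rewrite metric_sumr.
have sK a := derive_bilinear_sum (0 : 'rV[R]_(cdim (atl M))) w (sg a).
have sr a := derive_rsubmx z0 0 w a.
have sT a : smooth_at z0 (T a) by apply: smooth_at_mul; [exact: (sr a).1|exact: (sK a).1].
have sS : smooth_at z0 (fun z => 2^-1 * (\sum_a T a z)).
  by apply: smooth_at_mul; [exact: smooth_at_cst|exact: smooth_at_sum].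
have [sV1 dV1] := derive_lsubmx 0 w sVc.
split; first by rewrite /smoothc /= -/c -/k EL; exact: smooth_at_sub.
rewrite /dT /= -/c -/k EL -/z0.
have d1 : derivable _ z0 (row_mx 0 w) := diff_derivable (smooth_at_diff sS).
have d2 : derivable _ z0 (row_mx 0 w) := diff_derivable (smooth_at_diff sV1).
rewrite [LHS](deriveB d1 d2) dV1 derive0 subr0.
have dTa a : derivable (T a) z0 (row_mx 0 w) by exact/diff_derivable/smooth_at_diff.
have -> : (fun z => 2^-1 * (\sum_a T a z)) = 2^-1 *: (\sum_a T a).
  by apply/funext => z; rewrite -[RHS]/(2^-1 * _) fct_sumE.
rewrite deriveZ; last exact: derivable_sum.
rewrite derive_sum//.
have dTE a : 'D_(row_mx 0 w) (T a) z0 =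
   (\sum_b w 0 a * fcoord k v 0 b * G x (frm k a x) (frm k b x)) +
   \sum_b fcoord k v 0 a * w 0 b * G x (frm k a x) (frm k b x).
  rewrite [LHS](deriveM (diff_derivable (smooth_at_diff (sr a).1)) (diff_derivable (smooth_at_diff (sK a).1))).
  rewrite (sK a).2 (sr a).2 addrC /GRing.scale /= row_mxKr /K [_ * w 0 a]mulrC !mulr_sumr.
  rewrite E0 /g (ao_mapK okM cx); congr (_ + _); apply: eq_bigr => b _.
    by rewrite mulrA.
  by rewrite derive0 mulr0 addr0 mulrA.
rewrite [X in _ *: X](eq_bigr _ (fun a _ => dTE a)).
rewrite big_split /=.
have EG : \sum_a \sum_b fcoord k v 0 a * w 0 b * G x (frm k a x) (frm k b x) =
    G x v (\sum_a w 0 a *: frm k a x).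
  rewrite -[in RHS](sum_fcoord (vb_basis (vbP E) kx) v) metric_suml; apply: eq_bigr => a _.
  by rewrite metric_sumr mulr_sumr; apply: eq_bigr => b _; rewrite mulrA.
rewrite EG (_ : \sum_a _ = G x v (\sum_a w 0 a *: frm k a x)).
  by rewrite /GRing.scale /=; field.
rewrite -EG exchange_big /=; apply: eq_bigr => a _; apply: eq_bigr => b _.
by rewrite Defs.metric_sym [w 0 b * _]mulrC.
Qed.

Lemma mechanical_sm e : smoothc (total_sp (atl M) E) e L.
Proof. by have [] := mechanical_sm_fibre e 0. Qed.

(** The morphism [eps] covers the identity of the dual bundle, so the point below eps(dL(e)) is the
    fibre derivative of the Lagrangian at [e]; it is tested on frame vectors. *)
Lemma mechanical_fibre (eps : algebroid E) (e : {x : M & E x}) (w : E (projT1 e)) :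
  (projT2 (eps_map eps e (dcov (total_sp (atl M) E) L e)).1 : dualb E _) w =
  G (projT1 e) (projT2 e) w.
Proof.
have bx := vb_basis (vbP E) (vb_at (vbP E) (projT1 e)).
rewrite -[in LHS](sum_fcoord bx w) -[in RHS](sum_fcoord bx w) linear_sum metric_sumr.
apply: eq_bigr => a _; rewrite linearZ; congr (_ * _).
apply: (etrans (eps_map_fibre eps e _ a)); rewrite !mxE.
have := (mechanical_sm_fibre e (delta_mx 0 a)).2.
rewrite (bigD1 a)//= mxE !eqxx scale1r big1 ?addr0; last first.
  by move=> b ba; rewrite mxE (negPf ba) andbF scale0r.
move=> <-; congr (dT _ (_, _)); apply/rowP => b.
case: (split_ordP b) => b' ->.
  by rewrite row_mxEl !mxE eq_lrshift.
by rewrite row_mxEr !mxE eq_rshift.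
Qed.

End lagrangian.

Section clift.
Variables (M : manifold R) (E : vbundle M) (eps : algebroid E).

Lemma clift_sectP (X : sect E) (e : {x : M & E x}) : smooth_sect X ->
  forall alpha, pair_cov alpha (clift_sect eps X e).2 = dT (iota_sect X) (eps_map eps e alpha).
Proof.
case: e => x v sX; have sXx := (smooth_sect_atP X).1 sX x.
set k := frame_at E x; rewrite /clift_sect /=.
set A := [set Z | _]; suff [Z AZ] : exists Z, A Z by exact: (@xgetPex _ 0 A (ex_intro _ Z AZ)).
(* The witness is the coordinate formula of the complete lift: its base part uses the right anchor,
   its fibre part the structure functions and the derivatives of [X] along the left anchor. *)
exists (row_mx (\sum_b fcoord k (X x) 0 b *: anchor_right eps x (frm k b x))
  (\row_c ((\sum_b \sum_a structure_fun eps x a b c * fcoord k v 0 a * fcoord k (X x) 0 b) +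
     dT (fun m => fcoord k (X m) 0 c)
       ((x, \sum_a fcoord k v 0 a *: anchor_left eps x (frm k a x)) : tangent_vec (atl M))))).
move=> alpha; rewrite pair_cov_row_mx pair_cov_sum.
have fib a := eps_map_fibre eps (existT _ x v) alpha a.
rewrite [RHS](@dT_iota _ _ _ X (eps_map eps (existT _ x v) alpha).1 _ _ sXx) /= -/k.
under [RHS]eq_bigr do rewrite mxE.
rewrite [RHS](eq_bigr (fun b => (fcoord k (X x) 0 b * pair_cov (lsubmx alpha) (anchor_right eps x (frm k b x))
   + fcoord k (X x) 0 b * \sum_a \sum_c structure_fun eps x a b c * fcoord k v 0 a * rsubmx alpha 0 c)
   + rsubmx alpha 0 b * dT (fun m => fcoord k (X m) 0 b)
       ((x, \sum_a fcoord k v 0 a *: anchor_left eps x (frm k a x)) : tangent_vec (atl M)))); last first.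
  by move=> b _; rewrite -(fib b) /=; ring.
rewrite !big_split /= -addrA; congr (_ + _).
rewrite /pair_cov [LHS](eq_bigr (fun c => rsubmx alpha 0 c *
    (\sum_b \sum_a structure_fun eps x a b c * fcoord k v 0 a * fcoord k (X x) 0 b)
  + rsubmx alpha 0 c * dT (fun m => fcoord k (X m) 0 c)
      ((x, \sum_a fcoord k v 0 a *: anchor_left eps x (frm k a x)) : tangent_vec (atl M)))); last first.
  by move=> c _; rewrite [X in _ * X]mxE mulrDr.
rewrite big_split /=; congr (_ + _).
under eq_bigr do rewrite mulr_sumr.
rewrite exchange_big /=; apply: eq_bigr => b _.
rewrite mulr_sumr; under eq_bigr do rewrite mulr_sumr.
rewrite exchange_big /=; apply: eq_bigr => a _.
by rewrite mulr_sumr; apply: eq_bigr => c _; ring.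
Qed.

Lemma dT_clift (l : {x : M & E x} -> R) (X : sect E) (e : {x : M & E x}) : smooth_sect X ->
  smoothc (total_sp (atl M) E) e l ->
  dT l (clift_sect eps X e) = dT (iota_sect X) (eps_map eps e (dcov (total_sp (atl M) E) l e)).
Proof. by move=> sX sl; rewrite -clift_sectP// [LHS]pair_dcov. Qed.

End clift.

End mechanical.

(** * The constrained Tulczyjew differential *)

Section nonholonomic.
Variables (R : realType) (M : manifold R) (E : vbundle M) (eps : algebroid E).
Variables (G : bundle_metric E) (V : M -> R).
Hypothesis sV : forall p, smoothc (atl M) p V.
Variables (N : manifold R) (j : N -> M).
Hypothesis hj : is_submanifold j.
Variables (D : vbundle N) (i : forall n, 'Hom(D n, E (j n))).
Hypothesis hi : is_subbundle i.

Let sj : smooth_map j := submfd_smooth hj.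

Lemma incl_coord_sm (l : fidx D) (k : fidx E) (n : N) a b : fdom l n -> fdom k (j n) ->
  smoothc (atl N) n (fun m => fcoord k (i m (frm l a m)) 0 b).
Proof.
move=> ln kn.
have oW : open (fdom l `&` j @^-1` fdom k).
  apply: openI; first exact: (vb_dom_open (vbP D)).
  by move/continuousP: sj.1; apply; exact: (vb_dom_open (vbP E)).
exact: ((smooth_fun_coordP _ oW).1 (subvb_smooth hi l (k : fidx (pullb j E)) a)).
Qed.

Lemma incl_sect_sm (Z : sect D) (k : fidx E) (n : N) b : smooth_sect_at n Z -> fdom k (j n) ->
  smoothc (atl N) n (fun m => fcoord k (i m (Z m)) 0 b).
Proof.
move=> sZ kn; have ln := vb_at (vbP D) n; set l := frame_at D n in ln.
apply: (smoothc_ext (g := fun m => \sum_a fcoord l (Z m) 0 a * fcoord k (i m (frm l a m)) 0 b)).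
  apply/nearcM; apply: filterS (fdom_near ln) => m lm.
  rewrite -[in RHS](sum_fcoord (vb_basis (vbP D) lm) (Z m)) linear_sum fcoord_sum summxE.
  by apply: eq_bigr => a _; rewrite linearZ fcoordZ [RHS]mxE.
by apply: smoothc_sum => a; apply: smoothc_mul; [exact: sZ|exact: incl_coord_sm].
Qed.

Lemma extend_incl (Z : sect D) (n : N) : smooth_sect_at n Z ->
  exists2 Z' : sect E, smooth_sect Z' & \forall m \near n, Z' (j m) = i m (Z m).
Proof.
move=> sZ; have kn := vb_at (vbP E) (j n).
apply: (@extend_sect_along R N M j n sj (@submfd_immersion _ _ _ _ hj n) E
  (fun m => i m (Z m)) (frame_at E (j n)) kn).
by move=> a; exact: incl_sect_sm.
Qed.

(** * The induced metric on D and the restricted Lagrangian *)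

Definition induced_fun n (u v : D n) : R := G (j n) (i n u) (i n v).

Fact induced_linear n (a : R) (u v w : D n) :
  induced_fun (a *: u + v) w = a * induced_fun u w + induced_fun v w.
Proof. by rewrite /induced_fun linearP metric_linear. Qed.

Fact induced_sym n (u v : D n) : induced_fun u v = induced_fun v u.
Proof. exact: Defs.metric_sym. Qed.

Fact induced_pos n (u : D n) : u != 0 -> 0 < induced_fun u u.
Proof.
move=> u0; apply: metric_pos; apply: contra_neq u0 => iu.
by apply: (subvb_inj hi); rewrite iu linear0.
Qed.

Fact induced_smooth (l : fidx D) a b :
  smooth_fun (atl N) (fdom l) (fun n => induced_fun (frm l a n) (frm l b n)).
Proof.
apply/smooth_funP; first exact: (vb_dom_open (vbP D)).
move=> n ln; have kn := vb_at (vbP E) (j n); set k := frame_at E (j n) in kn.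
apply: (smoothc_ext (g := fun m => \sum_c fcoord k (i m (frm l a m)) 0 c *
   \sum_d fcoord k (i m (frm l b m)) 0 d * G (j m) (frm k c (j m)) (frm k d (j m)))).
  apply/nearcM; apply: filterS (near_pullback sj (fdom_near kn)) => m km.
  have bm := vb_basis (vbP E) km; rewrite /induced_fun.
  rewrite -[in RHS](sum_fcoord bm (i m (frm l a m))) metric_suml; apply: eq_bigr => c _.
  by rewrite -[in RHS](sum_fcoord bm (i m (frm l b m))) metric_sumr.
apply: smoothc_sum => c; apply: smoothc_mul; first exact: incl_coord_sm.
apply: smoothc_sum => d; apply: smoothc_mul; first exact: incl_coord_sm.
exact: (smoothc_pullback sj (metric_sm G c d kn)).
Qed.

Definition induced_metric : bundle_metric D :=
  BundleMetric induced_linear induced_sym induced_pos induced_smooth.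

Let L := mechanical_lagrangian G V.
Let l := fun e : {n : N & D n} => L (bundle_incl i e).

(** The restriction is again mechanical, so what was shown for a mechanical Lagrangian applies to
    [D] with [epsP]. *)
Lemma restricted_lagrangian : l = mechanical_lagrangian induced_metric (V \o j).
Proof. by []. Qed.

Lemma potential_restr_sm n : smoothc (atl N) n (V \o j).
Proof. exact: (smoothc_pullback sj (sV (j n))). Qed.

Variable P : forall n, 'Hom(E (j n), D n).
Hypothesis hP : is_orthogonal_projection i G P.
Variable epsP : algebroid D.
Hypothesis hepsP : is_nonholonomic_restriction i eps P epsP.

(** * The constrained differential through the pullback of the dual of E *)

Let u_ (e : {n : N & D n}) := eps_map eps (bundle_incl i e)
  (dcov (total_sp (atl M) E) L (bundle_incl i e)).
Let q_ (e : {n : N & D n}) : {n : N & pullb j (dualb E) n} :=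
  existT (fibre (pullb j (dualb E))) (projT1 e) (projT2 (u_ e).1).
Let TP := total_sp (atl N) (pullb j (dualb E)).
Let TE := total_sp (atl M) (dualb E).
Let TD := total_sp (atl N) (dualb D).

Let TP_at (q : {n : N & pullb j (dualb E) n}) : cdom (chart_at TP q) q.
Proof.
by split; [exact: (ao_at (manifold_atlas N))|exact: (vb_at (vbP E))].
Qed.

Let TP_mapK (c : cidx TP) q : cdom c q -> cinv c (cmap c q) = q.
Proof.
case: c => [c k]; case: q => [n xi] [/= cn kn].
rewrite row_mxKl row_mxKr (ao_mapK (manifold_atlas N) cn).
congr (existT _ _ _).
exact: (@sum_fcoord R N (pullb j (dualb E)) k n (dual_basis (vb_basis (vbP E) kn)) xi).
Qed.

Let okM := manifold_atlas M.
Let okN := manifold_atlas N.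

Let near_base := @nearc_base R N (pullb j (dualb E)).

Lemma dual_incl_smoothc_map q : smoothc_map TP TE q (@dual_incl R N M j E).
Proof.
have nk := near_pullback sj (fdom_near (vb_at (vbP E) (j (projT1 q)))).
split; last first.
  apply: (near_base (Q := fun m => cdom (chart_at (atl M) (j (projT1 q))) (j m) /\
    fdom (frame_at E (j (projT1 q))) (j m))).
  apply: filterI nk; apply: (near_pullback sj).
  by apply: open_nbhs_nbhs; split; [exact: (mfd_dom_open (mfdP M))|exact: (ao_at okM)].
apply: smooth_at_row_mx.
  apply: (@smooth_at_comp _ _ _ _ _ (fun z : 'rV[R]_(cdim (atl N) + vb_rank (pullb j (dualb E))) => lsubmx z)
    ((cmap (chart_at (atl M) (j (projT1 q))) \o j) \o cinv (chart_at (atl N) (projT1 q)))).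
    exact: lsubmx_smooth.
  by rewrite row_mxKl; exact: (smooth_map_chart _ sj).
apply: smooth_at_ext (@rsubmx_smooth _ _ _ _).
have := near_base (q := q) nk; rewrite /nearc; apply: filterS => z kz.
rewrite /= -[LHS](@fcoordK _ _ (dualb E) (frame_at E (j (projT1 q))) _ (dual_basis (vb_basis (vbP E) kz))).
by [].
Qed.

(** In coordinates this is the identity of the base, with the fibres multiplied by the transposed
    matrix of [i]. *)
Lemma dual_restr_smoothc_map q : smoothc_map TP TD q (@dual_restr R N M j E D i).
Proof.
have ln := vb_at (vbP D) (projT1 q); set l0 := frame_at D (projT1 q) in ln.
have kn := vb_at (vbP E) (j (projT1 q)); set k0 := frame_at E (j (projT1 q)) in kn.
have nl := fdom_near ln.
split; last first.
  apply: (near_base (Q := fun m => cdom (chart_at (atl N) (projT1 q)) m /\ fdom l0 m)).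
  apply: filterI nl.
  by apply: open_nbhs_nbhs; split; [exact: (mfd_dom_open (mfdP N))|exact: (ao_at okN)].
have sl := @lsubmx_smooth R (cdim (atl N)) (vb_rank (pullb j (dualb E))).
apply: smooth_at_row_mx.
  apply: (@smooth_at_comp _ _ _ _ _ (fun z : 'rV[R]_(cdim (atl N) + vb_rank (pullb j (dualb E))) => lsubmx z)
    (cmap (chart_at (atl N) (projT1 q)) \o cinv (chart_at (atl N) (projT1 q)))).
    exact: sl.
  by rewrite row_mxKl; apply: (ao_trans okN); exact: (ao_at okN).
apply: smooth_at_row => b.
have si a : smooth_at (lsubmx (cmap (chart_at TP q) q))
    (fun y => fcoord k0 (i _ (frm l0 b (cinv (chart_at (atl N) (projT1 q)) y))) 0 a).
  by rewrite row_mxKl; exact: incl_coord_sm.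
have [H _] := derive_bilinear_sum 0 0 si.
apply: smooth_at_ext H.
have := near_base (q := q) nl; rewrite /nearc; apply: filterS => z lz.
rewrite [RHS](fcoord_dual (vb_basis (vbP D) lz)) comp_lfunE /= sum_lfunE.
apply: eq_bigr => a _; rewrite scale_lfunE; congr (_ * _).
by rewrite lfunE mxE.
Qed.

Lemma dT_base (F : framed R N) (h : N -> R) (q : {n : N & F n})
    (w : 'rV[R]_(cdim (atl N) + vb_rank F)) : smoothc (atl N) (projT1 q) h ->
  smoothc (total_sp (atl N) F) q (fun q' => h (projT1 q')) /\
  dT (fun q' => h (projT1 q')) ((q, w) : tangent_vec (total_sp (atl N) F)) =
  dT h ((projT1 q, lsubmx w) : tangent_vec (atl N)).
Proof.
move=> sh; set c := chart_at (atl N) (projT1 q).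
pose z0 : 'rV[R]_(cdim (atl N) + vb_rank F) := cmap (chart_at (total_sp (atl N) F) q) q.
have E0 : lsubmx z0 = cmap c (projT1 q) by rewrite row_mxKl.
have sh0 : smooth_at (lsubmx z0) (h \o cinv c) by rewrite E0.
have [H1 H2] := derive_lsubmx (lsubmx w) (rsubmx w) sh0.
split; first exact: H1.
by rewrite -[w in LHS]hsubmxK [LHS]H2 E0.
Qed.

(** The pullback uses the frames of [E], so [dual_incl] is [j] on the base and the identity on fibre
    coordinates. *)
Lemma Tmap_dual_incl q (w : 'rV[R]_(cdim (atl N) + vb_rank E)) :
  (Tmap TE (@dual_incl R N M j E) ((q, w) : tangent_vec TP)).2 =
  row_mx (Tmap (atl M) j ((projT1 q, lsubmx w) : tangent_vec (atl N))).2 (rsubmx w).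
Proof.
have [s1 _] := dual_incl_smoothc_map q.
have kn := vb_at (vbP E) (j (projT1 q)); set k0 := frame_at E (j (projT1 q)) in kn.
have nk := near_pullback sj (fdom_near kn).
have sc : smoothc (atl N) (projT1 q) (cmap (chart_at (atl M) (j (projT1 q))) \o j).
  exact: smooth_map_chart.
apply/rowP => b; rewrite dT_coord//; case: (split_ordP b) => a ->.
  rewrite row_mxEl dT_coord//.
  have sa : smoothc (atl N) (projT1 q) (fun m => cmap (chart_at (atl M) (j (projT1 q))) (j m) 0 a).
    exact: smooth_at_coord.
  rewrite -(dT_base (F := pullb j (dualb E)) w sa).2.
  by apply: dT_ext; apply: nearcW => q' /=; rewrite row_mxEl.
rewrite row_mxEr -[X in _ = rsubmx X _ _]hsubmxK row_mxKr.
have [_ <-] := derive_rsubmx (cmap (chart_at TP q) q) (lsubmx w) (rsubmx w) a.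
rewrite -[w in LHS]hsubmxK; apply: near_eq_derive.
have := near_base (q := q) nk; rewrite /nearc; apply: filterS => z kz.
rewrite /= row_mxEr.
by rewrite (@fcoordK _ _ (dualb E) (frame_at E (j (projT1 q))) _ (dual_basis (vb_basis (vbP E) kz))).
Qed.

(* [Lambda] is defined through [xget]; [w_spec] shows that the chosen set is inhabited. *)
Let w_ (e : {n : N & D n}) : 'rV[R]_(cdim TP) :=
  xget 0 [set w0 | Tmap TE (@dual_incl R N M j E) ((q_ e, w0) : tangent_vec TP) = u_ e].

Let Lambda_def e : Lambda i eps L e = Tmap TD (@dual_restr R N M j E D i) ((q_ e, w_ e) : tangent_vec TP).
Proof. by []. Qed.

Lemma eps_map_base (e : {x : M & E x}) alpha :
  lsubmx ((eps_map eps e alpha).2 : 'rV[R]_(cdim (atl M) + vb_rank E)) =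
  anchor_left eps (projT1 e) (projT2 e).
Proof.
rewrite row_mxKl -[in RHS](sum_fcoord (vb_basis (vbP E) (vb_at (vbP E) (projT1 e))) (projT2 e)).
by rewrite linear_sum; apply: eq_bigr => c _; rewrite linearZ.
Qed.

Let w_spec e : Tmap TE (@dual_incl R N M j E) ((q_ e, w_ e) : tangent_vec TP) = u_ e.
Proof.
suff [w0 H0] : exists w0 : 'rV[R]_(cdim TP),
    Tmap TE (@dual_incl R N M j E) ((q_ e, w0) : tangent_vec TP) = u_ e.
  exact: (@xgetPex _ 0 [set w0 | Tmap TE (@dual_incl R N M j E) ((q_ e, w0) : tangent_vec TP) = u_ e]
    (ex_intro _ w0 H0)).
case: e => n d.
(* The left anchor of [epsP] is the vector on [N] that [j] sends to the left anchor of [eps]; the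
   fibre part is copied unchanged. *)
exists (row_mx (anchor_left epsP n d)
  (rsubmx ((u_ (existT _ n d)).2 : 'rV[R]_(cdim (atl M) + vb_rank E)))).
rewrite [LHS]surjective_pairing [RHS]surjective_pairing; congr (_, _).
rewrite Tmap_dual_incl row_mxKl row_mxKr (nhr_rho hepsP) /=.
rewrite -[RHS](@hsubmxK _ _ (cdim (atl M)) (vb_rank E)); congr (row_mx _ _).
exact/esym/(eps_map_base (bundle_incl i (existT _ n d))).
Qed.

(** Injectivity of the tangent map of [j] determines the base part of the chosen vector. *)
Let w_base e : lsubmx (w_ e : 'rV[R]_(cdim (atl N) + vb_rank E)) = anchor_left epsP (projT1 e) (projT2 e).
Proof.
apply: (submfd_immersion hj (n := projT1 e)) => /=.
rewrite [RHS](nhr_rho hepsP) [LHS]surjective_pairing; congr (_, _).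
have := congr1 (fun v => lsubmx (v.2 : 'rV[R]_(cdim (atl M) + vb_rank E))) (w_spec e).
by rewrite Tmap_dual_incl row_mxKl => ->; exact: (eps_map_base (bundle_incl i e)).
Qed.

Lemma dT_Lambda e (h : {n : N & dualb D n} -> R) :
  smoothc TD (legendre_nh i eps L e) h ->
  dT h (Lambda i eps L e) = dT (h \o @dual_restr R N M j E D i) ((q_ e, w_ e) : tangent_vec TP).
Proof.
move=> sh; rewrite Lambda_def; apply/esym; apply: dT_comp.
- exact: TP_mapK.
- exact: TP_at.
- exact: (ao_mapK (total_atlas (dual_vbundle (vbP D)))).
- exact: dual_restr_smoothc_map.
- exact: sh.
Qed.

Lemma Lambda_base e (h : N -> R) : smoothc (atl N) (projT1 e) h ->
  dT (fun xi : {n : N & dualb D n} => h (projT1 xi)) (Lambda i eps L e) =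
  dT h ((projT1 e, anchor_left epsP (projT1 e) (projT2 e)) : tangent_vec (atl N)).
Proof.
move=> sh; rewrite dT_Lambda; last exact: (dT_base (F := dualb D) (q := legendre_nh i eps L e) 0 sh).1.
have := (dT_base (F := pullb j (dualb E)) (q := q_ e) (w_ e) sh).2.
by rewrite w_base.
Qed.

Lemma legendre_fibre e (d : D (projT1 e)) :
  (projT2 (legendre_nh i eps L e) : dualb D _) d =
  G (j (projT1 e)) (i _ (projT2 e)) (i _ d).
Proof.
rewrite /= comp_lfunE; exact: (@mechanical_fibre R M E G V sV eps (bundle_incl i e)).
Qed.

Lemma metricB (x : M) (u v w : E x) : G x (u - v) w = G x u w - G x v w.
Proof. by rewrite addrC -scaleN1r metric_linear mulN1r addrC. Qed.

Lemma Lambda_iota (Z Y : sect D) (n : N) : smooth_sect Z -> smooth_sect Y ->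
  dT (iota_sect Y) (Lambda i eps L (existT _ n (Z n))) =
  G (j n) (i n (Z n)) (i n (abracket epsP Z Y n)) +
  dT (fun m => l (existT _ m (Z m))) ((n, anchor_right epsP n (Y n)) : tangent_vec (atl N)).
Proof.
move=> sZ sY; set e := existT _ n (Z n).
have sYn := (smooth_sect_atP Y).1 sY n; have sZn := (smooth_sect_atP Z).1 sZ n.
have [Z' sZ' ZE] := extend_incl sZn; have [Y' sY' YE] := extend_incl sYn.
have Zn : Z' (j n) = i n (Z n) by exact: nbhs_singleton ZE.
have Yn : Y' (j n) = i n (Y n) by exact: nbhs_singleton YE.
rewrite dT_Lambda; last exact: (@iota_sm R N D).
(* Since [Y'] extends [Y], the two fibrewise linear functions agree on the pullback near the point;
   this moves the computation from [D] to [E], where [iota_eps_map] applies. *)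
have -> : dT (iota_sect Y \o @dual_restr R N M j E D i) ((q_ e, w_ e) : tangent_vec TP) =
   dT (iota_sect Y' \o @dual_incl R N M j E) ((q_ e, w_ e) : tangent_vec TP).
  apply: dT_ext; have := near_base (q := q_ e) YE; apply: nearcS => q' Hq'.
  by rewrite /iota_sect /= comp_lfunE /= Hq'.
have sI : smoothc TE (dual_incl (q_ e)) (iota_sect Y').
  by apply: (@iota_sm R M E); exact: (smooth_sect_atP Y').1.
rewrite (dT_comp (w_ e) TP_mapK (TP_at (q_ e)) (ao_mapK (total_atlas (dual_vbundle (vbP E))))
   (dual_incl_smoothc_map (q_ e)) sI) w_spec.
have sL : smoothc (total_sp (atl M) E) (existT _ (j n) (Z' (j n))) L by exact: mechanical_sm.
have := @iota_eps_map R M E eps L Z' Y' (j n) sZ' sY' sL.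
rewrite /u_ /bundle_incl /= Zn => ->; congr (_ + _).
  (* The bracket in [E] is paired through the metric with a vector of [D], so its component
     orthogonal to [D] drops out. *)
  have := @mechanical_fibre R M E G V sV eps (existT _ (j n) (i n (Z n))) (abracket eps Z' Y' (j n)).
  move=> /= ->; have [_ orth] := hP n.
  rewrite (nhr_bracket hepsP sZ sY sZ' sY' ZE YE) Defs.metric_sym [RHS]Defs.metric_sym.
  by apply/eqP; rewrite -subr_eq0 -metricB; apply/eqP; exact: orth.
pose F x := L (existT _ x (Z' x)).
have sF : smoothc (atl M) (j n) F.
  by have [] := dT_along_sect 0 ((smooth_sect_atP Z').1 sZ' (j n)) sL.
(* The right anchor of [i n (Y n)] is tangent to [N], so only the values along [N] matter, and there
   [Z'] is [Z]. *)
rewrite Yn -[(_, anchor_right eps _ _)](nhr_sigma hepsP) -(dT_pullback sj _ sF).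
apply: dT_ext; apply/nearcM; apply: filterS ZE => m Zm.
by rewrite /F /= Zm.
Qed.

Lemma dT_clift_Lambda (X : sect D) e : smooth_sect X ->
  dT l (clift_sect epsP X e) = dT (iota_sect X) (Lambda i eps L e).
Proof.
case: e => n d sX; have sl : smoothc (total_sp (atl N) D) (existT _ n d) l.
  by rewrite restricted_lagrangian; apply: mechanical_sm => p; exact: potential_restr_sm.
rewrite (dT_clift epsP sX sl); have ln := vb_at (vbP D) n; set l0 := frame_at D n in ln.
(* Both invariant formulas need a global section through the given vector: constant coefficients in
   a local frame, then extended. *)
have [|Z sZ ZE] := @extend_sect R N D n (fun m => \sum_a fcoord l0 d 0 a *: frm l0 a m).
  apply: smooth_sect_at_sum => a; apply: smooth_sect_at_scale; first exact: smoothc_cst.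
  exact: frm_smooth_sect_at.
have Zn : Z n = d.
  by rewrite (nbhs_singleton ZE) sum_fcoord//; exact: (vb_basis (vbP D)).
rewrite -Zn in sl *; rewrite (Lambda_iota n sZ sX).
rewrite (iota_eps_map epsP sZ sX sl); congr (_ + _).
rewrite restricted_lagrangian.
exact: (@mechanical_fibre R N D induced_metric (V \o j) potential_restr_sm epsP (existT _ n (Z n))).
Qed.

Lemma dT_first_integral (X : sect D) (f : N -> R) e : smooth_sect X -> (forall n, smoothc (atl N) n f) ->
  dT (fun xi : {n : N & dualb D n} => iota_sect X xi - f (projT1 xi)) (Lambda i eps L e) =
  dT l (clift_sect epsP X e) - clift_fun epsP f e.
Proof.
move=> sX sf; rewrite dT_clift_Lambda// /clift_fun -Lambda_base//.
have s1 : smoothc TD (legendre_nh i eps L e) (iota_sect X).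
  by apply: (@iota_sm R N D); exact: (smooth_sect_atP X).1.
have s2 : smoothc TD (legendre_nh i eps L e) (fun xi => f (projT1 xi)).
  exact: (dT_base (F := dualb D) (q := legendre_nh i eps L e) 0 (sf _)).1.
exact: (deriveB (diff_derivable (smooth_at_diff s1)) (diff_derivable (smooth_at_diff s2))).
Qed.

Lemma symmetry_iff_phase (X : sect D) (f : N -> R) : smooth_sect X -> (forall n, smoothc (atl N) n f) ->
  is_symmetry epsP l X f <->
  constant_on_phase_dynamics i eps L
    (fun xi : {n : N & dualb D n} => iota_sect X xi - f (projT1 xi)).
Proof.
move=> sX sf; split=> H.
  by move=> _ [e _ <-]; rewrite dT_first_integral// H subrr.
move=> e; apply/eqP; rewrite -subr_eq0 -dT_first_integral//; apply/eqP.
by apply: H; exists e.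
Qed.

End nonholonomic.

(** * Vector fields and curves in charts *)

Section tangent_frames.
Variables (R : realType) (N : manifold R).

(** The chain rule through [c] expands every vector in the coordinate vectors of [c], so they span;
    their number equals the dimension. *)
Lemma tangent_basis (c : cidx (atl N)) (x : N) : cdom c x ->
  basis_of fullv (vb_frame (c : fidx (tangent_bundle (atl N))) x).
Proof.
move=> cx; have okN := manifold_atlas N.
rewrite basisEdim dimvf size_tuple; apply/andP; split; last by rewrite /dim /= mul1n.
apply/subvP => v _.
have dg := smooth_at_diff (ao_trans okN cx (ao_at okN x)).
have E := dT_chart okN v cx dg.
rewrite -(dT_self okN x v) E derive_sum_delta//.
apply: memv_suml => a _; apply: memvZ.
apply: memv_span; apply/tnthP; exists a.
by rewrite tnth_mktuple.
Qed.

Lemma dT_chart_fcoord (c : cidx (atl N)) (x : N) v : cdom c x ->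
  dT (cmap c) ((x, v) : tangent_vec (atl N)) =
  fcoord (c : fidx (tangent_bundle (atl N))) (v : tangent_bundle (atl N) x).
Proof.
move=> cx; have okN := manifold_atlas N.
have dg := smooth_at_diff (ao_trans okN cx (ao_at okN x)).
rewrite -[LHS](@fcoordK _ _ (tangent_bundle (atl N)) c x (tangent_basis cx)).
apply: (f_equal (@fcoord R N (tangent_bundle (atl N)) c x)).
by rewrite -[RHS](dT_self okN x v) (dT_chart okN v cx dg) derive_sum_delta.
Qed.

Variables (D : vbundle N) (h : forall x, 'Hom(D x, tangent_bundle (atl N) x)).
Hypothesis sh : smooth_hom h.

(** At [m] both the anchor and [dT] use the chart chosen at [m], which may jump with [m]. Near [p]
    everything is rewritten in the one chart [c], where partial derivatives and anchor coefficients
    are smooth. *)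
Lemma anchor_dT_sm (f : N -> R) (X : sect D) (p : N) : smoothc (atl N) p f -> smooth_sect_at p X ->
  smoothc (atl N) p (fun m => dT f ((m, h m (X m)) : tangent_vec (atl N))).
Proof.
move=> sf sX; have okN := manifold_atlas N.
have cp := ao_at okN p; set c := chart_at (atl N) p in cp.
have kp := vb_at (vbP D) p; set k := frame_at D p in kp.
have sF : smooth_at (cmap c p) (f \o cinv c) by exact: sf.
pose A a b m := fcoord (c : fidx (tangent_bundle (atl N))) (h m (frm k a m)) 0 b.
have sA a b : smoothc (atl N) p (A a b).
  have oW : open (fdom k `&` cdom c).
    by apply: openI; [exact: (vb_dom_open (vbP D))|exact: (mfd_dom_open (mfdP N))].
  exact: ((smooth_fun_coordP _ oW).1 (sh k (c : fidx (tangent_bundle (atl N))) a)).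
apply: (smoothc_ext (g := fun m => \sum_b (\sum_a fcoord k (X m) 0 a * A a b m) *
   ('D_(delta_mx 0 b) (f \o cinv c) \o cmap c) m)).
  have n1 : \forall m \near p, smoothc (atl N) m f by exact: smoothc_near.
  have n2 : \forall m \near p, cdom c m.
    by apply: open_nbhs_nbhs; split => //; exact: (mfd_dom_open (mfdP N)).
  apply/nearcM; apply: filterS (filterI n1 (filterI n2 (fdom_near kp))) => m [smoothc [cm km]].
  have d1 : differentiable (f \o cinv c) (cmap c m).
    exact: (smooth_at_diff ((smoothc_chart okN f cm).2 smoothc)).
  rewrite (dT_chart okN _ cm d1) dT_chart_fcoord// derive_sum_delta//.
  apply: eq_bigr => b _; congr (_ * _).
  rewrite -[in RHS](sum_fcoord (vb_basis (vbP D) km) (X m)) linear_sum fcoord_sum summxE.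
  by apply: eq_bigr => a _; rewrite linearZ fcoordZ [RHS]mxE.
apply: smoothc_sum => b; apply: smoothc_mul.
  by apply: smoothc_sum => a; apply: smoothc_mul; [exact: sX|exact: sA].
apply: (@smooth_at_ext _ _ _ _ ('D_(delta_mx 0 b) (f \o cinv c))).
  by apply: filterS (ao_near okN cp cp) => z [_ zz _] /=; rewrite zz.
exact: smooth_at_derive.
Qed.

End tangent_frames.

Section curves.
Variable R : realType.

Lemma smooth_curve_chart (T : Type) (A : charted R T) (I : set R) (g : R -> T) (c : cidx A) :
  atlas_ok A -> open I -> (forall t, I t -> cdom c (g t)) -> smooth_on I (cmap c \o g) ->
  smooth_curve A I g.
Proof.
move=> okA oI Ic sg d.
have sgt t : I t -> smooth_at t (cmap c \o g) by move=> It; exact: ((smooth_onP _ oI).1 sg).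
have oJ : open (I `&` g @^-1` cdom d).
  rewrite openE => t [It dt]; rewrite /interior.
  have n1 : \forall s \near t, I s by apply: open_nbhs_nbhs.
  have n2 : \forall s \near t, cdom d (cinv c (cmap c (g s))).
    apply: (near_comp (f := cmap c \o g) (P := fun z => cdom d (cinv c z))).
      exact: smooth_at_cont (sgt t It).
    by apply: filterS (ao_near okA (Ic t It) dt) => z [].
  by apply: filterS2 n1 n2 => s Is; rewrite (ao_mapK okA (Ic s Is)).
split => //; apply/smooth_onP => // t [It dt].
apply: (@smooth_at_ext _ _ _ _ ((cmap d \o cinv c) \o (cmap c \o g))).
  have n1 : \forall s \near t, I s by apply: open_nbhs_nbhs.
  by apply: filterS n1 => s Is /=; rewrite (ao_mapK okA (Ic s Is)).
apply: smooth_at_comp; first exact: sgt.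
exact: (ao_trans okA (Ic t It) dt).
Qed.

Lemma tprol_derive (T : Type) (A : charted R T) (W : normedModType R) (b : R -> T) (t : R) (g : T -> W) :
  atlas_ok A -> (\forall s \near t, cdom (chart_at A (b t)) (b s)) ->
  differentiable (cmap (chart_at A (b t)) \o b) t -> smoothc A (b t) g ->
  is_derive t 1 (g \o b) (dT g (tprol A b t)).
Proof.
move=> okA nb db sg; set c := chart_at A (b t) in nb db.
have dg : differentiable (g \o cinv c) ((cmap c \o b) t) by exact: smooth_at_diff sg.
apply: (near_eq_is_derive (f := (g \o cinv c) \o (cmap c \o b))).
  by apply: filterS nb => s cs /=; rewrite (ao_mapK okA cs).
have dgb := differentiable_comp db dg.
apply: DeriveDef; first exact: diff_derivable.
by rewrite (derive_comp _ db dg) /dT /tprol /= derive1E.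
Qed.

Lemma constant_on_interval (I : set R) (F : R -> R) : is_interval I ->
  (forall t, I t -> is_derive t 1 F 0) -> forall s t, I s -> I t -> F s = F t.
Proof.
move=> iI H s t Is It.
have [c cst|c _ E] := @mvt_real R F (fun=> 0) s t.
  apply: H; move: cst; case/orP: (le_total s t) => st.
    by rewrite (min_idPl st) (max_idPr st); exact: iI.
  by rewrite (min_idPr st) (max_idPl st); exact: iI.
by apply/eqP; rewrite eq_sym -subr_eq0 E mul0r.
Qed.

End curves.

(** * Solutions and first integrals *)

Section mechanical_dynamics.
Variables (R : realType) (N : manifold R) (D : vbundle N) (eps : algebroid D).
Variables (G : bundle_metric D) (W : N -> R).
Hypothesis sW : forall p, smoothc (atl N) p W.
Let l := mechanical_lagrangian G W.
Let TD := total_sp (atl N) D.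
Let TS := total_sp (atl N) (dualb D).
(* The four hypotheses on [Lam] are all that is needed of the constrained
   Tulczyjew differential. *)
Variables (Lam : {n : N & D n} -> tangent_vec TS) (xi : forall e : {n : N & D n}, dualb D (projT1 e)).
Hypothesis LamE : forall e, (Lam e).1 = existT _ (projT1 e) (xi e).
Hypothesis xiE : forall e d, xi e d = G (projT1 e) (projT2 e) d.
Hypothesis Lam_base : forall e (h : N -> R), smoothc (atl N) (projT1 e) h ->
  dT (fun q : {n : N & dualb D n} => h (projT1 q)) (Lam e) =
  dT h ((projT1 e, anchor_left eps (projT1 e) (projT2 e)) : tangent_vec (atl N)).
Hypothesis Lam_iota : forall (Z Y : sect D) n, smooth_sect Z -> smooth_sect Y ->
  dT (iota_sect Y) (Lam (existT _ n (Z n))) =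
  G n (Z n) (abracket eps Z Y n) +
  dT (fun m => l (existT _ m (Z m))) ((n, anchor_right eps n (Y n)) : tangent_vec (atl N)).

Let okN := manifold_atlas N.
Let okD := total_atlas (vbP D).
Let okS := total_atlas (dual_vbundle (vbP D)).
Let leg e := (Lam e).1.

Let leg_base e : projT1 (leg e) = projT1 e.
Proof. by rewrite /leg LamE. Qed.

Definition gram (k : fidx D) (n : N) : 'M[R]_(vb_rank D) :=
  \matrix_(a, b) G n (frm k a n) (frm k b n).

(** A row in the kernel is the coordinate row of a vector of norm zero. *)
Lemma gram_unit k n : fdom k n -> gram k n \in unitmx.
Proof.
move=> kn; have bk := vb_basis (vbP D) kn.
rewrite -row_free_unit; apply: inj_row_free => y y0.
pose v := \sum_a y 0 a *: frm k a n.
have Gv : G n v v = 0.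
  rewrite {2}/v metric_sumr big1// => b _.
  have -> : G n v (frm k b n) = (y *m gram k n) 0 b.
    by rewrite /v metric_suml mxE; apply: eq_bigr => a _; rewrite mxE.
  by rewrite y0 mxE mulr0.
have v0 : v = 0.
  apply/eqP; apply: contraT => v0; have := metric_pos G v0.
  by rewrite Gv ltxx.
by rewrite -(fcoordK bk y) -/v v0; apply/rowP => b; rewrite !mxE linear0.
Qed.

(* The Legendre map [d |-> G d _] in the charts defined by [c] and [k], and its inverse. *)
Let psi (c : cidx (atl N)) (k : fidx D) (y : 'rV[R]_(cdim (atl N) + vb_rank D)) :
    'rV[R]_(cdim (atl N) + vb_rank D) :=
  row_mx (lsubmx y) (rsubmx y *m gram k (cinv c (lsubmx y))).
Let ipsi (c : cidx (atl N)) (k : fidx D) (y : 'rV[R]_(cdim (atl N) + vb_rank D)) :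
    'rV[R]_(cdim (atl N) + vb_rank D) :=
  row_mx (lsubmx y) (rsubmx y *m invmx (gram k (cinv c (lsubmx y)))).

Let gram_sm c k (y : 'rV[R]_(cdim (atl N) + vb_rank D)) n a b : cdom c n -> fdom k n ->
  lsubmx y = cmap c n -> smooth_at y (fun z : 'rV[R]_(cdim (atl N) + vb_rank D) => gram k (cinv c (lsubmx z)) a b).
Proof.
move=> cn kn yn.
apply: (@smooth_at_compR _ _ _ _ (fun z : 'rV[R]_(cdim (atl N) + vb_rank D) => lsubmx z) (fun z => gram k (cinv c z) a b)).
  exact: lsubmx_smooth.
rewrite yn; under eq_fun do rewrite mxE.
exact: ((smoothc_chart okN (fun n => G n (frm k a n) (frm k b n)) cn).2 (metric_sm G a b kn)).
Qed.

Let psi_sm c k (y : 'rV[R]_(cdim (atl N) + vb_rank D)) n : cdom c n -> fdom k n ->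
  lsubmx y = cmap c n -> smooth_at y (psi c k).
Proof.
move=> cn kn yn; apply: smooth_at_row_mx; first exact: lsubmx_smooth.
apply: smooth_at_mulmx; first exact: rsubmx_smooth.
by move=> a b; exact: (gram_sm a b cn kn yn).
Qed.

Let ipsi_sm c k (y : 'rV[R]_(cdim (atl N) + vb_rank D)) n : cdom c n -> fdom k n ->
  lsubmx y = cmap c n -> smooth_at y (ipsi c k).
Proof.
move=> cn kn yn; apply: smooth_at_row_mx; first exact: lsubmx_smooth.
apply: smooth_at_mulmx; first exact: rsubmx_smooth.
move=> a b; apply: smooth_at_invmx.
  by rewrite yn (ao_mapK okN cn) gram_unit.
by move=> a' b'; exact: (gram_sm a' b' cn kn yn).
Qed.

Let leg_chart (c : cidx (atl N)) (k : fidx D) e : cdom c (projT1 e) -> fdom k (projT1 e) ->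
  cmap ((c, k) : cidx TS) (leg e) = psi c k (cmap ((c, k) : cidx TD) e).
Proof.
case: e => n d /= cn kn; rewrite /leg LamE /psi /= row_mxKl row_mxKr (ao_mapK okN cn).
congr (row_mx _ _); apply/rowP => b.
have bk := vb_basis (vbP D) kn.
have H : xi (existT _ n d) (frm k b n) = G n d (frm k b n) by exact: (@xiE (existT _ n d)).
transitivity (G n d (frm k b n)); first by rewrite -H; exact: fcoord_dual.
rewrite /= -{1}(sum_fcoord bk d) metric_suml mxE.
by apply: eq_bigr => a _; rewrite [in RHS]mxE; congr (_ * _); rewrite mxE.
Qed.

Let sol (I : set R) (gamma : R -> {n : N & D n}) : Prop :=
  smooth_curve TD I gamma /\ forall t, I t -> tprol TS (leg \o gamma) t = Lam (gamma t).

Lemma solution_derive (I : set R) gamma t (g : {n : N & dualb D n} -> R) :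
  open I -> sol I gamma -> I t -> smoothc TS (leg (gamma t)) g ->
  is_derive t 1 (fun s => g (leg (gamma s))) (dT g (Lam (gamma t))).
Proof.
move=> oI [sg Hg] It sgg; rewrite -Hg//.
set n := projT1 (gamma t); set c := chart_at (atl N) n; set k := frame_at D n.
have cn : cdom c n by exact: (ao_at okN).
have kn : fdom k n by exact: (vb_at (vbP D)).
have Ech : chart_at TS (leg (gamma t)) = ((c, k) : cidx TS).
  by rewrite /leg LamE.
have [oJ sJ] := sg ((c, k) : cidx TD).
have Jt : (I `&` gamma @^-1` (@cdom _ _ TD (c, k))) t by [].
have nJ : \forall s \near t, (I `&` gamma @^-1` (@cdom _ _ TD (c, k))) s.
  by apply: open_nbhs_nbhs.
have s1 : smooth_at t (cmap ((c, k) : cidx TD) \o gamma) := (smooth_onP _ oJ).1 sJ t Jt.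
have sp : smooth_at ((cmap ((c, k) : cidx TD) \o gamma) t) (psi c k).
  by apply: (psi_sm cn kn); rewrite /= row_mxKl.
apply: tprol_derive => //; rewrite Ech.
  by apply: filterS nJ => s [Is [cs ks]]; split; rewrite /= leg_base.
(* The equation of solutions fixes the value of [derive1], which is defined for any curve;
   differentiability comes from that of [gamma] and the smoothness of the Legendre map. *)
apply: smooth_at_diff; apply: smooth_at_ext (smooth_at_comp s1 sp).
by apply: filterS nJ => s [Is [cs ks]]; rewrite /= -leg_chart.
Qed.

Lemma phase_constant_solutions (g : {n : N & dualb D n} -> R) (I : set R) gamma :
  (forall q, smoothc TS q g) -> (forall e, dT g (Lam e) = 0) ->
  open I -> is_interval I -> sol I gamma ->
  forall s t, I s -> I t -> g (leg (gamma s)) = g (leg (gamma t)).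
Proof.
move=> sg g0 oI iI sgm; apply: (constant_on_interval (F := fun t => g (leg (gamma t)))) => //.
by move=> t It; have := solution_derive oI sgm It (sg _); rewrite g0.
Qed.

Lemma metric_sect_sm (X Y : sect D) p : smooth_sect_at p X -> smooth_sect_at p Y ->
  smoothc (atl N) p (fun m => G m (X m) (Y m)).
Proof.
move=> sX sY; have kp := vb_at (vbP D) p; set k := frame_at D p in kp.
apply: (smoothc_ext (g := fun m => \sum_a fcoord k (X m) 0 a *
   \sum_b fcoord k (Y m) 0 b * G m (frm k a m) (frm k b m))).
  apply/nearcM; apply: filterS (fdom_near kp) => m km; have bm := vb_basis (vbP D) km.
  rewrite -[in RHS](sum_fcoord bm (X m)) metric_suml; apply: eq_bigr => a _.
  by rewrite -[in RHS](sum_fcoord bm (Y m)) metric_sumr.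
apply: smoothc_sum => a; apply: smoothc_mul; first exact: sX.
by apply: smoothc_sum => b; apply: smoothc_mul; [exact: sY|exact: metric_sm].
Qed.

Let smoothc_lsub (f : N -> R) c n (y : 'rV[R]_(cdim (atl N) + vb_rank D)) : smoothc (atl N) n f -> cdom c n ->
  lsubmx y = cmap c n ->
  smooth_at y (fun z : 'rV[R]_(cdim (atl N) + vb_rank D) => f (cinv c (lsubmx z))).
Proof.
move=> sf cn yn; have H : smooth_at (lsubmx y) (f \o cinv c).
  by rewrite yn; apply: (smoothc_chart okN f cn).2.
by have [] := derive_lsubmx 0 0 H.
Qed.

(** * Local existence of solutions *)

Section local_solution.
Variables (c : cidx (atl N)) (k : fidx D) (F : 'I_(vb_rank D) -> sect D).
Hypothesis sF : forall a, smooth_sect (F a).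

(* The coefficients of the dynamics as a vector field on the dual bundle; they
   come from evaluating [Lam] on coordinates of the base and on the functions
   [iota_sect (F b)], where [F] extends the local frame [k]. *)
Let A i a m := dT (fun m' => cmap c m' 0 i) ((m, anchor_left eps m (F a m)) : tangent_vec (atl N)).
Let B b a a' m := G m (F a m) (abracket eps (F a') (F b) m) +
  2^-1 * dT (fun m' => G m' (F a m') (F a' m')) ((m, anchor_right eps m (F b m)) : tangent_vec (atl N)).
Let C b m := dT W ((m, anchor_right eps m (F b m)) : tangent_vec (atl N)).

Let vel (z : 'rV[R]_(cdim (atl N) + vb_rank D)) : 'rV[R]_(vb_rank D) :=
  rsubmx z *m invmx (gram k (cinv c (lsubmx z))).

(** The coordinates [z] are position and momenta, and [vel z] recovers the velocity by the inverse
    Gram matrix. *)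
Definition hamilton_field (z : 'rV[R]_(cdim (atl N) + vb_rank D)) : 'rV[R]_(cdim (atl N) + vb_rank D) :=
  let n := cinv c (lsubmx z) in
  row_mx (\row_i \sum_a vel z 0 a * A i a n)
    (\row_b (\sum_a \sum_a' vel z 0 a * vel z 0 a' * B b a a' n - C b n)).

Lemma hamilton_field_smooth n (z : 'rV[R]_(cdim (atl N) + vb_rank D)) : cdom c n -> fdom k n ->
  lsubmx z = cmap c n -> smooth_at z hamilton_field.
Proof.
move=> cn kn zn.
have sFn a := (smooth_sect_atP (F a)).1 (sF a) n.
have sv a : smooth_at z (fun z => vel z 0 a).
  apply: smooth_at_coord; apply: smooth_at_mulmx; first exact: rsubmx_smooth.
  move=> a1 b1; apply: smooth_at_invmx.
    by rewrite zn (ao_mapK okN cn) gram_unit.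
  by move=> a' b'; exact: (gram_sm a' b' cn kn zn).
apply: smooth_at_row_mx; apply: smooth_at_row => b; under eq_fun do rewrite mxE.
  apply: smooth_at_sum => a _; apply: smooth_at_mul => //.
  apply: (@smoothc_lsub (A b a) c n z) => //; apply: anchor_dT_sm => //; first exact: rho_smooth.
  by apply: smooth_at_coord; exact: smoothc_chart_map.
apply: smooth_at_sub.
  apply: smooth_at_sum => a _; apply: smooth_at_sum => a' _.
  apply: smooth_at_mul; first exact: smooth_at_mul.
  apply: (@smoothc_lsub (B b a a') c n z) => //; apply: smoothc_add.
    apply: metric_sect_sm => //; apply: (smooth_sect_atP _).1; exact: bracket_smooth.
  apply: smoothc_mul; first exact: smoothc_cst.
  apply: anchor_dT_sm => //; first exact: sigma_smooth.
  exact: metric_sect_sm.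
apply: (@smoothc_lsub (C b) c n z) => //; apply: anchor_dT_sm => //.
exact: sigma_smooth.
Qed.

(** Constant coefficients make the bracket linear without Leibniz terms, and the kinetic energy
    along the section a constant combination of the functions [g a a']. *)
Lemma Lam_iota_frame (y : 'rV[R]_(vb_rank D)) n b :
  dT (iota_sect (F b)) (Lam (existT _ n (\sum_a y 0 a *: F a n))) =
  \sum_a \sum_a' y 0 a * y 0 a' * B b a a' n - C b n.
Proof.
pose Z : sect D := fun m => \sum_a y 0 a *: F a m.
have sZa a : smooth_sect (fun m => y 0 a *: F a m).
  by apply: smooth_sect_scale => // q; exact: smoothc_cst.
have sZ : smooth_sect Z by exact: smooth_sect_sum.
rewrite (Lam_iota n sZ (sF b)).
have brZ a : abracket eps (fun m => y 0 a *: F a m) (F b) n = y 0 a *: abracket eps (F a) (F b) n.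
  have := bracket_linearl eps (y 0 a) (sF a) (@smooth_sect0 R N D) (sF b) n.
  rewrite bracket0l// addr0 => <-; congr (abracket eps _ (F b) n).
  by apply: sect_ext => m; rewrite addr0.
have -> : abracket eps Z (F b) n = \sum_a y 0 a *: abracket eps (F a) (F b) n.
  by rewrite bracket_suml//; apply: eq_bigr => a _.
have -> : G n (Z n) (\sum_a y 0 a *: abracket eps (F a) (F b) n) =
  \sum_a \sum_a' y 0 a * y 0 a' * G n (F a n) (abracket eps (F a') (F b) n).
  rewrite metric_suml; apply: eq_bigr => a _; rewrite metric_sumr mulr_sumr.
  by apply: eq_bigr => a' _; rewrite mulrA.
pose g a a' m := G m (F a m) (F a' m).
have sg a a' : smoothc (atl N) n (g a a').
  by apply: metric_sect_sm; apply: (smooth_sect_atP _).1.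
have sgy a a' : smoothc (atl N) n (fun m => 2^-1 * (y 0 a * y 0 a') * g a a' m).
  by apply: smoothc_mul => //; exact: smoothc_cst.
set u := anchor_right eps n (F b n).
have -> : dT (fun m => l (existT _ m (Z m))) ((n, u) : tangent_vec (atl N)) =
   dT (fun m => \sum_a \sum_a' 2^-1 * (y 0 a * y 0 a') * g a a' m + (-1) * W m) ((n, u) : tangent_vec (atl N)).
  apply: dT_ext; apply: nearcW => m; rewrite /l /mechanical_lagrangian /= mulN1r; congr (_ - _).
  rewrite metric_suml mulr_sumr; apply: eq_bigr => a _.
  rewrite metric_sumr !mulr_sumr; apply: eq_bigr => a' _.
  by rewrite !mulrA.
have s2 : smoothc (atl N) n (fun m => \sum_a \sum_a' 2^-1 * (y 0 a * y 0 a') * g a a' m).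
  by apply: smoothc_sum => a; apply: smoothc_sum => a'.
have s3 : smoothc (atl N) n (fun m => (-1) * W m) by apply: smoothc_mul => //; exact: smoothc_cst.
rewrite dT_add// dT_sum; last by move=> a; apply: smoothc_sum => a'.
rewrite dT_mul//; last exact: smoothc_cst.
rewrite dT_cst mulr0 addr0 mulN1r addrA; congr (_ - _).
rewrite -big_split /=; apply: eq_bigr => a _.
rewrite dT_sum; last by move=> a'; exact: sgy.
rewrite -big_split /=; apply: eq_bigr => a' _.
rewrite dT_mul//; last exact: smoothc_cst.
by rewrite dT_cst mulr0 addr0 /B -/u /g; ring.
Qed.

(** The last clause compares germs, because the fibre coordinates are to be replaced by
    [iota_sect (F b)] under a derivative. *)
Let good (z : 'rV[R]_(cdim (atl N) + vb_rank D)) : Prop :=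
  let n := cinv c (lsubmx z) in
  [/\ cdom c n, cmap c n = lsubmx z, fdom k n & forall a, \forall m \near n, F a m = frm k a m].

Let good_ipsi z : good z ->
  cmap ((c, k) : cidx TD) (cinv ((c, k) : cidx TD) (ipsi c k z)) = ipsi c k z.
Proof.
by move=> [cn zz kn _]; apply: (total_cinvK (vbP D)); rewrite /ipsi row_mxKl.
Qed.

Let velocity z := @cinv _ _ TD (c, k) (ipsi c k z).

Let velocityE z : velocity z =
  existT _ (cinv c (lsubmx z)) (\sum_a vel z 0 a *: frm k a (cinv c (lsubmx z))).
Proof. by rewrite /velocity /= /ipsi row_mxKl row_mxKr. Qed.

Let velocity_dom z : good z -> cdom ((c, k) : cidx TD) (velocity z).
Proof. by move=> [cn _ kn _]; rewrite velocityE; split. Qed.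

Let leg_velocity_dom z : good z -> cdom ((c, k) : cidx TS) (leg (velocity z)).
Proof. by move=> [cn _ kn _]; split; rewrite /= leg_base velocityE. Qed.

Let leg_velocity z : good z -> cmap ((c, k) : cidx TS) (leg (velocity z)) = z.
Proof.
move=> gz; have [cn zz kn _] := gz.
rewrite leg_chart; try by rewrite velocityE.
rewrite good_ipsi// /psi /ipsi row_mxKl row_mxKr mulmxKV ?gram_unit//.
exact: hsubmxK.
Qed.

Let Lam_field z : good z -> dT (cmap ((c, k) : cidx TS)) (Lam (velocity z)) = hamilton_field z.
Proof.
move=> gz; have [cn zz kn Fk] := gz; set n := cinv c (lsubmx z) in cn zz kn Fk.
have Fn a : F a n = frm k a n by exact: nbhs_singleton (Fk a).
have Ev : velocity z = existT _ n (\sum_a vel z 0 a *: F a n).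
  by rewrite velocityE -/n; congr (existT _ _ _); apply: eq_bigr => a _; rewrite Fn.
have Lb : projT1 (leg (velocity z)) = n by rewrite leg_base Ev.
have cS : cdom ((c, k) : cidx TS) (leg (velocity z)) by split; rewrite /= Lb.
rewrite [Lam _]surjective_pairing -/(leg _); set v := (Lam _).2.
have sc := smoothc_chart_map okS cS.
apply/rowP => i; rewrite dT_coord//; case: (split_ordP i) => b ->.
  rewrite row_mxEl mxE.
  have -> : dT (fun q => cmap ((c, k) : cidx TS) q 0 (lshift (vb_rank D) b)) ((leg (velocity z), v) : tangent_vec TS)
     = dT (fun q : {n : N & dualb D n} => cmap c (projT1 q) 0 b) (Lam (velocity z)).
    by rewrite [in RHS](surjective_pairing (Lam _)); apply: dT_ext; apply: nearcW => q; rewrite /= row_mxEl.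
  rewrite (Lam_base (h := fun m => cmap c m 0 b)); last first.
    by apply: smooth_at_coord; apply: (smoothc_chart_map okN); rewrite velocityE.
  rewrite Ev [projT2 _]/= linear_sum.
  have -> : \sum_a anchor_left eps n (vel z 0 a *: F a n) = \sum_a vel z 0 a *: anchor_left eps n (F a n).
    by apply: eq_bigr => a _; rewrite linearZ.
  rewrite dT_sumv//; apply: smooth_at_coord; exact: (smoothc_chart_map okN).
rewrite row_mxEr mxE -Lam_iota_frame -Ev.
rewrite [in RHS](surjective_pairing (Lam _)); apply: dT_ext.
have nF : \forall m \near projT1 (leg (velocity z)), fdom k m /\ F b m = frm k b m.
  by rewrite Lb; apply: filterI (fdom_near kn) (Fk b).
apply: nearcS (nearc_base nF) => q [kq Fq].
by rewrite /= row_mxEr (fcoord_dual (vb_basis (vbP D) kq)) /iota_sect Fq.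
Qed.

(** The equation is solved for the momenta, starting at the Legendre image of [e0]; [velocity]
    carries the solution back to [D]. *)
Lemma local_solution (e0 : {n : N & D n}) :
  cdom c (projT1 e0) -> fdom k (projT1 e0) ->
  (forall a, \forall m \near projT1 e0, F a m = frm k a m) ->
  exists d, exists gamma : R -> {n : N & D n},
    [/\ 0 < d, gamma 0 = e0 & sol [set t : R | -d < t < d] gamma].
Proof.
move=> c0 k0 F0; set n0 := projT1 e0 in c0 k0 F0.
pose z0 : 'rV[R]_(cdim (atl N) + vb_rank D) := cmap ((c, k) : cidx TS) (leg e0).
have z0E : lsubmx z0 = cmap c n0 by rewrite row_mxKl leg_base.
have v0 : velocity z0 = e0.
  rewrite /velocity /z0 leg_chart// /ipsi /psi row_mxKl row_mxKr row_mxKl.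
  rewrite (ao_mapK okN c0) mulmxK ?gram_unit//.
  by rewrite -[X in row_mx X _](row_mxKl _ (fcoord k (projT2 e0))) hsubmxK; exact: (ao_mapK okD (c := (c, k))).
have ng : \forall z \near z0, good z /\ smooth_at z hamilton_field.
  (* Agreement near [n0] is agreement near every point close to [n0], as [good] demands along the
     whole curve. *)
  have nF : \forall m \near n0, forall a, \forall m' \near m, F a m' = frm k a m'.
    by apply: (@filter_forall _ _ _ (nbhs n0) (nbhs_filter n0)) => a; exact: near_join (F0 a).
  have ct : {for z0, continuous (fun z : 'rV[R]_(cdim (atl N) + vb_rank D) => lsubmx z)}.
    exact: smooth_at_cont (lsubmx_smooth _).
  have n1 : \forall z \near z0, let n := cinv c (lsubmx z) in
      [/\ cdom c n, cmap c n = lsubmx z & cdom c n].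
    apply: (near_comp (f := fun z : 'rV[R]_(cdim (atl N) + vb_rank D) => lsubmx z)
      (P := fun z => [/\ cdom c (cinv c z), cmap c (cinv c z) = z & cdom c (cinv c z)])) => //.
    by rewrite z0E; exact: (ao_near okN c0 c0).
  have n2 : \forall z \near z0, (fun n => fdom k n /\ forall a, \forall m' \near n, F a m' = frm k a m')
      (cinv c (lsubmx z)).
    apply: (near_comp (f := fun z : 'rV[R]_(cdim (atl N) + vb_rank D) => lsubmx z)
      (P := fun z => (fun n => fdom k n /\ forall a, \forall m' \near n, F a m' = frm k a m') (cinv c z))) => //.
    rewrite z0E; apply: (nearc_chart (Q := fun n => fdom k n /\ forall a, \forall m' \near n, F a m' = frm k a m') okN c0).
    apply/nearcM; exact: filterI (fdom_near k0) nF.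
  have n3 := smooth_at_near (hamilton_field_smooth c0 k0 z0E).
  apply: filterS3 n1 n2 n3 => z [cz zz _] [kz Fz] sz.
  by split.
have [U [oU Uz HU]] := open_of_near ng.
have sU : smooth_on U hamilton_field by apply/smooth_onP => // z /HU [].
have [d [z [d0 zz sz dz]]] := ode_exists oU Uz sU.
pose I := [set t : R | -d < t < d].
have oI : open I by exact: open_centered_itv.
have gz t : I t -> good (z t) by move=> /dz [/HU []].
exists d, (velocity \o z); split => //; first by rewrite /= zz.
split.
  apply: (@smooth_curve_chart R _ TD I (velocity \o z) ((c, k) : cidx TD) okD oI).
    by move=> t /gz gzt; exact: velocity_dom.
  apply/smooth_onP => // t It; have [cn zn kn _] := gz t It.
  apply: (@smooth_at_ext _ _ _ _ (ipsi c k \o z)).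
    have n1 : \forall s \near t, I s by apply: open_nbhs_nbhs.
    by apply: filterS n1 => s Is; first [exact: (good_ipsi (gz s Is)) | exact: (esym (good_ipsi (gz s Is)))].
  apply: smooth_at_comp; first exact: ((smooth_onP _ oI).1 sz).
  by apply: (ipsi_sm cn kn); rewrite zn.
move=> t It; have [cn zn kn _] := gz t It.
rewrite [RHS]surjective_pairing /tprol; congr (_, _) => /=.
set q := leg (velocity (z t)); set ch := chart_at TS q.
have cS : cdom ((c, k) : cidx TS) q by exact: leg_velocity_dom (gz t It).
have qz : cmap ((c, k) : cidx TS) q = z t by exact: leg_velocity (gz t It).
have sch := ao_trans okS cS (ao_at okS q).
have dch := smooth_at_diff sch.
(* The equation for [z] holds in the chart [(c, k)], whereas tangent vectors at [q] are read in the
   chart chosen there; the transition map takes one to the other. *)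
rewrite -[RHS](dT_self okS q) (dT_chart okS _ cS dch).
have -> : dT (cmap ((c, k) : cidx TS)) ((q, (Lam (velocity (z t))).2) : tangent_vec TS) = hamilton_field (z t).
  by rewrite -Lam_field; [rewrite [in RHS](surjective_pairing (Lam _))|exact: gz].
have [_ [dzt dzE]] := dz t It.
have dz1 : differentiable z t by apply/derivable1_diffP.
rewrite -dzE qz -/ch; rewrite qz in dch; rewrite -(derive_comp _ dz1 dch) derive1E.
apply: near_eq_derive.
have n1 : \forall s \near t, I s by apply: open_nbhs_nbhs.
apply: filterS n1 => s Is; congr (cmap ch _).
rewrite -[in RHS](leg_velocity (gz s Is)) (ao_mapK okS)//.
exact: leg_velocity_dom (gz s Is).
Qed.

End local_solution.

Lemma first_integralP (g : {n : N & dualb D n} -> R) :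
  (forall q, smoothc (total_sp (atl N) (dualb D)) q g) ->
  (forall e, dT g (Lam e) = 0) <->
  (forall (I : set R) (gamma : R -> {n : N & D n}), open I -> is_interval I ->
    sol I gamma ->
    forall s t, I s -> I t -> g (leg (gamma s)) = g (leg (gamma t))).
Proof.
move=> sg; split=> [g0 I gamma oI iI sgm|H e].
  exact: (phase_constant_solutions sg g0 oI iI sgm).
have ce := ao_at (manifold_atlas N) (projT1 e).
have ke := vb_at (vbP D) (projT1 e).
have [F [sF FE]] := global_frame ke.
have [d [gamma [d0 g0 sgm]]] := local_solution sF ce ke FE.
set I := [set t : R | _] in sgm.
have oI : open I by exact: open_centered_itv.
have I0 : I 0 by rewrite /I /= oppr_lt0 d0.
have iI : is_interval I.
  move=> x y /andP[x1 _] /andP[_ y2] z /andP[xz zy].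
  by rewrite /I /= (lt_le_trans x1 xz) (le_lt_trans zy y2).
have dg := solution_derive oI sgm I0 (sg _).
rewrite -g0 -(@derive_val _ _ _ _ _ _ _ dg).
rewrite (near_eq_derive (g := cst (g (leg (gamma 0))))); first exact: derive_cst.
have nI : \forall s \near (0 : R), I s by apply: open_nbhs_nbhs.
by apply: filterS nI => s Is; apply: (H _ _ oI iI sgm).
Qed.

End mechanical_dynamics.

Theorem theorem5p3 (R : realType) (M : manifold R) (E : vbundle M)
  (eps : algebroid E) (G : bundle_metric E) (V : M -> R)
  (hV : smooth_fun (atl M) setT V)
  (DM : manifold R) (j : DM -> M) (hj : is_submanifold j)
  (D : vbundle DM) (i : forall n, 'Hom(D n, E (j n))) (hi : is_subbundle i)
  (hrho : maps_into_tangent i (anchor_left eps))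
  (hsigma : maps_into_tangent i (anchor_right eps))
  (P : forall n, 'Hom(E (j n), D n)) (hP : is_orthogonal_projection i G P)
  (epsP : algebroid D) (hepsP : is_nonholonomic_restriction i eps P epsP)
  (X : sect D) (hX : smooth_sect X)
  (f : DM -> R) (hf : smooth_fun (atl DM) setT f) :
  let L := mechanical_lagrangian G V in
  let l := fun e : {n : DM & D n} => L (bundle_incl i e) in
  let g := fun xi : {n : DM & dualb D n} => iota_sect X xi - f (projT1 xi) in
  (is_symmetry epsP l X f <-> constant_on_phase_dynamics i eps L g) /\
  (constant_on_phase_dynamics i eps L g <->
   constant_on_solutions i eps L (fun e => g (legendre_nh i eps L e))).
Proof.
move=> L l g.
have sV p : smoothc (atl M) p V by apply: ((smooth_funP _ openT).1 hV).
have sf n : smoothc (atl DM) n f by apply: ((smooth_funP _ openT).1 hf).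
split; first exact: (symmetry_iff_phase sV hj hi hP hepsP hX sf).
have sg q : smoothc (total_sp (atl DM) (dualb D)) q g.
  have s1 : smoothc (total_sp (atl DM) (dualb D)) q (iota_sect X).
    by apply: iota_sm; exact: (smooth_sect_atP X).1.
  exact: (smoothc_sub s1 (dT_base (F := dualb D) (q := q) 0 (sf _)).1).
have Lam_iota : forall (Z Y : sect D) n, smooth_sect Z -> smooth_sect Y ->
    dT (iota_sect Y) (Lambda i eps L (existT _ n (Z n))) =
    induced_metric G hj hi n (Z n) (abracket epsP Z Y n) +
    dT (fun m => mechanical_lagrangian (induced_metric G hj hi) (V \o j) (existT _ m (Z m)))
      ((n, anchor_right epsP n (Y n)) : tangent_vec (atl DM)).
  by move=> Z Y n sZ sY; exact: (Lambda_iota sV hj hi hP hepsP n sZ sY).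
(* Seen from [D], [Lambda] satisfies the relations of a mechanical system for [epsP], the induced
   metric and the restricted potential, which is all that this equivalence asks. *)
have [bc cb] := @first_integralP R DM D epsP (induced_metric G hj hi) (V \o j) (potential_restr_sm sV hj)
  (Lambda i eps L) (fun e => projT2 (legendre_nh i eps L e)) (fun=> erefl)
  (fun e d => legendre_fibre eps G sV i (e := e) d) (fun e h sh => Lambda_base G V hj hi hepsP sh) Lam_iota g sg.
split=> [c I gamma oI iI sol|c _ [e _ <-]].
  by apply: (bc _ I gamma oI iI sol) => e; apply: c; exists e.
exact: cb c e.
Qed.
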